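(* Let $T>0$, let $l_S,l_A$ be lines through the origin of $\mathbb R^2$, let $V_1\le V_2$ be two positively homogeneous $C^1$-functions of degree $2$ on $\mathbb R^2$ (in the sense of the context), let $g:[0,T]\times\mathbb R^2\to\mathbb R^2$ be of the form $$g(t,z)=(1-\gamma(t,z))\nabla V_1(z)+\gamma(t,z)\nabla V_2(z)$$ for some $L^2$-Carathéodory function $\gamma:[0,T]\times\mathbb R^2\to[0,1]$, and let $p:[0,T]\times\mathbb R^2\to\mathbb R^2$ be a Carathéodory function such that for every compact set $K\subset\mathbb R^2$ there is $\ell_K\in L^2(0,T)$ with $|p(t,z)|\le\ell_K(t)$ for a.e. $t\in[0,T]$ and all $z\in K$, and such that $$\lim_{|z|\to\infty}\frac{|p(t,z)|}{|z|}=0\quad\text{uniformly for a.e. } t\in[0,T].$$ If $T\notin\mathcal I$, where $\mathcal I$ is the resonance set defined in the context, then the boundary value problem $$Jz'=g(t,z)+p(t,z),\qquad z(0)\in l_S,\quad z(T)\in l_A$$ has at least one solution.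
   Context: $J=\begin{pmatrix}0&-1\\1&0\end{pmatrix}$; $\mathbb N=\{0,1,2,\dots\}$; solutions of differential systems are in the Carathéodory (absolutely continuous) sense. A $C^1$-function $V:\mathbb R^2\to\mathbb R$ is called positively homogeneous of degree $2$ if $0<V(\lambda z)=\lambda^2V(z)$ for every $\lambda>0$ and $z\ne0$. For such $V$, the origin is an isochronous center for $Jz'=\nabla V(z)$: all nontrivial solutions are periodic with the same minimal period $\tau_V=\int_0^{2\pi}\frac{d\theta}{2V(\cos\theta,\sin\theta)}$, and they rotate clockwise around the origin. Let $\varphi_V$ be the solution of $Jz'=\nabla V(z)$ with $V(\varphi_V(t))\equiv\frac12$ and $\varphi_V(0)=(0,y_0)$, $y_0>0$. Given the lines $l_S,l_A$ through the origin, define: - $\tau_{0,V}$: the least nonnegative time with $\varphi_V(\tau_{0,V})\in l_S$; - $\tau_{1,V}$: the least positive time with $\varphi_V(\tau_{0,V}+\tau_{1,V})\in l_A$; - $\sigma_{1,V}$: the least nonnegative time with $\varphi_V(\tau_{0,V}+\tau_{1,V}+\sigma_{1,V})\in l_S$; - $\tau_{2,V}$: the least positive time with $\varphi_V(\tau_{0,V}+\tau_{1,V}+\sigma_{1,V}+\tau_{2,V})\in l_A$; - $\sigma_{2,V}$: the least nonnegative time with $\varphi_V(\tau_{0,V}+\tau_{1,V}+\sigma_{1,V}+\tau_{2,V}+\sigma_{2,V})\in l_S$. For $k\in\mathbb N$ set $a_{2k}^1=k\tau_{V_2}+\tau_{1,V_2}$, $a_{2k}^2=k\tau_{V_2}+\tau_{2,V_2}$,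 $a_{2k+1}^1=k\tau_{V_2}+\tau_{1,V_2}+\tau_{2,V_2}+\sigma_{1,V_2}$, $a_{2k+1}^2=k\tau_{V_2}+\tau_{1,V_2}+\tau_{2,V_2}+\sigma_{2,V_2}$, $b_{2k}^1=k\tau_{V_1}+\tau_{1,V_1}$, $b_{2k}^2=k\tau_{V_1}+\tau_{2,V_1}$, $b_{2k+1}^1=k\tau_{V_1}+\tau_{1,V_1}+\tau_{2,V_1}+\sigma_{1,V_1}$, $b_{2k+1}^2=k\tau_{V_1}+\tau_{1,V_1}+\tau_{2,V_1}+\sigma_{2,V_1}$, and, for $j\in\mathbb N$, $\alpha_j=\min\{a_j^1,a_j^2\}$, $\beta_j=\max\{b_j^1,b_j^2\}$. The resonance set is $\mathcal I=\bigcup_{j\in\mathbb N}[\alpha_j,\beta_j]$. *)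

(* Defs.v *)
From HB Require Import structures.
From mathcomp Require Import all_boot all_order all_algebra.
From mathcomp Require Import all_classical all_reals all_analysis.
From mathcomp Require Import measurable_realfun.

Set Implicit Arguments.
Unset Strict Implicit.
Unset Printing Implicit Defensive.

Import Order.TTheory GRing.Theory Num.Theory.
Import numFieldNormedType.Exports.

Local Open Scope classical_set_scope.
Local Open Scope ring_scope.

(* The library's norm on [R * R] is the max norm, hence a separate Euclidean
   norm. *)
Definition enorm (R : realType) (z : R * R) : R :=
  Num.sqrt (z.1 ^+ 2 + z.2 ^+ 2).

Definition Jrot (R : realType) (z : R * R) : R * R := (- z.2, z.1).

Definition grad (R : realType) (V : R * R -> R) (z : R * R) : R * R :=
  ('D_((1, 0) : R * R) V z, 'D_((0, 1) : R * R) V z).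

Definition C1 (R : realType) (V : R * R -> R) : Prop :=
  (forall z, differentiable V z) /\ continuous (grad V).

Definition pos_homogeneous2 (R : realType) (V : R * R -> R) : Prop :=
  forall (lam : R) (z : R * R), 0 < lam -> z != 0 ->
    0 < V (lam *: z) /\ V (lam *: z) = lam ^+ 2 * V z.

Definition is_line (R : realType) (l : set (R * R)) : Prop :=
  exists2 v : R * R, v != 0 & l = [set c *: v | c in [set: R]].

Definition absolutely_continuous_on (R : realType) (a b : R) (f : R -> R * R)
    : Prop :=
  forall e : R, 0 < e -> exists2 d : R, 0 < d &
    forall (n : nat) (u v : 'I_n -> R),
      (forall i, a <= u i /\ u i <= v i /\ v i <= b) ->
      trivIset [set: 'I_n] (fun i => `]u i, v i[%classic) ->
      \sum_(i < n) (v i - u i) < d ->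
      \sum_(i < n) enorm (f (v i) - f (u i)) < e.

(* Caratheodory solutions of J z' = F(t, z) on [a, b] *)
Definition is_solution (R : realType) (F : R -> R * R -> R * R) (a b : R)
    (z : R -> R * R) : Prop :=
  absolutely_continuous_on a b z /\
  {ae lebesgue_measure, forall t : R, t \in `[a, b] ->
     derivable z t 1 /\ Jrot (derive1 z t) = F t (z t)}.

(* The library's sigma-algebra on [R] is the Borel one; measurability in the
   time variable is meant in the sense of Lebesgue, i.e. for the completed
   sigma-algebra (see [g_sigma_completed_algebra_genE]). *)
Definition lebesgue_measurable_fun (R : realType) (D : set R) (f : R -> R)
    : Prop :=
  @measurable_fun _ _
    (g_sigma_algebraType (completed_algebra_gen (@lebesgue_measure R))) R D f.

Definition caratheodory (R : realType) (T : R) (f : R -> R * R -> R) : Prop :=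
  (forall z, lebesgue_measurable_fun `[0, T]%classic (f ^~ z)) /\
  {ae lebesgue_measure, forall t : R, t \in `[0, T] -> continuous (f t)}.

Definition caratheodory2 (R : realType) (T : R) (f : R -> R * R -> R * R)
    : Prop :=
  caratheodory T (fun t z => (f t z).1) /\
  caratheodory T (fun t z => (f t z).2).

(* Taking [ell] Borel loses no generality: every class of L^2(0,T) has a Borel
   representative. *)
Definition L2_dominated_on_compacts (R : realType) (T : R)
    (N : R -> R * R -> R) : Prop :=
  forall K : set (R * R), compact K ->
    exists2 ell : R -> R,
      (ell \_ `[0, T]%classic) \in Lfun lebesgue_measure 2%:E &
      {ae lebesgue_measure, forall t : R, t \in `[0, T] ->
         forall z, K z -> N t z <= ell t}.

Definition L2_caratheodory (R : realType) (T : R) (f : R -> R * R -> R)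
    : Prop :=
  caratheodory T f /\ L2_dominated_on_compacts T (fun t z => `|f t z|).

Definition sublinear (R : realType) (T : R) (p : R -> R * R -> R * R) : Prop :=
  forall e : R, 0 < e -> exists M : R,
    {ae lebesgue_measure, forall t : R, t \in `[0, T] ->
       forall z, z != 0 -> M < enorm z -> enorm (p t z) / enorm z < e}.

Definition is_phi (R : realType) (V : R * R -> R) (f : R -> R * R) : Prop :=
  [/\ forall a b : R, a <= b -> is_solution (fun=> grad V) a b f,
      forall t, V (f t) = 2^-1,
      (f 0).1 = 0 &
      0 < (f 0).2].

(* Exists and is unique for V of class C^1 and positively homogeneous. *)
Definition phi (R : realType) (V : R * R -> R) : R -> R * R :=
  get [set f | is_phi V f].

Definition period (R : realType) (V : R * R -> R) : R :=
  \int[lebesgue_measure]_(theta in `[0, 2 * pi]%classic)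
     (2 * V (cos theta, sin theta))^-1.

Definition least (R : realType) (A : set R) : R := get (A `&` lbound A).

Definition hit_ge (R : realType) (f : R -> R * R) (l : set (R * R)) (s : R)
    : R :=
  least [set t : R | 0 <= t /\ l (f (s + t))].

Definition hit_gt (R : realType) (f : R -> R * R) (l : set (R * R)) (s : R)
    : R :=
  least [set t : R | 0 < t /\ l (f (s + t))].

Section Resonance.
Variables (R : realType) (lS lA : set (R * R)).

Definition tau0 (V : R * R -> R) : R := hit_ge (phi V) lS 0.
Definition tau1 (V : R * R -> R) : R := hit_gt (phi V) lA (tau0 V).
Definition sigma1 (V : R * R -> R) : R :=
  hit_ge (phi V) lS (tau0 V + tau1 V).
Definition tau2 (V : R * R -> R) : R :=
  hit_gt (phi V) lA (tau0 V + tau1 V + sigma1 V).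
Definition sigma2 (V : R * R -> R) : R :=
  hit_ge (phi V) lS (tau0 V + tau1 V + sigma1 V + tau2 V).

(* With V = V2 these are the a_j^1, a_j^2, with V = V1 the b_j^1, b_j^2;
   here j = 2 k or j = 2 k + 1 with k = j./2. *)
Definition time1 (V : R * R -> R) (j : nat) : R :=
  (j./2)%:R * period V +
  if odd j then tau1 V + tau2 V + sigma1 V else tau1 V.
Definition time2 (V : R * R -> R) (j : nat) : R :=
  (j./2)%:R * period V +
  if odd j then tau1 V + tau2 V + sigma2 V else tau2 V.

Definition alpha (V2 : R * R -> R) (j : nat) : R :=
  Num.min (time1 V2 j) (time2 V2 j).
Definition beta (V1 : R * R -> R) (j : nat) : R :=
  Num.max (time1 V1 j) (time2 V1 j).

Definition resonance_set (V1 V2 : R * R -> R) : set R :=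
  \bigcup_(j in [set: nat]) `[alpha V2 j, beta V1 j]%classic.

End Resonance.

(* Main.v *)
Require Import Defs.
From mathcomp Require Import all_boot all_order all_algebra.
From mathcomp Require Import all_classical all_reals all_analysis.
From mathcomp Require Import measurable_realfun ring lra.
Set Implicit Arguments.
Unset Strict Implicit.
Unset Printing Implicit Defensive.
Import Order.TTheory GRing.Theory Num.Theory.
Import numFieldNormedType.Exports.
Local Open Scope classical_set_scope.
Local Open Scope ring_scope.

(** Write [F = g + p], so that the system reads [z1' = F2], [z2' = - F1].  Along
    a solution the polar angle decreases with speed [<F, z> / |z|^2].  By Euler's
    identity [<grad V z, z> = 2 V z], and since [p] is sublinear, this speed lies,
    far from the origin, between [(1 - eta) 2 V1 e] and [(1 + eta) 2 V2 e], where
    [e] is the unit vector in the direction of [z] and [eta] is as small as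
    desired.  For the autonomous system [J z' = grad V z] the speed is exactly
    [2 V e].  A function [W] of the angle with derivative
    [1 / (2 V (cos th, sin th))] is therefore a clock ([is_clock]): the autonomous
    system needs the time [W a - W b] to turn clockwise from the angle [a] to the
    angle [b].  With angles [omS], [omA] of the two lines such that
    [omS - pi <= omA < omS], the times that define the resonance set become
    [W omS - W (omA - j pi)] and [W (omS - pi) - W (omA - pi - j pi)] ([time1E],
    [time2E]).

    Let [n] be the first index with [T < alpha V2 n].  As [T] is not resonant,
    [beta V1 (n - 1) < T] ([nonresonant_window]).  Comparing the rotation of a
    solution with the two clocks ([solution_rotation]) shows that a solution which
    starts far away at the angle [omS] has, at time [T], an angle strictly between
    [omA - n pi] and [omA - n pi + pi]; one which starts at [omS - pi] ends half a
    turn further.  Hence opposite starting points, far away on the line [lS], lead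
    to opposite sides of the line [lA] ([solution_side]), and by continuity some
    starting point between them should lead to [lA] itself.

    Solutions are not determined by their starting points, so the intermediate
    value theorem cannot be applied to them.  It is applied to the delayed
    equation, where [F] at time [t] is evaluated at the position at time [t - d]:
    its solutions are obtained by finitely many integrations and depend
    continuously on the starting point.  As [d] tends to zero they accumulate, by
    Tychonoff's theorem, a common modulus of continuity and dominated convergence,
    at solutions of the original equation ([delayed_limit], [shooting]).

    Two estimates reduce the problem to bounded right-hand sides.  By Gronwall's
    inequality, [ln (1 + |z|^2)] varies along a solution by at most a constant
    which does not depend on the solution ([solution_growth]).  Thus solutions
    that start at distance [c] stay far from the origin if [c] is large, and those
    that start within distance [c] stay in a disc outside of which [F] may be
    changed freely ([truncation_inactive]).

    Solutions are only absolutely continuous.  All differential inequalities are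
    integrated by one principle: an absolutely continuous function whose
    derivative is nonnegative almost everywhere is nondecreasing
    ([abscont_nondecreasing]).  It yields the existence of polar angles along
    solutions ([polar_lift]), Gronwall's inequality and the comparison with the
    clocks. *)

(** * Absolute continuity *)

(** Planar curves are treated one coordinate at a time, where sums, products and
    compositions make sense. *)
Definition abscont (R : realType) (a b : R) (f : R -> R) : Prop :=
  forall e : R, 0 < e -> exists2 d : R, 0 < d &
    forall (n : nat) (u v : 'I_n -> R),
      (forall i, a <= u i /\ u i <= v i /\ v i <= b) ->
      trivIset [set: 'I_n] (fun i => `]u i, v i[%classic) ->
      \sum_(i < n) (v i - u i) < d ->
      \sum_(i < n) `|f (v i) - f (u i)| < e.

Lemma normr_le_enorm (R : realType) (z : R * R) :
  (`|z.1| <= enorm z) * (`|z.2| <= enorm z).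
Proof. by split; rewrite /enorm -sqrtr_sqr ler_wsqrtr// ?lerDl ?lerDr sqr_ge0. Qed.

Lemma enorm_le_normrD (R : realType) (z : R * R) :
  enorm z <= `|z.1| + `|z.2|.
Proof.
rewrite -(ger0_norm (_ : 0 <= `|z.1| + `|z.2|)) ?addr_ge0// -sqrtr_sqr.
rewrite ler_wsqrtr// sqrrD !real_normK ?num_real// lerD2r lerDl.
by rewrite mulrn_wge0// mulr_ge0.
Qed.

Lemma enorm_ge0 (R : realType) (z : R * R) : 0 <= enorm z.
Proof. exact: sqrtr_ge0. Qed.

(** Sums, products, compositions with Lipschitz functions and the like are
    absolutely continuous because their increments are controlled by those of
    the given functions; three of these are enough below. *)
Lemma abscont_dominated (R : realType) (a b C : R) (f g h k : R -> R) :
  0 <= C -> abscont a b g -> abscont a b h -> abscont a b k ->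
  (forall u v, a <= u -> u <= v -> v <= b ->
     `|f v - f u| <= C * (`|g v - g u| + `|h v - h u| + `|k v - k u|)) ->
  abscont a b f.
Proof.
move=> C0 acg ach ack fgh e e0.
have e1 : 0 < e / (3 * (C + 1)) by rewrite divr_gt0// mulr_gt0// ltr_wpDl.
have [d1 d10 H1] := acg _ e1; have [d2 d20 H2] := ach _ e1.
have [d3 d30 H3] := ack _ e1.
exists (Num.min d1 (Num.min d2 d3)); first by rewrite !lt_min d10 d20.
move=> n u v uv tuv; rewrite !lt_min => /and3P[s1 s2 s3].
have {}H1 := H1 _ _ _ uv tuv s1; have {}H2 := H2 _ _ _ uv tuv s2.
have {}H3 := H3 _ _ _ uv tuv s3.
apply: (@le_lt_trans _ _ (C * (\sum_(i < n) `|g (v i) - g (u i)| +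
    \sum_(i < n) `|h (v i) - h (u i)| + \sum_(i < n) `|k (v i) - k (u i)|))).
  rewrite -!big_split/= mulr_sumr ler_sum// => i _.
  by have [? [? ?]] := uv i; apply: fgh.
apply: (@le_lt_trans _ _ (C * (3 * (e / (3 * (C + 1)))))).
  by apply: ler_wpM2l => //; lra.
rewrite [ltLHS](_ : _ = C / (C + 1) * e).
  by rewrite gtr_pMl// ltr_pdivrMr ?ltr_wpDl// mul1r ltrDl.
have C1 : C + 1 != 0 by rewrite gt_eqF// ltr_wpDl.
by field.
Qed.

Lemma absolutely_continuous_onP (R : realType) (a b : R) (z : R -> R * R) :
  absolutely_continuous_on a b z <->
  abscont a b (fun t => (z t).1) /\ abscont a b (fun t => (z t).2).
Proof.
split=> [acz|[ac1 ac2] e e0].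
  by split=> e e0; have [d d0 H] := acz _ e0; exists d => // n u v uv tuv s;
    apply: le_lt_trans (H _ _ _ uv tuv s); apply: ler_sum => i _;
    [have := (normr_le_enorm (z (v i) - z (u i))).1
    |have := (normr_le_enorm (z (v i) - z (u i))).2].
have e2 : 0 < e / 2 by rewrite divr_gt0.
have [d1 d10 H1] := ac1 _ e2; have [d2 d20 H2] := ac2 _ e2.
exists (Num.min d1 d2); first by rewrite lt_min d10.
move=> n u v uv tuv; rewrite lt_min => /andP[s1 s2].
have {}H1 := H1 _ _ _ uv tuv s1; have {}H2 := H2 _ _ _ uv tuv s2.
rewrite (splitr e) (le_lt_trans _ (ltrD H1 H2))// -big_split/= ler_sum// => i _.
exact: enorm_le_normrD.
Qed.

Lemma abscont_sub (R : realType) (a b c d : R) (f : R -> R) :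
  a <= c -> d <= b -> abscont a b f -> abscont c d f.
Proof.
move=> ac db acf e /acf[r r0 H]; exists r => // n u v uv; apply: H => i.
by have [? [? ?]] := uv i; split; [exact: le_trans ac _|split => //;
  exact: le_trans db].
Qed.

Lemma abscont_lipschitz (R : realType) (a b C : R) (f : R -> R) : 0 <= C ->
  (forall u v, a <= u -> u <= v -> v <= b -> `|f v - f u| <= C * (v - u)) ->
  abscont a b f.
Proof.
move=> C0 H e e0; exists (e / (C + 1)); first by rewrite divr_gt0// ltr_wpDl.
move=> n u v uv _ s; apply: (@le_lt_trans _ _ (C * \sum_(i < n) (v i - u i))).
  by rewrite mulr_sumr ler_sum// => i _; have [? [? ?]] := uv i; apply: H.
apply: le_lt_trans (_ : C * (e / (C + 1)) < e).
  by rewrite ler_wpM2l// ltW.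
by rewrite mulrCA gtr_pMr// ltr_pdivrMr ?ltr_wpDl// mul1r ltrDl.
Qed.

Lemma abscont_id (R : realType) (a b : R) : abscont a b idfun.
Proof.
by apply: (@abscont_lipschitz _ _ _ 1) => // u v _ uv _; rewrite mul1r ger0_norm ?subr_ge0.
Qed.

Lemma abscont_cst (R : realType) (a b c : R) : abscont a b (cst c).
Proof.
by apply: (@abscont_lipschitz _ _ _ 0) => // u v _ uv _; rewrite mul0r /cst subrr normr0.
Qed.

Lemma abscont_within (R : realType) (a b : R) (f : R -> R) : abscont a b f ->
  forall e, 0 < e -> exists2 d, 0 < d & forall x y, a <= x -> x <= y -> y <= b ->
    y - x < d -> `|f y - f x| < e.
Proof.
move=> acf e /acf[d d0 H]; exists d => // x y ax xy yb yx.
have := H 1%N (fun=> x) (fun=> y); rewrite !big_ord1; apply => //.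
move=> i j _ _ _; rewrite (ord1 i) (ord1 j) //.
Qed.

Lemma abscont_continuous_at (R : realType) (a b x : R) (f : R -> R) :
  a < x -> x < b -> abscont a b f -> {for x, continuous f}.
Proof.
move=> ax xb acf; apply/cvgrPdist_lt => e /(abscont_within acf)[d d0 H].
near=> y.
have ay : a <= y by apply/ltW; near: y; exact: lt_nbhsr.
have yb : y <= b by apply/ltW; near: y; exact: lt_nbhsl.
have : `|x - y| < d by near: y; exact: (@cvgr_dist_lt _ _ _ _ _ id).
have [xy|/ltW yx] := leP x y.
  by rewrite ler0_norm ?subr_le0// opprB => yd; rewrite distrC; apply: H => //; exact: ltW.
by rewrite ger0_norm ?subr_ge0// => yd; apply: H => //; exact: ltW.
Unshelve. all: by end_near. Qed.

Lemma measure_disjoint_itv (R : realType) (n : nat) (u v : 'I_n -> R) :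
  (forall i, u i <= v i) ->
  trivIset [set: 'I_n] (fun i => `]u i, v i[%classic) ->
  lebesgue_measure (\big[setU/set0]_(i < n) `]u i, v i[%classic) =
  (\sum_(i < n) (v i - u i))%:E.
Proof.
move=> uv tuv; rewrite measure_semi_additive_ord//; last exact: bigsetU_measurable.
rewrite -sumEFin; apply: eq_bigr => i _.
transitivity (lebesgue_measure `]u i, v i[%classic); first by [].
rewrite lebesgue_measure_itv/= lte_fin EFinD EFinN.
case: ltP => // vu; rewrite (_ : v i = u i) ?subee//.
by apply/eqP; rewrite eq_le vu uv.
Qed.

(** Fix [e] and an open set [U] of tiny measure that contains the exceptional
    null set, and sweep [a, b] from the left: at a point outside [U] the
    derivative keeps [G] from dropping faster than [e], while across [U] the drop
    is charged to finitely many disjoint intervals, on which absolute continuity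
    makes it small. *)
Theorem abscont_nondecreasing (R : realType) (a b : R) (G : R -> R) :
  a <= b -> abscont a b G ->
  {ae lebesgue_measure, forall t : R, t \in `[a, b] ->
     derivable G t 1 /\ 0 <= derive1 G t} ->
  G a <= G b.
Proof.
move=> ab acG [N0 [mN0 N00 subN]].
have [N [mN N0_ NN0]] : exists N : set R,
    [/\ measurable N, lebesgue_measure N = 0%E & N = N0] by exists N0.
rewrite -NN0 in subN => {NN0 mN0 N00 N0}.
apply/ler_addgt0Pr => e0 e00.
pose e := e0 / (b - a + 1).
have ba1 : 0 < b - a + 1 by rewrite ltr_wpDl// subr_ge0.
have e_gt0 : 0 < e by rewrite divr_gt0.
have [d d0 Hd] := acG _ e_gt0.
have [|U [oU NU UN]] := lebesgue_regularity_outer mN _ d0.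
  exact: (eq_ind_r (fun x => (x < +oo)%E) (ltry (0 : R)) N0_).
have mU : measurable U by exact: open_measurable.
have Ud : (lebesgue_measure U < d%:E)%E.
  have -> : U = (U `\` N) `|` N by rewrite setUC setDUK.
  rewrite measureU//=; first by rewrite [X in (_ + X)%E]N0_ adde0.
  - exact: measurableD.
  - by rewrite setDE -setIA setICl setI0.
(* [P x]: the sweep has reached [x], having charged the drop across [U] to the
   intervals from [u i] to [v i] *)
pose P x := exists n (u v : nat -> R),
  [/\ forall i, (i < n)%N ->
        [/\ a <= u i, u i <= v i, v i <= x & `]u i, v i[%classic `<=` U],
      forall i j, (i < j < n)%N -> v i <= u j &
      G a - G x <= e * (x - a) + \sum_(i < n) `|G (v i) - G (u i)| ].
pose S := [set x | a <= x <= b /\ P x].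
have Sa : S a.
  split; first by rewrite lexx ab.
  exists 0%N, (fun=> 0), (fun=> 0); split => //.
  by rewrite big_ord0 !subrr mulr0 addr0.
have supS : has_sup S by split; [exists a | exists b => x [/andP[]]].
set s := sup S.
have sab : a <= s <= b.
  apply/andP; split; first exact: ub_le_sup supS.2 _ Sa.
  by apply: ge_sup; [exists a | move=> x [/andP[]]].
(* one step of the sweep around [s] *)
have [r r0 step] : exists2 r, 0 < r & forall y x, a <= y -> y <= s -> s <= x ->
    x <= b -> s - r < y -> x < s + r -> P y -> P x.
  have [sU|sU] := pselect (U s).
    have [r /= r0 rU] := (open_subball oU sU).
    have [q [q0 qr qU]] : exists q, [/\ 0 < q, q < r & ball s q `<=` U].
      exists (r / 2); rewrite divr_gt0// gtr_pMr// invf_lt1// ltr1n; split => //.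
      apply: rU => //=; rewrite ?divr_gt0//= sub0r normrN gtr0_norm ?divr_gt0//.
      by rewrite gtr_pMr// invf_lt1// ltr1n.
    exists q => // y x ay ys sx xb yq xq [n [u [v [uv vu Gy]]]].
    exists n.+1, (fun i => if i == n then y else u i),
                 (fun i => if i == n then x else v i); split.
    - move=> i; rewrite ltnS leq_eqVlt => /predU1P[->|ni].
        rewrite eqxx; split => //; first exact: le_trans sx.
        move=> z /=; rewrite in_itv/= => /andP[yz zx]; apply: qU.
        by rewrite /ball/= ltr_distlC; apply/andP; split; lra.
      rewrite (ltn_eqF ni); have [? ? ? ?] := uv _ ni; split => //.
      by lra.
    - move=> i j /andP[ij]; rewrite ltnS leq_eqVlt => /predU1P[jn|jn].
        rewrite jn eqxx ltn_eqF -?jn//.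
        by have [] := uv i _ => //; rewrite -jn.
      by rewrite !ltn_eqF//; [apply: vu; rewrite ij|exact: ltn_trans jn].
    - rewrite big_ord_recr/= eqxx.
      under eq_bigr => i _ do rewrite ltn_eqF//.
      have := ler_norm (- (G x - G y)); rewrite normrN => Gxy.
      have : e * (y - a) <= e * (x - a).
        by rewrite ler_wpM2l ?(ltW e_gt0)// lerB// (le_trans ys).
      by lra.
  have [dG Gs] : derivable G s 1 /\ 0 <= derive1 G s.
    apply: contrapT => H; apply: sU; apply: NU; apply: subN => /=.
    by move=> /(_ _)H'; apply: H; apply: H'; rewrite in_itv/=.
  have : (fun h => h^-1 *: (G (h + s) - G s)) @ 0^' --> derive1 G s.
    move: dG => /cvg_ex[l lG].
    have -> : derive1 G s = l by rewrite derive1E; exact: cvg_lim lG.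
    apply: cvg_trans lG; apply: near_eq_cvg.
    by near=> h => /=; rewrite [h%:A]mulr1.
  move=> /cvgrPdist_lt /(_ _ e_gt0) /nbhs_ballP[r /= r0 rG].
  have Gr x : `|x - s| < r -> x != s -> - e < (G x - G s) / (x - s).
    move=> xs nxs.
    have /= := rG (x - s); rewrite /ball/= sub0r normrN subr_eq0 => /(_ xs nxs).
    rewrite subrK [_ *: _]mulrC ltr_distl => /andP[_].
    by rewrite -ltrBlDr; apply: le_lt_trans; rewrite lerBrDr addNr.
  exists r => // y x ay ys sx xb yq xq [n [u [v [uv vu Gy]]]].
  exists n, u, v; split => //.
    by move=> i ni; have [? ? ? ?] := uv _ ni; split => //; lra.
  have G1 : G y - G s <= e * (s - y).
    have [->|ys'] := eqVneq y s; first by rewrite !subrr mulr0.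
    have ys1 : y < s by rewrite lt_neqAle ys' ys.
    have := Gr y; rewrite ltr0_norm ?subr_lt0// opprB => /(_ _ ys').
    have ysr : s - y < r by lra.
    move=> /(_ ysr); rewrite ltr_ndivlMr ?subr_lt0//.
    by lra.
  have G2 : G s - G x <= e * (x - s).
    have [->|xs'] := eqVneq x s; first by rewrite !subrr mulr0.
    have xs1 : s < x by rewrite lt_neqAle eq_sym xs' sx.
    have := Gr x; rewrite gtr0_norm ?subr_gt0// => /(_ _ xs').
    have xsr : x - s < r by lra.
    move=> /(_ xsr); rewrite ltr_pdivlMr ?subr_gt0//.
    by lra.
  by lra.
have [y Sy sry] : exists2 y, S y & s - r < y by exact: sup_adherent.
have ys : y <= s by exact: ub_le_sup supS.2 _ Sy.
have [/andP[ay yb] Py] := Sy.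
have /andP[as_ sb] := sab.
have sb' : s = b.
  apply/eqP; rewrite eq_le sb leNgt; apply/negP => sb'.
  pose x := Num.min b (s + r / 2).
  have sx : s < x by rewrite lt_min sb' ltrDl divr_gt0.
  have Sx : S x.
    split; first by rewrite ge_min lexx/= (le_trans as_ (ltW sx)).
    apply: (step y) => //; [exact: ltW|by rewrite ge_min lexx|].
    by rewrite gt_min; apply/orP; right; rewrite ltrD2l gtr_pMr// invf_lt1// ltr1n.
  by have := ub_le_sup supS.2 Sx; rewrite leNgt sx.
have [n [u [v [uv vu Gb]]]] : P b.
  by apply: (step y) => //; rewrite ?sb' ?ltrDl// -sb'.
have tuv : trivIset [set: 'I_n] (fun i => `]u i, v i[%classic).
  move=> i j _ _ [x [/=]]; rewrite !in_itv/= => /andP[ux xv] /andP[ux' xv'].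
  apply: val_inj; case: (ltngtP (i : nat) (j : nat)) => // ij.
    have := vu i j; rewrite ij ltn_ord => /(_ isT) vij.
    by have := lt_trans ux' (lt_le_trans xv vij); rewrite ltxx.
  have := vu j i; rewrite ij ltn_ord => /(_ isT) vij.
  by have := lt_trans ux (lt_le_trans xv' vij); rewrite ltxx.
have := Hd n u v _ tuv.
have uvo (i : 'I_n) := uv i (ltn_ord i).
have sumd : \sum_(i < n) (v i - u i) < d.
  rewrite -lte_fin; apply: le_lt_trans Ud.
  rewrite -(@measure_disjoint_itv _ n u v)//; last by move=> i; have [] := uvo i.
  apply: le_measure; rewrite ?inE//; first exact: bigsetU_measurable.
  by rewrite -bigcup_seq => x [i _]; have [_ _ _] := uvo i; exact.
move=> /(_ _ sumd) H.
have {}H : \sum_(i < n) `|G (v i) - G (u i)| < e.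
  by apply: H => i; have [] := uvo i.
have : e * (b - a) + e = e0.
  by rewrite -[X in _ + X]mulr1 -mulrDr /e -mulrA mulVf ?mulr1 ?gt_eqF.
by lra.
Unshelve. all: by end_near. Qed.

(** * Primitives *)

Definition primitive (R : realType) (h : R -> R) (t : R) : R :=
  \int[lebesgue_measure]_(s in `]-oo, t]) h s.

Lemma primitive_sub (R : realType) (h : R -> R) (u v : R) :
  lebesgue_measure.-integrable [set: R] (EFin \o h) -> u <= v ->
  primitive h v - primitive h u = \int[lebesgue_measure]_(s in `]u, v]) h s.
Proof.
by move=> ih uv; rewrite /primitive Rintegral_itvB//; exact: integrableS ih.
Qed.

Lemma le_primitive_sub (R : realType) (h k : R -> R) (u v : R) :
  lebesgue_measure.-integrable [set: R] (EFin \o h) ->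
  lebesgue_measure.-integrable [set: R] (EFin \o k) ->
  (forall s, `|h s| <= k s) -> u <= v ->
  `|primitive h v - primitive h u| <= primitive k v - primitive k u.
Proof.
move=> ih ik hk uv; rewrite !primitive_sub//.
have ihuv : lebesgue_measure.-integrable `]u, v] (EFin \o h).
  exact: integrableS ih.
rewrite (le_trans (le_normr_Rintegral _ ihuv))//.
apply: le_Rintegral => //; last exact: integrableS ik.
exact: (integrable_norm ihuv).
Qed.

Lemma abscont_primitive (R : realType) (a b : R) (h : R -> R) :
  lebesgue_measure.-integrable [set: R] (EFin \o h) -> abscont a b (primitive h).
Proof.
move=> ih e e0; have [d [d0 Hd]] := integral_normr_continuous ih e0.
exists d => // n u v uv tuv sd.
pose D := \big[setU/set0]_(i < n) `]u i, v i[%classic.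
have mD : measurable D by exact: bigsetU_measurable.
have muD : (lebesgue_measure D < d%:E)%E.
  by rewrite /D measure_disjoint_itv// => i; have [_ []] := uv i.
have := Hd D mD muD; apply: le_lt_trans.
have iD : lebesgue_measure.-integrable D (EFin \o (fun x => `|h x|)).
  apply: (@integrableS _ _ _ lebesgue_measure [set: R]) => //.
  exact: (integrable_norm ih).
rewrite -lee_fin fineK; last exact: integrable_fin_num.
rewrite /D -sumEFin ge0_integral_bigsetU//=; last 3 first.
- exact: index_enum_uniq.
- by apply: sub_trivIset tuv.
- by move: iD => /(measurable_int lebesgue_measure); apply: measurable_funS.
apply: lee_sum => i _; have [_ [uvi _]] := uv i.
rewrite primitive_sub//.
have iuv : lebesgue_measure.-integrable `]u i, v i[ (EFin \o h).
  exact: integrableS ih.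
rewrite -Rintegral_itv_bndo_bndc//.
rewrite -[leRHS]fineK; last first.
  by apply: integrable_fin_num => //; exact: (integrable_norm iuv).
by rewrite lee_fin; exact: le_normr_Rintegral.
Qed.

Lemma primitive_ae_derivable (R : realType) (h : R -> R) :
  lebesgue_measure.-integrable [set: R] (EFin \o h) ->
  {ae lebesgue_measure, forall t : R,
    derivable (primitive h) t 1 /\ derive1 (primitive h) t = h t}.
Proof.
move=> ih; apply: FTC1Ny; first by move=> y; exact: integrableS ih.
by apply: open_integrable_locally => //; exact: openT.
Qed.

(** * One-variable calculus in pointwise form *)

Section pointwise_derivatives.
Context {R : realType}.
Implicit Types (f g : R -> R) (t a b : R).

Lemma is_derive_eq1 f t a b : is_derive t 1 f a -> a = b -> is_derive t 1 f b.
Proof. by move=> + <-. Qed.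

Lemma is_derive_addf f g t a b : is_derive t 1 f a -> is_derive t 1 g b ->
  is_derive t 1 (fun s => f s + g s) (a + b).
Proof. by move=> fa gb; exact: (is_deriveD fa gb). Qed.

Lemma is_derive_oppf f t a : is_derive t 1 f a ->
  is_derive t 1 (fun s => - f s) (- a).
Proof. by move=> fa; exact: (is_deriveN fa). Qed.

Lemma is_derive_subf f g t a b : is_derive t 1 f a -> is_derive t 1 g b ->
  is_derive t 1 (fun s => f s - g s) (a - b).
Proof. by move=> fa gb; exact: (is_deriveB fa gb). Qed.

Lemma is_derive_mulf f g t a b : is_derive t 1 f a -> is_derive t 1 g b ->
  is_derive t 1 (fun s => f s * g s) (a * g t + f t * b).
Proof.
move=> fa gb; apply: (is_derive_eq1 (is_deriveM fa gb)).
by rewrite addrC [_ *: a]mulrC.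
Qed.

Lemma is_derive_cstf t a : is_derive t 1 (fun=> a) 0.
Proof. exact: is_derive_cst. Qed.

Lemma is_derive_idf t : is_derive t 1 (fun s => s) 1.
Proof. exact: is_derive_id. Qed.

Lemma is_derive_compf f g t a b : is_derive (g t) 1 f a -> is_derive t 1 g b ->
  is_derive t 1 (fun s => f (g s)) (a * b).
Proof. exact: is_derive1_comp. Qed.

Lemma is_derive_sqrtf f t a : 0 < f t -> is_derive t 1 f a ->
  is_derive t 1 (fun s => Num.sqrt (f s)) (a / (2 * Num.sqrt (f t))).
Proof.
move=> f0 fa; rewrite mulrC.
exact: (is_derive_compf (is_derive1_sqrt f0) fa).
Qed.

Lemma is_derive_invf f t a : f t != 0 -> is_derive t 1 f a ->
  is_derive t 1 (fun s => (f s)^-1) (- a / f t ^+ 2).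
Proof.
move=> f0 fa; apply: (is_derive_eq1 (is_deriveV f0 fa)).
by rewrite /GRing.scale/= mulNr mulrC mulNr.
Qed.

Lemma is_derive_contf f t a : is_derive t 1 f a -> {for t, continuous f}.
Proof.
by move=> fa; apply/differentiable_continuous/derivable1_diffP; exact: ex_derive.
Qed.

Lemma is_derive_derive1 f t a : is_derive t 1 f a ->
  derivable f t 1 /\ derive1 f t = a.
Proof.
by move=> fa; split; [exact: ex_derive | rewrite derive1E; exact: derive_val].
Qed.

Lemma derivable_is_derive1 f t : derivable f t 1 ->
  is_derive t 1 f (derive1 f t).
Proof. by move=> /derivableP; rewrite derive1E. Qed.

Lemma mean_value f (df : R -> R) : (forall s : R, is_derive s 1 f (df s)) ->
  forall a b, a <= b -> exists2 c, a <= c <= b & f b - f a = df c * (b - a).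
Proof.
move=> Df a b ab.
have [c cab ->] := MVT_segment ab (fun x _ => Df x)
  (continuous_subspaceT (fun x => is_derive_contf (Df x))).
by exists c => //; move: cab; rewrite in_itv.
Qed.

(** Antiderivatives on the whole line: both orientations of the integral are
    kept, since only one of the two intervals is nonempty. *)
Lemma continuous_antiderivative (k : R -> R) : continuous k ->
  exists W : R -> R, forall x : R, is_derive x 1 W (k x).
Proof.
move=> ck.
have ik a b : lebesgue_measure.-integrable `[a, b] (EFin \o k).
  apply: continuous_compact_integrable; first exact: segment_compact.
  exact: continuous_subspaceT.
have iko a b : lebesgue_measure.-integrable `]a, b] (EFin \o k).
  by apply: integrableS (ik a b) => //; exact: subset_itv_oc_cc.
exists (fun y => \int[lebesgue_measure]_(s in `]0, y]) k s -
                 \int[lebesgue_measure]_(s in `]y, 0]) k s) => x.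
pose N : R := `|x| + 1.
have N0 : 0 < N by rewrite ltr_wpDl.
have xN : - N < x < N.
  by rewrite -ltr_norml /N ltrDl.
have /andP[Nx xN'] := xN.
pose F (y : R) := \int[lebesgue_measure]_(s in `[- N, y]) k s.
have FTC := @continuous_FTC1 R k (BLeft (- N)) x N xN' (ik _ _).
have [|dF F'] := FTC _ (ck x); first by rewrite lte_fin.
have DF : is_derive x 1 F (k x) by rewrite -F'; exact: derivable_is_derive1.
apply: (@near_eq_is_derive _ _ _ (fun y => F y - F 0)); last first.
  by rewrite -[k x]subr0; apply: is_derive_subf => //; exact: is_derive_cstf.
near=> y.
have Ny : - N <= y by apply: ltW; near: y; exact: lt_nbhsr.
have [y0|/ltW y0] := leP 0 y.
  rewrite /F Rintegral_itvB//; last by rewrite bnd_simp oppr_le0 ltW.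
  rewrite [X in _ - X](_ : _ = 0) ?subr0// set_itv_ge ?Rintegral_set0//.
  by rewrite bnd_simp -leNgt.
rewrite [X in _ = X - _](_ : _ = 0) ?sub0r; last first.
  by rewrite set_itv_ge ?Rintegral_set0// bnd_simp -leNgt.
by rewrite /F -opprB Rintegral_itvB// bnd_simp.
Unshelve. all: by end_near. Qed.

Lemma integral_antiderivative (k W : R -> R) (a b : R) : continuous k ->
  (forall x : R, is_derive x 1 W (k x)) -> a < b ->
  \int[lebesgue_measure]_(s in `[a, b]) k s = W b - W a.
Proof.
move=> ck DW ab; rewrite /Rintegral (continuous_FTC2 ab (F := W))//.
- exact: continuous_subspaceT.
- have cW : continuous W by move=> x; exact: is_derive_contf (DW x).
  split.
  + by move=> x _; exact: ex_derive.
  + by apply: cvg_at_right_filter; exact: cW.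
  + by apply: cvg_at_left_filter; exact: cW.
- by move=> x _; exact: (is_derive_derive1 (DW x)).2.
Qed.

End pointwise_derivatives.

(** * Polar angles along absolutely continuous curves *)

Lemma enorm_sqr (R : realType) (z : R * R) : enorm z ^+ 2 = z.1 ^+ 2 + z.2 ^+ 2.
Proof. by rewrite sqr_sqrtr// addr_ge0// sqr_ge0. Qed.

Lemma enorm_dist (R : realType) (z w : R * R) :
  `|enorm z - enorm w| <= `|z.1 - w.1| + `|z.2 - w.2|.
Proof.
have [/eqP|s0] := eqVneq (enorm z + enorm w) 0.
  rewrite paddr_eq0 ?enorm_ge0// => /andP[/eqP -> /eqP ->].
  by rewrite subrr normr0 addr_ge0.
have s_gt0 : 0 < enorm z + enorm w by rewrite lt_neqAle eq_sym s0 addr_ge0 ?enorm_ge0.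
rewrite -(ler_pM2r s_gt0) -[X in _ * X <= _]ger0_norm ?(ltW s_gt0)//.
rewrite -normrM -subr_sqr !enorm_sqr.
rewrite (_ : _ - _ = (z.1 - w.1) * (z.1 + w.1) + (z.2 - w.2) * (z.2 + w.2)); last ring.
rewrite [leRHS]mulrDl (le_trans (ler_normD _ _))// lerD// normrM ler_wpM2l//.
  by rewrite (le_trans (ler_normD _ _))// lerD// normr_le_enorm.
by rewrite (le_trans (ler_normD _ _))// lerD// normr_le_enorm.
Qed.

Lemma unit_polar (R : realType) (x y : R) : x ^+ 2 + y ^+ 2 = 1 ->
  exists2 th, - pi <= th <= pi & x = cos th /\ y = sin th.
Proof.
move=> xy1.
have y2 : y ^+ 2 = 1 - x ^+ 2 by rewrite -xy1; ring.
have x1 : -1 <= x <= 1.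
  by rewrite -ler_norml -(@expr_le1 _ 2)// real_normK ?num_real// -xy1 lerDl sqr_ge0.
have [y0|/ltW y0] := leP 0 y.
  exists (acos x).
    rewrite acos_lepi// andbT (le_trans _ (acos_ge0 _))//.
    by rewrite oppr_le0 pi_ge0.
  by rewrite acosK// sin_acos// -y2 sqrtr_sqr ger0_norm.
exists (- acos x).
  rewrite lerN2 acos_lepi//= (le_trans _ (pi_ge0 R))// oppr_le0.
  exact: acos_ge0.
by rewrite cosN sinN acosK// sin_acos// -y2 sqrtr_sqr ler0_norm// opprK.
Qed.

Lemma polar_representation (R : realType) (z : R * R) : z != 0 ->
  exists2 th, - pi <= th <= pi &
    z = (enorm z * cos th, enorm z * sin th).
Proof.
move=> z0.
have r0 : enorm z != 0.
  apply: contra z0 => /eqP r0; have := enorm_sqr z.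
  rewrite r0 expr0n/= => /esym/eqP; rewrite paddr_eq0 ?sqr_ge0// !sqrf_eq0.
  by case: z {r0} => z1 z2/= /andP[/eqP -> /eqP ->].
have [|th thpi [c s]] := @unit_polar R (z.1 / enorm z) (z.2 / enorm z).
  by rewrite !exprMn -mulrDl -enorm_sqr -exprMn divff// expr1n.
exists th => //; rewrite -c -s !(mulrC (enorm z)) !divfK//.
by case: z {r0 c s z0}.
Qed.

Lemma enorm_gt0 (R : realType) (z : R * R) : z != 0 -> 0 < enorm z.
Proof.
move=> z0; rewrite lt_neqAle enorm_ge0 andbT eq_sym; apply/negP => /eqP r0.
by have [th _ E] := polar_representation z0; move: z0; rewrite E r0 !mul0r eqxx.
Qed.

Lemma enorm_polar (R : realType) (r th : R) : 0 <= r ->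
  enorm (r * cos th, r * sin th) = r.
Proof.
by move=> r0; rewrite /enorm/= !exprMn -mulrDr cos2Dsin2 mulr1 sqrtr_sqr ger0_norm.
Qed.

Lemma ae_imply (R : realType) (P Q : R -> Prop) :
  (forall t, P t -> Q t) -> {ae @lebesgue_measure R, forall t, P t} ->
  {ae @lebesgue_measure R, forall t, Q t}.
Proof.
move=> PQ; apply: filterS; last exact: PQ.
exact: (ae_filter_ringOfSetsType (@lebesgue_measure R)).
Qed.

Lemma ae_conj (R : realType) (P Q : R -> Prop) :
  {ae @lebesgue_measure R, forall t, P t} ->
  {ae @lebesgue_measure R, forall t, Q t} ->
  {ae @lebesgue_measure R, forall t, P t /\ Q t}.
Proof. by move=> aP aQ; apply: filterI => //; exact: (ae_filter_ringOfSetsType (@lebesgue_measure R)). Qed.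

Lemma abscont_constant (R : realType) (a b : R) (G : R -> R) : abscont a b G ->
  {ae lebesgue_measure, forall t : R, t \in `[a, b] -> is_derive t 1 G 0} ->
  forall t, a <= t <= b -> G t = G a.
Proof.
move=> acG dG t /andP[at_ tb]; have acGt := abscont_sub (lexx a) tb acG.
have abt s : s \in `[a, t] -> s \in `[a, b].
  by rewrite !in_itv/= => /andP[-> st]; exact: le_trans tb.
apply/eqP; rewrite eq_le; apply/andP; split; last first.
  apply: (abscont_nondecreasing at_ acGt).
  apply: ae_imply dG => s dG /abt /dG sG.
  by have [? ->] := is_derive_derive1 sG.
rewrite -lerN2; apply: (@abscont_nondecreasing _ _ _ (fun s => - G s) at_).
  apply: (@abscont_dominated _ _ _ 1 _ G (cst 0) (cst 0)) => //.
  - exact: abscont_cst.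
  - exact: abscont_cst.
  - by move=> u v _ _ _; rewrite !subrr !normr0 !addr0 mul1r -opprD normrN.
apply: ae_imply dG => s dG /abt /dG sG.
by have [? ->] := is_derive_derive1 (is_derive_oppf sG); rewrite oppr0.
Qed.

(** The radial projection onto the unit circle is Lipschitz off a disc. *)
Lemma unit_dist (R : realType) (rho : R) (z w : R * R) : 0 < rho ->
  rho <= enorm z -> rho <= enorm w ->
  (`|z.1 / enorm z - w.1 / enorm w| <=
      2 / rho * (`|z.1 - w.1| + `|z.2 - w.2|)) *
  (`|z.2 / enorm z - w.2 / enorm w| <=
      2 / rho * (`|z.1 - w.1| + `|z.2 - w.2|)).
Proof.
move=> rho0 rz rw.
have z0 : 0 < enorm z by exact: lt_le_trans rz.
have w0 : 0 < enorm w by exact: lt_le_trans rw.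
have key c d : `|d| <= enorm w -> `|c - d| <= `|z.1 - w.1| + `|z.2 - w.2| ->
    `|c / enorm z - d / enorm w| <= 2 / rho * (`|z.1 - w.1| + `|z.2 - w.2|).
  move=> dw cd.
  have -> : c / enorm z - d / enorm w =
      (c - d) / enorm z + d / enorm w * (enorm w - enorm z) / enorm z.
    by field; rewrite !gt_eqF.
  set D := `|z.1 - w.1| + `|z.2 - w.2| in cd *.
  have Dz : D / enorm z <= D / rho.
    by rewrite ler_wpM2l ?addr_ge0// lef_pV2// posrE.
  rewrite (le_trans (ler_normD _ _))// !normrM !normfV.
  rewrite !(gtr0_norm z0) (gtr0_norm w0).
  have -> : 2 / rho * D = D / rho + D / rho by ring.
  apply: lerD.
    by apply: le_trans Dz; rewrite ler_wpM2r// invr_ge0 ltW.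
  apply: le_trans Dz; rewrite ler_wpM2r ?invr_ge0 ?(ltW z0)//.
  rewrite -[leRHS]mul1r ler_pM//.
  - by rewrite mulr_ge0// invr_ge0 ltW.
  - by rewrite ler_pdivrMr// mul1r.
  - by rewrite distrC enorm_dist.
by split; apply: key; rewrite ?normr_le_enorm// ?lerDl ?lerDr.
Qed.

Lemma sin_lipschitz (R : realType) (x y : R) : `|sin x - sin y| <= `|x - y|.
Proof.
wlog xy : x y / y <= x.
  by move=> H; have [/H//|/ltW/H] := leP y x; rewrite distrC (distrC y).
have [c _ ->] := @mean_value R sin cos (@is_derive_sin R) _ _ xy.
by rewrite normrM ler_piMl// ler_norml cos_geN1 cos_le1.
Qed.

Lemma cos_lipschitz (R : realType) (x y : R) : `|cos x - cos y| <= `|x - y|.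
Proof.
wlog xy : x y / y <= x.
  by move=> H; have [/H//|/ltW/H] := leP y x; rewrite distrC (distrC y).
have [c _ ->] := @mean_value R cos (fun s => - sin s) (@is_derive_cos R) _ _ xy.
by rewrite normrM normrN ler_piMl// ler_norml sin_geN1 sin_le1.
Qed.

(** If [th] satisfies the differential equation of the polar angle of the curve
    [(x, y)] and starts right, it is the polar angle for all times: the inner
    product of the unit vectors in the directions of [(x, y)] and of [th] is
    absolutely continuous with derivative zero, hence stays equal to one. *)
Lemma polar_lift (R : realType) (a b rho : R) (x y th : R -> R) :
  0 < rho -> abscont a b x -> abscont a b y -> abscont a b th ->
  (forall t, a <= t <= b -> rho <= enorm (x t, y t)) ->
  {ae lebesgue_measure, forall t : R, t \in `[a, b] -> exists dx dy,
    [/\ is_derive t 1 x dx, is_derive t 1 y dy &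
        is_derive t 1 th ((x t * dy - y t * dx) / enorm (x t, y t) ^+ 2)]} ->
  (x a, y a) = (enorm (x a, y a) * cos (th a), enorm (x a, y a) * sin (th a)) ->
  forall t, a <= t <= b ->
  (x t, y t) = (enorm (x t, y t) * cos (th t), enorm (x t, y t) * sin (th t)).
Proof.
move=> rho0 acx acy acth rrho dxyth xya t tab.
pose r s := enorm (x s, y s).
have r0 s : a <= s <= b -> 0 < r s by move=> /rrho; exact: lt_le_trans.
pose e1 s := x s / r s; pose e2 s := y s / r s.
have ub u v : a <= u -> u <= v -> v <= b -> a <= u <= b.
  by move=> -> uv vb; rewrite (le_trans uv).
have vb u v : a <= u -> u <= v -> v <= b -> a <= v <= b.
  by move=> au uv ->; rewrite (le_trans au).
have rho2 : 0 <= 2 / rho by rewrite divr_ge0// ltW.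
have ace1 : abscont a b e1.
  apply: (@abscont_dominated _ _ _ (2 / rho) _ x y (cst 0)) => //.
    exact: abscont_cst.
  move=> u v au uv vb'; rewrite subrr normr0 addr0.
  exact: (@unit_dist _ _ (x v, y v) (x u, y u) rho0
    (rrho _ (vb _ _ au uv vb')) (rrho _ (ub _ _ au uv vb'))).1.
have ace2 : abscont a b e2.
  apply: (@abscont_dominated _ _ _ (2 / rho) _ x y (cst 0)) => //.
    exact: abscont_cst.
  move=> u v au uv vb'; rewrite subrr normr0 addr0.
  exact: (@unit_dist _ _ (x v, y v) (x u, y u) rho0
    (rrho _ (vb _ _ au uv vb')) (rrho _ (ub _ _ au uv vb'))).2.
have e12 s : a <= s <= b -> e1 s ^+ 2 + e2 s ^+ 2 = 1.
  move=> /r0 rs; rewrite /e1 /e2 !exprMn -mulrDl -[x s ^+ 2 + _](enorm_sqr (x s, y s)).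
  by rewrite -exprMn divff ?gt_eqF// expr1n.
have le1 (p q : R) : p ^+ 2 + q ^+ 2 = 1 -> `|p| <= 1 /\ `|q| <= 1.
  move=> pq; have n1 (u : R) : u ^+ 2 <= 1 -> `|u| <= 1.
    by move=> u1; rewrite -(@expr_le1 _ 2)// real_normK ?num_real.
  by split; apply: n1; rewrite -pq ?lerDl ?lerDr sqr_ge0.
pose c s := e1 s * cos (th s) + e2 s * sin (th s).
have acc : abscont a b c.
  apply: (@abscont_dominated _ _ _ 2 _ e1 e2 th) => // u v au uv vb'.
  have [E1 E2] := le1 _ _ (e12 _ (ub _ _ au uv vb')).
  have [C1 C2] := le1 _ _ (cos2Dsin2 (th v)).
  rewrite /c (_ : _ - _ =
    (e1 v - e1 u) * cos (th v) + (e2 v - e2 u) * sin (th v) +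
    e1 u * (cos (th v) - cos (th u)) + e2 u * (sin (th v) - sin (th u))); last ring.
  have cl := cos_lipschitz (th v) (th u); have sl := sin_lipschitz (th v) (th u).
  have n4 (p q k l : R) : `|p + q + k + l| <= `|p| + `|q| + `|k| + `|l|.
    rewrite (le_trans (ler_normD _ _))// lerD2r (le_trans (ler_normD _ _))//.
    by rewrite lerD2r ler_normD.
  apply: le_trans (n4 _ _ _ _) _.
  apply: (@le_trans _ _ (`|e1 v - e1 u| + `|e2 v - e2 u| + `|th v - th u| + `|th v - th u|)).
    repeat apply: lerD; rewrite normrM.
    - by rewrite ler_piMr.
    - by rewrite ler_piMr.
    - by apply: le_trans cl; rewrite ler_piMl.
    - by apply: le_trans sl; rewrite ler_piMl.
  by rewrite -subr_ge0 (_ : _ - _ = `|e1 v - e1 u| + `|e2 v - e2 u|) ?addr_ge0//; ring.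
have ct : c t = c a.
  apply: (abscont_constant acc) tab; apply: ae_imply dxyth => s H sab.
  have [dx [dy [Dx Dy Dth]]] := H sab.
  have rs : 0 < r s by apply: r0; move: sab; rewrite in_itv.
  have r2 : 0 < x s ^+ 2 + y s ^+ 2.
    by rewrite -[x s ^+ 2 + _](enorm_sqr (x s, y s)) exprn_gt0.
  have Dr : is_derive s 1 r ((x s * dx + y s * dy) / r s).
    have D2 : is_derive s 1 (fun s => x s ^+ 2 + y s ^+ 2)
        (dx * x s + x s * dx + (dy * y s + y s * dy)).
      exact: (is_derive_addf (is_derive_mulf Dx Dx) (is_derive_mulf Dy Dy)).
    have D3 := @is_derive_sqrtf R (fun s => x s ^+ 2 + y s ^+ 2) s _ r2 D2.
    apply: (is_derive_eq1 D3).
    by rewrite -[Num.sqrt _]/(r s); field; rewrite gt_eqF.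
  have Dri := is_derive_invf (lt0r_neq0 rs) Dr.
  have De1 := is_derive_mulf Dx Dri; have De2 := is_derive_mulf Dy Dri.
  have Dc := is_derive_compf (is_derive_cos (th s)) Dth.
  have Ds := is_derive_compf (is_derive_sin (th s)) Dth.
  apply: (is_derive_eq1 (is_derive_addf (is_derive_mulf De1 Dc) (is_derive_mulf De2 Ds))).
  rewrite -/(r s) /=.
  transitivity ((r s ^+ 2 - (x s ^+ 2 + y s ^+ 2)) *
    (dx * cos (th s) + dy * sin (th s)) / r s ^+ 3).
    by rewrite /e1 /e2; field; rewrite gt_eqF.
  by rewrite -[x s ^+ 2 + _](enorm_sqr (x s, y s)) subrr !mul0r.
have ca : c a = 1.
  have aab : a <= a <= b by case/andP: tab => ? ?; rewrite lexx (le_trans _ (_ : t <= b)).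
  have ra := r0 _ aab; case: xya => xa ya.
  have e1a : e1 a = cos (th a) by apply: canLR (mulfK (lt0r_neq0 ra)) _; rewrite mulrC.
  have e2a : e2 a = sin (th a) by apply: canLR (mulfK (lt0r_neq0 ra)) _; rewrite mulrC.
  by rewrite /c e1a e2a -!expr2 cos2Dsin2.
have rt := r0 _ tab; have e1t := e12 _ tab.
rewrite ca in ct.
have : (e1 t - cos (th t)) ^+ 2 + (e2 t - sin (th t)) ^+ 2 = 0.
  transitivity (e1 t ^+ 2 + e2 t ^+ 2 + (cos (th t) ^+ 2 + sin (th t) ^+ 2) - 2 * c t).
    by rewrite /c; ring.
  by rewrite e1t cos2Dsin2 ct; ring.
move/eqP; rewrite paddr_eq0 ?sqr_ge0// !sqrf_eq0 !subr_eq0 => /andP[/eqP <- /eqP <-].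
by rewrite /e1 /e2 -/(r t) !(mulrC (r t)) !divfK// gt_eqF.
Qed.

(** * Positively homogeneous functions of degree two *)

Lemma is_derive_planar (R : realType) (V : R * R -> R) (x y : R -> R)
    (t dx dy : R) :
  differentiable V (x t, y t) -> is_derive t 1 x dx -> is_derive t 1 y dy ->
  is_derive t 1 (fun s => V (x s, y s))
    ((grad V (x t, y t)).1 * dx + (grad V (x t, y t)).2 * dy).
Proof.
move=> dV Dx Dy.
have dx1 : differentiable x t by apply/derivable1_diffP; exact: ex_derive.
have dy1 : differentiable y t by apply/derivable1_diffP; exact: ex_derive.
have dxy : differentiable (fun s => (x s, y s)) t by exact: differentiable_pair.
have dVxy : differentiable (V \o (fun s => (x s, y s))) t.
  exact: differentiable_comp.
apply: DeriveDef; first exact: diff_derivable.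
rewrite deriveE// diff_comp//= diff_pair//.
rewrite -(deriveE (1 : R) dx1) -(deriveE (1 : R) dy1) !derive_val.
rewrite (_ : (dx, dy) = dx *: ((1, 0) : R * R) + dy *: ((0, 1) : R * R)); last first.
  by apply/pair_equal_spec; rewrite /= /GRing.scale/= !mulr1 !mulr0 addr0 add0r.
by rewrite linearD !linearZ /grad/= !deriveE// ![_ *: _]mulrC.
Qed.

Lemma is_derive_affine (R : realType) (t b c : R) :
  is_derive t 1 (fun s : R => b + s * c) c.
Proof.
apply: (is_derive_eq1 (is_derive_addf (is_derive_cstf t b)
  (is_derive_mulf (is_derive_idf t) (is_derive_cstf t c)))).
by rewrite mul1r mulr0 addr0 add0r.
Qed.

Lemma circle_continuous (R : realType) (g : R * R -> R) : continuous g ->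
  continuous (fun th : R => g (cos th, sin th)).
Proof.
move=> cg th; apply: (@continuous_comp _ _ _ (fun th : R => (cos th, sin th)) g).
  apply/differentiable_continuous/differentiable_pair; apply/derivable1_diffP.
    exact: (@ex_derive _ _ _ _ _ _ _ (is_derive_cos th)).
  exact: (@ex_derive _ _ _ _ _ _ _ (is_derive_sin th)).
exact: cg.
Qed.

Lemma circle_extrema (R : realType) (g : R * R -> R) : continuous g ->
  exists a b : R, forall th,
    g (cos a, sin a) <= g (cos th, sin th) <= g (cos b, sin b).
Proof.
move=> /circle_continuous cg.
have pp : - pi <= pi :> R by rewrite (le_trans _ (pi_ge0 R))// oppr_le0 pi_ge0.
have [b _ bmax] := EVT_max pp (continuous_subspaceT cg).
have [a _ amin] := EVT_min pp (continuous_subspaceT cg).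
exists a, b => th; have [th' th'pi [-> ->]] := unit_polar (cos2Dsin2 th).
by rewrite amin ?bmax.
Qed.

Lemma circle_neq0 (R : realType) (th : R) : ((cos th, sin th) : R * R) != 0.
Proof.
apply/eqP => -[c s]; have := cos2Dsin2 th; rewrite c s expr0n/= addr0.
by move/eqP; rewrite eq_sym oner_eq0.
Qed.

Section homogeneous.
Context {R : realType} (V : R * R -> R).
Hypotheses (C1V : C1 V) (hV : pos_homogeneous2 V).

Let dV z : differentiable V z. Proof. exact: C1V.1. Qed.

Lemma homogeneous_gt0 z : z != 0 -> 0 < V z.
Proof. by move=> z0; have [+ _] := hV ltr01 z0; rewrite scale1r. Qed.

(** Continuity along a ray. *)
Lemma homogeneous_at0 : V 0 = 0.
Proof.
pose e1 : R * R := (1, 0).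
have e10 : e1 != 0 by apply/eqP => -[] /eqP; rewrite oner_eq0.
have cV : (fun l : R => V (0 + l * 1, 0 + l * 0)) @ 0^'+ --> V 0.
  have -> : V 0 = V (0 + 0 * 1, 0 + 0 * 0) by rewrite !mul0r !addr0.
  apply: cvg_at_right_filter; apply: is_derive_contf.
  exact: (is_derive_planar (dV _) (is_derive_affine 0 0 1) (is_derive_affine 0 0 0)).
have cV0 : (fun l : R => l * l * V e1) @ 0^'+ --> 0 * 0 * V e1.
  have c0 : {for (0 : R), continuous (fun l : R => l * l * V e1)}.
    exact: (is_derive_contf (is_derive_mulf (is_derive_mulf (is_derive_idf 0)
      (is_derive_idf 0)) (is_derive_cstf 0 (V e1)))).
  by apply: cvg_at_right_filter; exact: c0.
rewrite !mul0r in cV0.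
apply: (cvg_unique (@Rhausdorff R) cV).
apply: cvg_trans cV0; apply: near_eq_cvg; near=> l.
have l0 : 0 < l by near: l; exact: nbhs_right_gt.
by have [_] := @hV l e1 l0 e10; rewrite expr2 !add0r => <-.
Unshelve. all: by end_near. Qed.

Lemma homogeneous_polar r th : 0 < r ->
  V (r * cos th, r * sin th) = r ^+ 2 * V (cos th, sin th).
Proof.
move=> r0; have [_ <-] := hV r0 (circle_neq0 th).
by [].
Qed.

(** Euler's identity: the derivative at [s = 1] of [s |-> V (s z)], computed by the
    chain rule and by homogeneity. *)
Lemma homogeneous_euler z : z != 0 ->
  (grad V z).1 * z.1 + (grad V z).2 * z.2 = 2 * V z.
Proof.
case: z => x y z0.
have Dl : is_derive (1 : R) 1 (fun s : R => V (s * x, s * y))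
    ((grad V (x, y)).1 * x + (grad V (x, y)).2 * y).
  have D (c : R) : is_derive (1 : R) 1 (fun s : R => s * c) c.
    apply: (is_derive_eq1 (is_derive_mulf (is_derive_idf 1) (is_derive_cstf 1 c))).
    by rewrite mul1r mulr0 addr0.
  by have := is_derive_planar (dV _) (D x) (D y); rewrite !mul1r.
have Dr : is_derive (1 : R) 1 (fun s : R => V (s * x, s * y)) (2 * V (x, y)).
  apply: (@near_eq_is_derive _ _ _ (fun s : R => s * s * V (x, y))); last first.
    apply: (is_derive_eq1 (is_derive_mulf (is_derive_mulf (is_derive_idf 1)
      (is_derive_idf 1)) (is_derive_cstf 1 _))).
    by rewrite /=; ring.
  near=> s; have s0 : 0 < s by near: s; exact: lt_nbhsr.
  by have [_] := hV s0 z0; rewrite expr2 => <-.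
have [_ /= <-] := is_derive_derive1 Dl.
by have [_ /= <-] := is_derive_derive1 Dr.
Unshelve. all: by end_near. Qed.

(** The derivatives of [w |-> V (l w) = l^2 V w] along the lines through [z]. *)
Lemma grad_homogeneous l z : 0 < l -> z != 0 -> grad V (l *: z) = l *: grad V z.
Proof.
move=> l0 z0.
have l00 : l != 0 by rewrite gt_eqF.
suff key (i j : R) : (grad V (l *: z)).1 * (l * i) + (grad V (l *: z)).2 * (l * j) =
    l ^+ 2 * ((grad V z).1 * i + (grad V z).2 * j).
  move: (grad V (l *: z)) (grad V z) key => [a b] [c d]/= key.
  apply/pair_equal_spec; split; apply: (mulIf l00); rewrite /GRing.scale/=.
    by have := key 1 0; rewrite !mulr0 !addr0 !mulr1 => ->; ring.
  by have := key 0 1; rewrite !mulr0 !add0r !mulr1 => ->; ring.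
pose w (s : R) : R * R := (z.1 + s * i, z.2 + s * j).
have w0 : w 0 = z by rewrite /w !mul0r !addr0 -surjective_pairing.
have Dw : is_derive (0 : R) 1 (fun s : R => V (w s)) ((grad V z).1 * i + (grad V z).2 * j).
  by have := is_derive_planar (dV _) (is_derive_affine 0 z.1 i) (is_derive_affine 0 z.2 j); rewrite -/(w 0) w0.
have Dlw : is_derive (0 : R) 1
    (fun s : R => V (l * z.1 + s * (l * i), l * z.2 + s * (l * j)))
    ((grad V (l *: z)).1 * (l * i) + (grad V (l *: z)).2 * (l * j)).
  have := is_derive_planar (dV _) (is_derive_affine 0 (l * z.1) (l * i))
    (is_derive_affine 0 (l * z.2) (l * j)).
  by rewrite !mul0r !addr0.
have Dr : is_derive (0 : R) 1
    (fun s : R => V (l * z.1 + s * (l * i), l * z.2 + s * (l * j)))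
    (l ^+ 2 * ((grad V z).1 * i + (grad V z).2 * j)).
  have DD : is_derive (0 : R) 1 (fun s : R => l ^+ 2 * V (w s))
      (l ^+ 2 * ((grad V z).1 * i + (grad V z).2 * j)).
    apply: (is_derive_eq1 (is_derive_mulf (is_derive_cstf 0 (l ^+ 2)) Dw)).
    by rewrite mul0r add0r.
  apply: near_eq_is_derive DD.
  have cw (b c : R) : (b + s * c) @[s --> (0 : R)] --> b.
    have := is_derive_contf (is_derive_affine 0 b c).
    by rewrite /prop_for /continuous_at mul0r addr0.
  have wn0 : \forall s \near (0 : R), w s != 0.
    have [z1|z1] := eqVneq z.1 0.
      have z2 : z.2 != 0.
        by apply: contra z0 => /eqP z2; rewrite (surjective_pairing z) z1 z2.
      apply: (filterS _ (cvgr_neq0 _ (cw z.2 j) z2)) => s.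
      by apply: contra => /eqP ws; rewrite -[_ + _]/((w s).2) ws.
    apply: (filterS _ (cvgr_neq0 _ (cw z.1 i) z1)) => s.
    by apply: contra => /eqP ws; rewrite -[_ + _]/((w s).1) ws.
  near=> s; have ws0 : w s != 0 by near: s.
  have [_ <-] := hV l0 ws0; congr (V (_, _)); rewrite /w /=.
    by rewrite /GRing.scale/=; ring.
  by rewrite /GRing.scale/=; ring.
have [_ /= <-] := is_derive_derive1 Dlw.
by have [_ /= <-] := is_derive_derive1 Dr.
Unshelve. all: by end_near. Qed.

Lemma homogeneous_circle_bounds : exists2 c : R, 0 < c &
  exists2 C : R, 0 < C & forall th, c <= V (cos th, sin th) <= C.
Proof.
have [|a [b ab]] := @circle_extrema _ V.
  by move=> z; exact: differentiable_continuous.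
have pos th : 0 < V (cos th, sin th).
  by apply: homogeneous_gt0; exact: circle_neq0.
by exists (V (cos a, sin a)) => //; exists (V (cos b, sin b)).
Qed.

(** By homogeneity of the gradient, the bound on the circle propagates. *)
Lemma grad_linear_bound : exists2 B : R, 0 <= B & forall z, z != 0 ->
  `|(grad V z).1| <= B * enorm z /\ `|(grad V z).2| <= B * enorm z.
Proof.
have cn (i : R * R -> R) : continuous i -> continuous (fun z => `|i (grad V z)|).
  move=> ci z; apply: (@continuous_comp _ _ _ (i \o grad V) Num.norm).
    by apply: continuous_comp; [exact: C1V.2|exact: ci].
  exact: norm_continuous.
have c1 : continuous (fst : R * R -> R) by move=> z; exact: cvg_fst.
have c2 : continuous (snd : R * R -> R) by move=> z; exact: cvg_snd.
have [a1 [b1 B1]] := circle_extrema (cn _ c1).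
have [a2 [b2 B2]] := circle_extrema (cn _ c2).
pose M (i : R * R -> R) (b : R) : R := `|i (grad V (cos b, sin b))|.
exists (M fst b1 + M snd b2); first by rewrite /M addr_ge0.
move=> z z0; have [th _ zE] := polar_representation z0.
have r0 := enorm_gt0 z0.
have -> : grad V z = enorm z *: grad V (cos th, sin th).
  by rewrite -grad_homogeneous ?circle_neq0// {1}zE.
have {}B1 := B1 th; have {}B2 := B2 th; rewrite -/(M fst b1) in B1.
rewrite -/(M snd b2) in B2; have [M1 M2] : 0 <= M fst b1 /\ 0 <= M snd b2 by split; exact: normr_ge0.
move: (M fst b1) (M snd b2) (grad V (cos th, sin th)) B1 B2 M1 M2.
move=> m1 m2 [g1 g2]/= /andP[_ B1] /andP[_ B2] M1 M2.
rewrite !normrM gtr0_norm// ![enorm z * _]mulrC !ler_pM2r//; split.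
  by rewrite (le_trans B1)// lerDl.
by rewrite (le_trans B2)// lerDr.
Qed.
End homogeneous.

Lemma is_derive_fst_snd (R : realType) (f : R -> R * R) (t : R) :
  derivable f t 1 ->
  is_derive t 1 (fun s => (f s).1) (derive1 f t).1 /\
  is_derive t 1 (fun s => (f s).2) (derive1 f t).2.
Proof.
move=> df; rewrite derive1E.
have cf : (fun h : R => h^-1 *: ((f \o shift t) (h *: 1) - f t)) @ 0^' -->
  'D_1 f t by [].
have c1 : (fun h : R => h^-1 *: ((f (h *: 1 + t)).1 - (f t).1)) @ 0^' -->
    ('D_1 f t).1.
  by apply: (cvg_comp _ fst cf); exact: cvg_fst.
have c2 : (fun h : R => h^-1 *: ((f (h *: 1 + t)).2 - (f t).2)) @ 0^' -->
    ('D_1 f t).2.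
  by apply: (cvg_comp _ snd cf); exact: cvg_snd.
split; apply: DeriveDef.
- by apply/cvg_ex; exists ('D_1 f t).1.
- exact: (cvg_lim (@Rhausdorff R) c1).
- by apply/cvg_ex; exists ('D_1 f t).2.
- exact: (cvg_lim (@Rhausdorff R) c2).
Qed.

Lemma is_derive_pair (R : realType) (f : R -> R * R) (t d1 d2 : R) :
  is_derive t 1 (fun s => (f s).1) d1 -> is_derive t 1 (fun s => (f s).2) d2 ->
  derivable f t 1 /\ derive1 f t = (d1, d2).
Proof.
move=> D1 D2.
have df : derivable f t 1.
  apply/derivable1_diffP; rewrite (_ : f = fun s => ((f s).1, (f s).2)); last first.
    by apply/funext => s; rewrite -surjective_pairing.
  by apply: differentiable_pair; apply/derivable1_diffP; exact: ex_derive.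
have [E1 E2] := is_derive_fst_snd df.
split => //; rewrite (surjective_pairing (derive1 f t)).
rewrite -(is_derive_derive1 E1).2 -(is_derive_derive1 E2).2.
by rewrite (is_derive_derive1 D1).2 (is_derive_derive1 D2).2.
Qed.

Lemma abscont_C1 (R : realType) (a b : R) (f df : R -> R) : continuous df ->
  (forall t : R, is_derive t 1 f (df t)) -> abscont a b f.
Proof.
move=> cdf Df; have [ab|ba] := leP a b; last first.
  move=> e e0; exists 1 => // -[|n] u v uv _ _; first by rewrite big_ord0.
  have [au [uv' vb]] := uv ord0; have := le_trans au (le_trans uv' vb).
  by rewrite leNgt ba.
have cn : continuous (fun t => `|df t|).
  by move=> t; apply: continuous_comp; [exact: cdf|exact: norm_continuous].
have [c _ cmax] := EVT_max ab (continuous_subspaceT cn).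
apply: (@abscont_lipschitz _ _ _ `|df c|) => // u v au uv vb.
have [t /andP[ut tv] ->] := mean_value Df uv.
rewrite normrM [X in _ * X <= _]ger0_norm ?subr_ge0// ler_wpM2r ?subr_ge0//.
by apply: cmax; rewrite in_itv/= (le_trans au ut) (le_trans tv vb).
Qed.

(** * The isochronous centre *)

(** Along [J z' = grad V z] the polar angle obeys [th' = - 2 V (cos th, sin th)],
    so any antiderivative [W] of [1 / (2 V (cos th, sin th))] is a clock: the
    time spent turning clockwise from [th0] to [th1] is [W th0 - W th1]. *)
Definition is_clock (R : realType) (V : R * R -> R) (W : R -> R) : Prop :=
  forall th : R, is_derive th 1 W (2 * V (cos th, sin th))^-1.

Section clock.
Context {R : realType} (V : R * R -> R).
Hypotheses (C1V : C1 V) (hV : pos_homogeneous2 V).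

Let V2_gt0 th : 0 < 2 * V (cos th, sin th).
Proof. by rewrite mulr_gt0// homogeneous_gt0// circle_neq0. Qed.

Let cV : continuous (fun th : R => V (cos th, sin th)).
Proof.
by apply: circle_continuous => z; apply: differentiable_continuous; exact: C1V.1.
Qed.

Let cV2 : continuous (fun th : R => (2 * V (cos th, sin th))^-1).
Proof.
move=> th; apply: (@continuousV _ _ (fun th : R => 2 * V (cos th, sin th))).
  by rewrite gt_eqF.
by apply: continuousM; [exact: cst_continuous|exact: cV].
Qed.

Lemma clock_exists : exists W, is_clock V W.
Proof. exact: continuous_antiderivative cV2. Qed.

Variable W : R -> R.
Hypothesis DW : is_clock V W.

(** [V] lies between positive constants on the circle, so [W] is bi-Lipschitz. *)
Lemma clock_increment : exists2 c : R, 0 < c & exists2 C : R, 0 < C &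
  forall a b, a <= b -> C * (b - a) <= W b - W a <= c * (b - a).
Proof.
have [c c0 [C C0 vcC]] := homogeneous_circle_bounds C1V hV.
exists (2 * c)^-1; first by rewrite invr_gt0 mulr_gt0.
exists (2 * C)^-1; first by rewrite invr_gt0 mulr_gt0.
move=> a b ab; have [t _ ->] := mean_value DW ab.
have /andP[ct tC] := vcC t.
have h (x y : R) : 0 < x -> x <= y -> (2 * y)^-1 <= (2 * x)^-1.
  move=> x0 xy; have y0 := lt_le_trans x0 xy.
  by rewrite lef_pV2 ?posrE ?mulr_gt0// ler_pM2l.
by rewrite !ler_wpM2r ?subr_ge0// h// (lt_le_trans c0).
Qed.

Lemma clock_lt a b : (W a < W b) = (a < b).
Proof.
have [c c0 [C C0 H]] := clock_increment.
have [ab|ba] := ltP a b.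
  rewrite -subr_gt0; have /andP[+ _] := H _ _ (ltW ab); apply: lt_le_trans.
  by rewrite mulr_gt0// subr_gt0.
apply/negbTE; rewrite -leNgt -subr_ge0.
have /andP[+ _] := H _ _ ba; apply: le_trans.
by rewrite mulr_ge0 ?subr_ge0// ltW.
Qed.

Lemma clock_le a b : (W a <= W b) = (a <= b).
Proof. by rewrite !leNgt clock_lt. Qed.

Lemma clock_inj : injective W.
Proof. by move=> a b ab; apply/eqP; rewrite eq_le -(clock_le a b) -(clock_le b a) ab lexx. Qed.

Lemma clock_surj y : exists th, W th = y.
Proof.
have [c c0 [C C0 H]] := clock_increment.
pose d := `|y - W 0| / C.
have d0 : 0 <= d by rewrite divr_ge0// ltW.
have Cd : C * d = `|y - W 0| by rewrite mulrC divfK// gt_eqF.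
have cW : continuous W by move=> x; exact: is_derive_contf (DW x).
have dd : - d <= d by rewrite (le_trans _ d0)// oppr_le0.
have H1 : W (- d) <= y.
  have := H (- d) 0; rewrite oppr_le0 => /(_ d0) /andP[+ _].
  rewrite opprK add0r Cd => h; have := ler_norm (- (y - W 0)); rewrite normrN; lra.
have H2 : y <= W d.
  have /andP[+ _] := H 0 d d0; rewrite subr0 Cd => h.
  by have := ler_norm (y - W 0); lra.
have [|th _ <-] := @IVT _ W _ _ y dd (continuous_subspaceT cW); last by exists th.
by rewrite ge_min H1 le_max H2 orbT.
Qed.

(** On the level [1/2] the angular velocity is [- |f t|^-2], a continuous function
    of time.  Its antiderivative [K] that starts at [pi / 2] is a polar angle of
    [f], and the derivative of [W (K t) + t] vanishes. *)
Lemma level_half_polar f : is_phi V f ->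
  forall t th, 0 <= t -> W th = W (pi / 2) - t ->
  f t = (enorm (f t) * cos th, enorm (f t) * sin th) /\ 0 < enorm (f t).
Proof.
move=> [solf Vf f10 f20].
have f0 t : f t != 0.
  by apply/eqP => ft; have := Vf t; rewrite ft homogeneous_at0// => /eqP; rewrite eq_sym invr_eq0 pnatr_eq0.
have r0 t : 0 < enorm (f t) by exact: enorm_gt0.
have [c c0 [C C0 vcC]] := homogeneous_circle_bounds C1V hV.
have VfE t : exists2 th, 2^-1 = enorm (f t) ^+ 2 * V (cos th, sin th) &
    f t = (enorm (f t) * cos th, enorm (f t) * sin th).
  have [th _ E] := polar_representation (f0 t); exists th => //.
  by rewrite -homogeneous_polar// -E Vf.
pose rho := Num.sqrt (2 * C)^-1.
have rho0 : 0 < rho by rewrite sqrtr_gt0 invr_gt0 mulr_gt0.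
have rf t : rho <= enorm (f t).
  have [th E _] := VfE t; have /andP[_ vC] := vcC th.
  rewrite -[leRHS]gtr0_norm// -sqrtr_sqr ler_wsqrtr//.
  rewrite invfM ler_pdivrMr// E ler_wpM2l ?sqr_ge0//.
have acf a b : a <= b -> abscont a b (fun t => (f t).1) /\ abscont a b (fun t => (f t).2).
  by move=> /solf[/absolutely_continuous_onP].
have cf1 t : {for t, continuous (fun s => (f s).1)}.
  have [|ac1 _] := acf (t - 1) (t + 1); first by rewrite lerD2l -subr_ge0 opprK addr_ge0.
  by apply: (abscont_continuous_at _ _ ac1); rewrite ?ltrBlDr ltrDl.
have cf2 t : {for t, continuous (fun t => (f t).2)}.
  have [|_ ac1] := acf (t - 1) (t + 1); first by rewrite lerD2l -subr_ge0 opprK addr_ge0.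
  by apply: (abscont_continuous_at _ _ ac1); rewrite ?ltrBlDr ltrDl.
have ck : continuous (fun t => - (enorm (f t) ^+ 2)^-1).
  have cr : continuous (fun t => enorm (f t) ^+ 2).
    rewrite (_ : (fun t => _) = (fun t => (f t).1 * (f t).1 + (f t).2 * (f t).2)).
      move=> t; exact: (continuousD (continuousM (cf1 t) (cf1 t))
        (continuousM (cf2 t) (cf2 t))).
    by apply/funext => t; rewrite enorm_sqr !expr2.
  move=> t; apply: (@continuousN _ _ _ (fun t => (enorm (f t) ^+ 2)^-1)).
  by apply: (continuousV _ (cr t)); rewrite expf_neq0// gt_eqF.
have [K0 DK0] := continuous_antiderivative ck.
pose K t := pi / 2 + (K0 t - K0 0).
have DK : forall t : R, is_derive t 1 K (- (enorm (f t) ^+ 2)^-1).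
  move=> t; apply: (is_derive_eq1 (is_derive_addf (is_derive_cstf t _)
    (is_derive_subf (DK0 t) (is_derive_cstf t _)))).
  by rewrite subr0 add0r.
have polar t : 0 <= t -> f t = (enorm (f t) * cos (K t), enorm (f t) * sin (K t)).
  move=> t0; have [ac1 ac2] := acf _ _ t0.
  have := @polar_lift R 0 t rho (fun t => (f t).1) (fun t => (f t).2) K rho0 ac1 ac2
    (@abscont_C1 R 0 t K _ ck DK).
  have pf s : ((f s).1, (f s).2) = f s by rewrite -surjective_pairing.
  move=> H; rewrite -{1}(pf t) -{1 2}(pf t); apply: H; last by rewrite t0 lexx.
  - by move=> s _; rewrite pf.
  - have [_] := solf _ _ t0; apply: ae_imply => s + st => /(_ st)[ds Js].
    have [D1 D2] := is_derive_fst_snd ds; exists (derive1 f s).1, (derive1 f s).2.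
    split => //; apply: (is_derive_eq1 (DK s)); rewrite pf.
    have := homogeneous_euler C1V hV (f0 s); rewrite -Js /= Vf divff// => e.
    by rewrite -[in LHS]mulN1r -e; congr (_ / _); ring.
  - rewrite pf /K subrr addr0 cos_pihalf sin_pihalf mulr0 mulr1.
    have -> : enorm (f 0) = (f 0).2.
      by rewrite /enorm f10 expr0n add0r sqrtr_sqr gtr0_norm.
    by rewrite {1}(surjective_pairing (f 0)) f10.
have clock t : 0 <= t -> W (K t) = W (pi / 2) - t.
  move=> t0; have DG : forall s : R, is_derive s 1 (fun s => W (K s) + s)
      ((2 * V (cos (K s), sin (K s)))^-1 * (- (enorm (f s) ^+ 2)^-1) + 1).
    by move=> s; exact: (is_derive_addf (is_derive_compf (DW _) (DK s)) (is_derive_idf s)).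
  have [s /andP[s0 _]] := mean_value DG t0.
  have E := homogeneous_polar hV (K s) (r0 s); rewrite -polar// Vf in E.
  rewrite mulrN -invfM -mulrA [V _ * _]mulrC -E divff// invr1 addNr mul0r.
  by rewrite /K subrr !addr0 => /eqP; rewrite subr_eq0 => /eqP <-; rewrite addrK.
move=> t th t0; rewrite -clock// => /clock_inj ->; split => //.
exact: polar.
Qed.

Lemma clock_period th : W (th + 2 * pi) - W th = period V.
Proof.
have p0 : 0 < 2 * pi :> R by rewrite mulr_gt0// pi_gt0.
rewrite /period (integral_antiderivative cV2 DW p0).
have D : forall t : R, is_derive t 1 (fun t => W (t + 2 * pi) - W t) 0.
  move=> t; have Dt : is_derive t 1 (fun t => t + 2 * pi) 1.
    apply: (is_derive_eq1 (is_derive_addf (is_derive_idf t) (is_derive_cstf t _))).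
    by rewrite addr0.
  apply: (is_derive_eq1 (is_derive_subf (is_derive_compf (DW _) Dt) (DW t))).
  by rewrite mulr1 (_ : 2 * pi = pi *+ 2) ?mulr_natl// sinD2pi cosD2pi subrr.
have K a b : a <= b -> W (b + 2 * pi) - W b = W (a + 2 * pi) - W a.
  move=> ab; have [t _ E] := mean_value D ab.
  by apply/eqP; rewrite -subr_eq0 E mul0r.
rewrite -[X in W X - W 0]add0r.
by have [/K|/ltW/K] := leP 0 th.
Qed.

Lemma clock_periods th n : W (th + n%:R * (2 * pi)) - W th = n%:R * period V.
Proof.
elim: n => [|n IH]; first by rewrite !mul0r addr0 subrr.
rewrite (_ : th + n.+1%:R * _ = th + n%:R * (2 * pi) + 2 * pi); last first.
  by rewrite -natr1; ring.
transitivity (n%:R * period V + period V); last by rewrite -natr1 mulrDl mul1r.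
by rewrite -IH -(clock_period (th + n%:R * (2 * pi))); ring.
Qed.

(** The inverse of the clock gives the angle, and the radius [r] is what the level
    [1/2] requires. *)
Lemma level_half_exists : exists f, is_phi V f.
Proof.
have /choice[g Wg] := clock_surj.
have gW x : g (W x) = x by apply: clock_inj; rewrite Wg.
have Dg : forall y : R, is_derive y 1 g (2 * V (cos (g y), sin (g y))).
  move=> y; rewrite -{1}(Wg y) -[X in is_derive _ _ _ X]invrK.
  apply: is_derive_inverse (DW (g y)) _.
  - by near=> x; exact: gW.
  - by near=> x; exact: (is_derive_contf (DW x)).
  - by rewrite invr_eq0 gt_eqF.
pose th t := g (W (pi / 2) - t).
pose v t := V (cos (th t), sin (th t)).
have v0 t : 0 < v t by rewrite homogeneous_gt0// circle_neq0.
have Dth : forall t : R, is_derive t 1 th (- (2 * v t)).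
  move=> t; apply: (is_derive_eq1 (is_derive_compf (Dg _)
    (is_derive_subf (is_derive_cstf t (W (pi / 2))) (is_derive_idf t)))).
  by rewrite sub0r mulrN1.
pose r t := (Num.sqrt (2 * v t))^-1.
have r0 t : 0 < r t by rewrite invr_gt0 sqrtr_gt0 mulr_gt0.
have r2 t : r t ^+ 2 * (2 * v t) = 1.
  by rewrite /r exprVn sqr_sqrtr ?mulVf// ?gt_eqF// ?ltW// mulr_gt0.
pose f t : R * R := (r t * cos (th t), r t * sin (th t)).
have fE t : f t = r t *: (cos (th t), sin (th t)) by [].
pose G t := grad V (cos (th t), sin (th t)).
have GE t : grad V (f t) = r t *: G t.
  by rewrite fE grad_homogeneous// circle_neq0.
have eu t : (G t).1 * cos (th t) + (G t).2 * sin (th t) = 2 * v t.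
  exact: (homogeneous_euler C1V hV (circle_neq0 _)).
have Dc t := is_derive_compf (is_derive_cos (th t)) (Dth t).
have Ds t := is_derive_compf (is_derive_sin (th t)) (Dth t).
have Dv : forall t : R, is_derive t 1 v
    (((G t).1 * sin (th t) - (G t).2 * cos (th t)) * (2 * v t)).
  move=> t; apply: (is_derive_eq1 (is_derive_planar (C1V.1 _) (Dc t) (Ds t))).
  by rewrite -/(G t); ring.
have Dr : forall t : R, is_derive t 1 r
    (- r t * ((G t).1 * sin (th t) - (G t).2 * cos (th t))).
  move=> t; have w0 : 0 < 2 * v t by rewrite mulr_gt0.
  have D2v := is_derive_mulf (is_derive_cstf t 2) (Dv t).
  have Dsq := @is_derive_sqrtf R (fun t => 2 * v t) t _ w0 D2v.
  have sq0 : Num.sqrt (2 * v t) != 0 by rewrite gt_eqF// sqrtr_gt0.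
  apply: (is_derive_eq1 (@is_derive_invf R (fun t => Num.sqrt (2 * v t)) t _ sq0 Dsq)).
  rewrite mul0r add0r sqr_sqrtr ?(ltW w0)// /r.
  have v1 := v0 t; field.
  by rewrite sq0 gt_eqF.
have D1 : forall t : R, is_derive t 1 (fun t => (f t).1) (grad V (f t)).2.
  move=> t; apply: (is_derive_eq1 (is_derive_mulf (Dr t) (Dc t))).
  rewrite GE -eu; move: (G t) => [g1 g2] /=.
  transitivity (g2 * (r t * (cos (th t) ^+ 2 + sin (th t) ^+ 2))); first by ring.
  by rewrite cos2Dsin2 mulr1 mulrC.
have D2 : forall t : R, is_derive t 1 (fun t => (f t).2) (- (grad V (f t)).1).
  move=> t; apply: (is_derive_eq1 (is_derive_mulf (Dr t) (Ds t))).
  rewrite GE -eu; move: (G t) => [g1 g2] /=.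
  transitivity (- g1 * (r t * (cos (th t) ^+ 2 + sin (th t) ^+ 2))); first by ring.
  by rewrite cos2Dsin2 mulr1 mulNr mulrC.
have cf : continuous f.
  move=> t; apply: differentiable_continuous; apply: differentiable_pair.
    by apply/derivable1_diffP; exact: (@ex_derive _ _ _ _ _ _ _ (D1 t)).
  by apply/derivable1_diffP; exact: (@ex_derive _ _ _ _ _ _ _ (D2 t)).
have cg : continuous (grad V \o f).
  by move=> t; apply: continuous_comp; [exact: cf|exact: C1V.2].
exists f; split.
- move=> a b ab; split.
    apply/absolutely_continuous_onP; split.
      apply: (@abscont_C1 _ _ _ _ (fun t => (grad V (f t)).2) _ D1) => t; apply: (@continuous_comp _ _ _ (grad V \o f) snd).
        exact: cg.
      exact: cvg_snd.
    apply: (@abscont_C1 _ _ _ _ (fun t => - (grad V (f t)).1) _ D2) => t; apply: (@continuousN _ _ _ (fst \o (grad V \o f))).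
    apply: (@continuous_comp _ _ _ (grad V \o f) fst); first exact: cg.
    exact: cvg_fst.
  apply: aeW => t _; have [df ->] := is_derive_pair (D1 t) (D2 t); split => //.
  by move: (grad V (f t)) => [x y]; rewrite /Jrot/= opprK.
- move=> t; rewrite homogeneous_polar//.
  by apply: (@mulfI _ 2) => //; rewrite mulrCA r2 divff.
- by rewrite /f /th subr0 gW cos_pihalf mulr0.
- by rewrite /f /th subr0 gW sin_pihalf mulr1 /= r0.
Unshelve. all: by end_near. Qed.

End clock.

(** * Lines and the times between them *)

(** A line has a class of angles modulo [pi]; a relation leaves the choice of the
    representative to each use. *)
Definition is_direction (R : realType) (l : set (R * R)) (om : R) : Prop :=
  forall z, l z <-> z.1 * sin om = z.2 * cos om.

Lemma is_direction_subpi (R : realType) (l : set (R * R)) (om : R) :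
  is_direction l om -> is_direction l (om - pi).
Proof.
have E : sin (om - pi) = - sin om /\ cos (om - pi) = - cos om.
  by rewrite -[in X in _ = - X /\ _](subrK pi om) -[in X in _ /\ _ = - X](subrK pi om)
    sinDpi cosDpi !opprK.
move=> lom z; rewrite lom E.1 E.2 !mulrN; split=> [->//|].
exact: oppr_inj.
Qed.

Lemma is_direction_addpi (R : realType) (l : set (R * R)) (om : R) :
  is_direction l om -> is_direction l (om + pi).
Proof.
move=> lom z; rewrite lom sinDpi cosDpi !mulrN; split=> [->//|].
exact: oppr_inj.
Qed.

Lemma is_direction_subnpi (R : realType) (l : set (R * R)) (om : R) n :
  is_direction l om -> is_direction l (om - n%:R * pi).
Proof.
elim: n => [|n IH] lom; first by rewrite mul0r subr0.
rewrite -natr1 mulrDl mul1r opprD addrA; apply: is_direction_subpi; exact: IH.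
Qed.

Lemma is_direction_addnpi (R : realType) (l : set (R * R)) (om : R) n :
  is_direction l om -> is_direction l (om + n%:R * pi).
Proof.
elim: n => [|n IH] lom; first by rewrite mul0r addr0.
rewrite -natr1 mulrDl mul1r addrA; apply: is_direction_addpi; exact: IH.
Qed.

Lemma line_direction (R : realType) (l : set (R * R)) (x : R) : is_line l ->
  exists2 om, is_direction l om & om <= x < om + pi.
Proof.
move=> [v v0 ->]; have [th _ vE] := polar_representation v0.
have r0 := enorm_gt0 v0; set r := enorm v in vE r0.
have dth : is_direction [set c *: v | c in [set: R]] th.
  move=> z; split=> [[c _ <-]|zE].
    by rewrite vE /= /GRing.scale/=; ring.
  exists ((z.1 * cos th + z.2 * sin th) / r) => //.
  have r1 : r != 0 by rewrite gt_eqF.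
  have cs := cos2Dsin2 th; rewrite vE (surjective_pairing z).
  apply/pair_equal_spec; rewrite /= /GRing.scale/= !mulrA !divfK//; split.
    transitivity (z.1 * cos th ^+ 2 + z.2 * cos th * sin th); first by ring.
    by rewrite -zE -[RHS]mulr1 -cs; ring.
  transitivity (z.1 * sin th * cos th + z.2 * sin th ^+ 2); first by ring.
  by rewrite zE -[RHS]mulr1 -cs; ring.
have p0 := pi_gt0 R.
pose n := Num.floor ((x - th) / pi).
have /andP[n1 n2] := floor_itv ((x - th) / pi).
exists (th + n%:~R * pi).
  case: (n) => m.
    exact: is_direction_addnpi.
  by rewrite NegzE mulrNz mulNr; exact: is_direction_subnpi.
move: n1 n2; rewrite -/n ler_pdivlMr// ltr_pdivrMr// intrD mulrDl mul1r.
by move=> ? ?; apply/andP; split; lra.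
Qed.

Lemma direction_between (R : realType) (l : set (R * R)) (om th r : R) :
  is_direction l om -> 0 < r -> om < th -> th < om + pi ->
  ~ l (r * cos th, r * sin th).
Proof.
move=> lom r0 omth thom /lom/= /eqP; rewrite -!mulrA (inj_eq (mulfI (lt0r_neq0 r0))).
rewrite eq_sym -subr_eq0 -sinB gt_eqF// sin_gt0_pi// subr_gt0 omth/=.
by rewrite ltrBlDl.
Qed.

Lemma direction_on (R : realType) (l : set (R * R)) (om r : R) :
  is_direction l om -> l (r * cos om, r * sin om).
Proof. by move=> lom; apply/lom => /=; ring. Qed.

Lemma least_eq (R : realType) (A : set R) (x : R) : A x -> lbound A x ->
  least A = x.
Proof.
move=> Ax lx; have [|Ay ly] := @getPex R (A `&` lbound A); first by exists x.
by apply/eqP; rewrite eq_le lx// ly.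
Qed.

Section hitting_times.
Context {R : realType} (V : R * R -> R).
Hypotheses (C1V : C1 V) (hV : pos_homogeneous2 V).
Variable W : R -> R.
Hypothesis DW : is_clock V W.

Let phi_polar t th : 0 <= t -> W th = W (pi / 2) - t ->
  phi V t = (enorm (phi V t) * cos th, enorm (phi V t) * sin th) /\
  0 < enorm (phi V t).
Proof.
have phiP : is_phi V (phi V).
  exact: (@getPex _ [set f | is_phi V f] (level_half_exists C1V hV DW)).
exact: (level_half_polar C1V hV DW phiP).
Qed.

Let phi_on l s om t : is_direction l om -> 0 <= s -> 0 <= t ->
  W om = W (pi / 2) - s - t -> l (phi V (s + t)).
Proof.
move=> lom s0 t0 Wom; have [|E _] := @phi_polar (s + t) om (addr_ge0 s0 t0).
  by rewrite Wom opprD addrA.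
rewrite E; exact: direction_on.
Qed.

Let phi_off l s om t : is_direction l om -> 0 <= s -> 0 <= t ->
  W om < W (pi / 2) - s - t -> W (pi / 2) - s - t < W (om + pi) ->
  ~ l (phi V (s + t)).
Proof.
move=> lom s0 t0 W1 W2; have [th Wth] := clock_surj C1V hV DW (W (pi / 2) - s - t).
have [|E r0] := @phi_polar (s + t) th (addr_ge0 s0 t0).
  by rewrite Wth opprD addrA.
by rewrite E; apply: (direction_between lom) => //; rewrite -(clock_lt C1V hV DW) Wth.
Qed.

(** Between the angles [om] and [om + pi] an orbit does not meet the line, so it
    first meets it when the clock shows [W om]. *)
Lemma hit_ge_eq l s om t : is_direction l om -> 0 <= s -> 0 <= t ->
  W om = W (pi / 2) - s - t -> W (pi / 2) - s < W (om + pi) ->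
  hit_ge (phi V) l s = t.
Proof.
move=> lom s0 t0 Wom Wpi; apply: least_eq.
  by split => //; exact: phi_on Wom.
move=> t' [t'0 lt']; rewrite leNgt; apply/negP => tt'.
by apply: (phi_off lom s0 t'0) lt'; [rewrite Wom|]; lra.
Qed.

Lemma hit_gt_eq l s om t : is_direction l om -> 0 <= s -> 0 < t ->
  W om = W (pi / 2) - s - t -> W (pi / 2) - s <= W (om + pi) ->
  hit_gt (phi V) l s = t.
Proof.
move=> lom s0 t0 Wom Wpi; apply: least_eq.
  by split => //; exact: phi_on (ltW t0) Wom.
move=> t' [t'0 lt']; rewrite leNgt; apply/negP => tt'.
by apply: (phi_off lom s0 (ltW t'0)) lt'; [rewrite Wom|]; lra.
Qed.

Variables (lS lA : set (R * R)) (omS omA : R).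
Hypotheses (dS : is_direction lS omS) (dA : is_direction lA omA).
Hypotheses (omS1 : omS <= pi / 2) (omS2 : pi / 2 < omS + pi).
Hypotheses (omA1 : omS - pi <= omA) (omA2 : omA < omS).

Let WlE := clock_le C1V hV DW.
Let WltE := clock_lt C1V hV DW.

(* The orbit starts at the angle [pi / 2] and turns clockwise; it meets [lS] and
   [lA] alternately, at the angles [omS], [omA], [omS - pi], [omA - pi] and
   [omS - pi - pi] *)
Let tau0E : tau0 lS V = W (pi / 2) - W omS.
Proof.
apply: (hit_ge_eq dS) => //; rewrite ?subr_ge0 ?WlE//; first by ring.
by rewrite subr0 WltE.
Qed.

Let tau1E : tau1 lS lA V = W omS - W omA.
Proof.
apply: (hit_gt_eq dA); rewrite ?tau0E ?subr_ge0 ?subr_gt0 ?WlE ?WltE//.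
  by ring.
by rewrite opprB addrC subrK WlE -lerBlDr.
Qed.

Let sigma1E : sigma1 lS lA V = W omA - W (omS - pi).
Proof.
have -> : sigma1 lS lA V = hit_ge (phi V) lS (W (pi / 2) - W omA).
  by rewrite /sigma1 tau0E tau1E addrA subrK.
apply: (hit_ge_eq (is_direction_subpi dS)); rewrite ?subr_ge0 ?WlE//.
- by rewrite (le_trans (ltW omA2)).
- by ring.
- by rewrite opprB addrC subrK subrK WltE.
Qed.

Let tau2E : tau2 lS lA V = W (omS - pi) - W (omA - pi).
Proof.
have -> : tau2 lS lA V = hit_gt (phi V) lA (W (pi / 2) - W (omS - pi)).
  by rewrite /tau2 tau0E tau1E sigma1E; congr hit_gt; ring.
apply: (hit_gt_eq (is_direction_subpi dA)); rewrite ?subr_ge0 ?subr_gt0 ?WlE ?WltE//.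
- by rewrite (le_trans _ omS1)// gerBl pi_ge0.
- by rewrite ltrD2r.
- by ring.
- by rewrite opprB addrC subrK subrK WlE.
Qed.

Let sigma2E : sigma2 lS lA V = W (omA - pi) - W (omS - pi - pi).
Proof.
have -> : sigma2 lS lA V = hit_ge (phi V) lS (W (pi / 2) - W (omA - pi)).
  by rewrite /sigma2 tau0E tau1E sigma1E tau2E; congr hit_ge; ring.
apply: (hit_ge_eq (is_direction_subpi (is_direction_subpi dS)));
  rewrite ?subr_ge0 ?WlE//.
- by rewrite lerBlDr (le_trans (ltW omA2))// (le_trans omS1)// lerDl pi_ge0.
- by rewrite lerD2r.
- by ring.
- by rewrite opprB addrC subrK subrK WltE ltrD2r.
Qed.

Let W2pi th k : W (th - k%:R * (2 * pi)) = W th - k%:R * period V.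
Proof.
have := clock_periods C1V hV DW (th - k%:R * (2 * pi)) k.
by rewrite subrK => <-; rewrite subKr.
Qed.

Let half_double j : j%:R * pi = j./2%:R * (2 * pi) + (odd j)%:R * pi :> R.
Proof. by rewrite -{1}(odd_double_half j) natrD -muln2 natrM; move: (@pi R) => p; ring. Qed.

(** The times spent between successive angles telescope, and a full turn takes one
    period. *)
Lemma time1E j : time1 lS lA V j = W omS - W (omA - j%:R * pi).
Proof.
rewrite /time1 half_double; case: (odd j); rewrite ?mul1r ?mul0r ?addr0.
  rewrite (_ : omA - _ = omA - pi - j./2%:R * (2 * pi)); last first.
    by move: (@pi R) => p; ring.
  by rewrite W2pi tau1E tau2E sigma1E; ring.
by rewrite W2pi tau1E; ring.
Qed.

Lemma time2E j : time2 lS lA V j = W (omS - pi) - W (omA - pi - j%:R * pi).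
Proof.
have WS : W (omS - pi - pi) = W omS - period V.
  have := W2pi omS 1; rewrite !mul1r => <-; congr W.
  by move: (@pi R) => p; ring.
have WA : W (omA - pi - pi) = W omA - period V.
  have := W2pi omA 1; rewrite !mul1r => <-; congr W.
  by move: (@pi R) => p; ring.
rewrite /time2 half_double; case: (odd j); rewrite ?mul1r ?mul0r ?addr0.
  rewrite (_ : omA - pi - _ = omA - pi - pi - j./2%:R * (2 * pi)); last first.
    by move: (@pi R) => p; ring.
  rewrite W2pi tau1E tau2E sigma2E WS WA; ring.
by rewrite W2pi tau2E; ring.
Qed.

End hitting_times.

(** * Shooting for bounded Caratheodory fields *)

(** The two coordinates of the right-hand side are kept as separate functions.  The
    bound [m] will be integrable and vanish outside of ]0, T]: curves are then
    defined for all times and constant outside of [0, T], which provides the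
    positions at negative times that a delay asks for. *)
Definition dominated_field (R : realType) (m : R -> R) (f : R -> R * R -> R) :=
  [/\ forall z, measurable_fun [set: R] (f ^~ z),
      forall t, continuous (f t) &
      forall t z, `|f t z| <= m t].

Lemma continuous_of_coordinates (R : realType) (w : R -> R * R) :
  continuous (fun s => (w s).1) -> continuous (fun s => (w s).2) ->
  continuous w.
Proof.
move=> c1 c2 s; rewrite (_ : w = fun s => ((w s).1, (w s).2)); last first.
  by apply/funext => u; rewrite -surjective_pairing.
exact: (cvg_pair (c1 s) (c2 s)).
Qed.

(** The superposition [s |-> f s (w s)] is the pointwise limit of the functions
    obtained by freezing [w] on intervals of length [1 / n.+1]. *)
Lemma superposition_measurable (R : realType) (m : R -> R)
    (f : R -> R * R -> R) (w : R -> R * R) :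
  dominated_field m f -> continuous w ->
  measurable_fun [set: R] (fun s => f s (w s)).
Proof.
move=> [mf cf _] cw.
pose q n (s : R) : R := (Num.floor (s * n.+1%:R))%:~R / n.+1%:R.
apply: (@measurable_fun_cvg _ _ _ _ (fun n s => f s (w (q n s)))).
  move=> n _ Y mY; rewrite setTI.
  have -> : (fun s => f s (w (q n s))) @^-1` Y =
      \bigcup_(k : int) (`[k%:~R / n.+1%:R, (k + 1)%:~R / n.+1%:R[%classic `&`
        (f ^~ (w (k%:~R / n.+1%:R)) @^-1` Y)).
    apply/seteqP; split=> s /=.
      move=> Ys; exists (Num.floor (s * n.+1%:R)) => //; split => //=.
      by rewrite in_itv/= ler_pdivrMr// ltr_pdivlMr// floor_itv.
    move=> [k _ [/=]]; rewrite in_itv/= ler_pdivrMr// ltr_pdivlMr// => kn.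
    by rewrite /q (floor_def kn).
  apply: countable_bigcupT_measurable; first exact: countableP.
  move=> k; apply: measurableI => //.
  by have := mf (w (k%:~R / n.+1%:R)) measurableT Y mY; rewrite setTI.
move=> s _; apply: (@continuous_cvg _ _ _ _ _ _ (f s)); first exact: cf.
apply: (@continuous_cvg _ _ _ _ _ _ w); first exact: cw.
apply/cvgrPdist_le => e e0; near=> n.
have n0 : 0 < n.+1%:R :> R by [].
have /andP[f1 f2] := floor_itv (s * n.+1%:R).
have h : `|s - q n s| * n.+1%:R <= 1.
  rewrite -[X in _ * X]gtr0_norm// -normrM mulrBl divfK ?gt_eqF//.
  rewrite ger0_norm ?subr_ge0// lerBlDr addrC; apply: ltW.
  by rewrite -intrD1 in f2 *.
rewrite (@le_trans _ _ n.+1%:R^-1)//.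
  by rewrite -[leRHS]mul1r ler_pdivlMr.
by apply: ltW; near: n; exact: (near_infty_natSinv_lt (PosNum e0)).
Unshelve. all: by end_near. Qed.

Lemma superposition_integrable (R : realType) (m : R -> R)
    (f : R -> R * R -> R) (w : R -> R * R) :
  dominated_field m f -> continuous w ->
  (@lebesgue_measure R).-integrable [set: R] (EFin \o m) ->
  (@lebesgue_measure R).-integrable [set: R] (EFin \o (fun s => f s (w s))).
Proof.
move=> df cw im; apply: (le_integrable _ _ _ im) => //.
  by apply/measurable_EFinP; exact: superposition_measurable df cw.
move=> s _ /=; rewrite lee_fin; have [_ _ fm] := df.
by rewrite (le_trans (fm _ _))// ler_norm.
Qed.

Section delayed_iteration.
Context {R : realType} (T : R) (m : R -> R) (f g : R -> R * R -> R).
Hypothesis im : (@lebesgue_measure R).-integrable [set: R] (EFin \o m).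
Hypotheses (df : dominated_field m f) (dg : dominated_field m g).

Definition primitive0 (h : R -> R) (t : R) : R := primitive h t - primitive h 0.

(** The integral equation [z t = z0 + \int_0^t (f, g) (s, w s) ds], to be read
    with [w = z] for solutions, and with [w] a delayed copy of [z] for their
    approximations. *)
Definition integral_curve (z0 : R * R) (w : R -> R * R) (t : R) : R * R :=
  (z0.1 + primitive0 (fun s => f s (w s)) t,
   z0.2 + primitive0 (fun s => g s (w s)) t).

Definition integral_solution (z : R -> R * R) : Prop :=
  continuous z /\ forall t, z t = integral_curve (z 0) z t.

(** Tonelli's approximations: as soon as [k d >= T], this solves on [0, T] the
    equation with delay [d]. *)
Fixpoint delayed (d : R) (z0 : R * R) (k : nat) : R -> R * R :=
  if k is k'.+1 then
    integral_curve z0 (fun s => delayed d z0 k' (s - d))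
  else fun=> z0.

Let M := primitive m.

Lemma integral_curve_modulus z0 w u v : continuous w -> u <= v ->
  `|(integral_curve z0 w v).1 - (integral_curve z0 w u).1| <= M v - M u /\
  `|(integral_curve z0 w v).2 - (integral_curve z0 w u).2| <= M v - M u.
Proof.
move=> cw uv; have [_ _ fm] := df; have [_ _ gm] := dg.
have E (a : R) h : a + primitive0 h v - (a + primitive0 h u) =
  primitive h v - primitive h u by rewrite /primitive0; ring.
split; rewrite /= E; apply: le_primitive_sub => //.
  exact: superposition_integrable df cw im.
exact: superposition_integrable dg cw im.
Qed.

Let cM : continuous M.
Proof.
move=> t; apply: (@abscont_continuous_at _ (t - 1) (t + 1)).
- by rewrite ltrBlDr ltrDl.
- by rewrite ltrDl.
- exact: abscont_primitive.
Qed.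

Lemma modulus_continuous (h : R -> R) :
  (forall u v, u <= v -> `|h v - h u| <= M v - M u) -> continuous h.
Proof.
move=> hM t; apply/cvgrPdist_le => e e0.
have /cvgrPdist_le /(_ _ e0) := @cM t; apply: filterS => s; apply: le_trans.
have [ts|/ltW st] := leP t s.
  by rewrite distrC (le_trans (hM _ _ ts))// distrC ler_norm.
by rewrite (le_trans (hM _ _ st))// ler_norm.
Qed.

Lemma integral_curve_continuous z0 w : continuous w ->
  continuous (integral_curve z0 w).
Proof.
move=> cw; apply: continuous_of_coordinates; apply: modulus_continuous => u v uv.
  by have [] := integral_curve_modulus z0 cw uv.
by have [] := integral_curve_modulus z0 cw uv.
Qed.

Lemma shift_continuous (w : R -> R * R) d : continuous w ->
  continuous (fun s => w (s - d)).
Proof.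
move=> cw s; apply: (@continuous_comp _ _ _ (fun s => s - d) w); last exact: cw.
exact: (is_derive_contf (is_derive_subf (is_derive_idf s) (is_derive_cstf s d))).
Qed.

Lemma delayed_continuous d z0 k : continuous (delayed d z0 k).
Proof.
elim: k => [|k IH] /=; first by move=> ?; exact: cst_continuous.
by apply: integral_curve_continuous; exact: shift_continuous.
Qed.

Lemma eq_primitive0 (h k : R -> R) t : (forall s, s <= Num.max 0 t -> h s = k s) ->
  primitive0 h t = primitive0 k t.
Proof.
move=> hk; rewrite /primitive0 /primitive; congr (_ - _); apply: eq_Rintegral => s.
  by rewrite inE/= in_itv/= => st; apply: hk; rewrite le_max st orbT.
by rewrite inE/= in_itv/= => st; apply: hk; rewrite le_max st.
Qed.

Hypothesis m0 : forall t, ~~ (0 < t <= T) -> m t = 0.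

Lemma dominated_field0 h t z : dominated_field m h -> ~~ (0 < t <= T) ->
  h t z = 0.
Proof.
move=> [_ _ hm] /m0 mt; apply/eqP; rewrite -normr_le0 -mt; exact: hm.
Qed.

(** Up to time [(k + 1) d] the integral equation only looks at positions up to time
    [k d], so each iteration settles one more interval of length [d]. *)
Lemma delayed_stable d z0 k t : 0 <= d -> t <= k%:R * d ->
  delayed d z0 k.+1 t = delayed d z0 k t.
Proof.
move=> d0; elim: k t => [|k IH] t.
  rewrite mul0r => t0.
  have E h : dominated_field m h -> primitive0 (fun s => h s z0) t = 0.
    move=> dh; rewrite (@eq_primitive0 _ (cst 0)).
      by rewrite /primitive0 /primitive !Rintegral_cst//= !mul0r subrr.
    move=> s; rewrite max_l// => s0; apply: dominated_field0 => //.
    by rewrite ltNge s0.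
  by rewrite /= /integral_curve !E// !addr0 -surjective_pairing.
move=> tk.
have E h : dominated_field m h ->
    primitive0 (fun s => h s (delayed d z0 k.+1 (s - d))) t =
    primitive0 (fun s => h s (delayed d z0 k (s - d))) t.
  move=> dh; apply: eq_primitive0 => s sm.
  have [s0|s0] := leP s 0; first by rewrite !dominated_field0// ltNge s0.
  rewrite IH//; move: sm; rewrite le_max leNgt s0/= => st.
  by rewrite lerBlDr (le_trans st)// -[X in _ + X]mul1r -mulrDl natr1.
by rewrite -[LHS]/(integral_curve _ _ _) /integral_curve !E.
Qed.

(** Each iteration is an integral that depends continuously on the previous one, by
    dominated convergence. *)
Lemma delayed_parameter_continuous d (v : R * R) k t :
  continuous (fun c : R => (delayed d (c *: v) k t).1) /\
  continuous (fun c : R => (delayed d (c *: v) k t).2).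
Proof.
elim: k t => [|k IH] t.
  split=> c /=.
    exact: (is_derive_contf (is_derive_mulf (is_derive_idf c) (is_derive_cstf c v.1))).
  exact: (is_derive_contf (is_derive_mulf (is_derive_idf c) (is_derive_cstf c v.2))).
have key (h : R -> R * R -> R) : dominated_field m h -> forall u : R,
    continuous (fun c : R => primitive (fun s => h s (delayed d (c *: v) k (s - d))) u).
  move=> dh u c; have [mh ch hm] := dh.
  have ih c' : (@lebesgue_measure R).-integrable [set: R]
      (EFin \o (fun s => h s (delayed d (c' *: v) k (s - d)))).
    apply: (superposition_integrable dh _ im); apply: shift_continuous.
    exact: delayed_continuous.
  apply: (@continuity_under_integral R _ _ lebesgue_measure
    (fun c s => h s (delayed d (c *: v) k (s - d))) `]-oo, u]%classic _ (c - 1) (c + 1) _ _ m).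
  - by [].
  - by move=> x _; exact: integrableS (ih x).
  - apply: aeW => s _ x _.
    apply: (@continuous_comp _ _ _ (fun c : R => delayed d (c *: v) k (s - d)) (h s)).
      have [c1 c2] := IH (s - d).
      exact: (@continuous_of_coordinates _ (fun c : R => delayed d (c *: v) k (s - d)) c1 c2).
    exact: ch.
  - exact: integrableS im.
  - by move=> x _; apply: aeW => s _; exact: hm.
  - by rewrite inE/= in_itv/= ltrDl ltr01 andbT ltrBlDr ltrDl.
have key0 (h : R -> R * R -> R) (a : R) : dominated_field m h -> 
    continuous (fun c : R => c * a + primitive0 (fun s => h s (delayed d (c *: v) k (s - d))) t).
  move=> dh c; apply: (@continuousD _ _ _ (fun c : R => c * a)).
    exact: (is_derive_contf (is_derive_mulf (is_derive_idf c) (is_derive_cstf c a))).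
  exact: (continuousB (key _ dh t c) (key _ dh 0 c)).
by split; [exact: (key0 f v.1)|exact: (key0 g v.2)].
Qed.

End delayed_iteration.

Lemma close_of_third (R : realFieldType) (a b a' b' D e : R) :
  `|a' - a| < e / 3 -> `|b' - a'| <= D -> `|b - a| <= D -> D < e / 3 ->
  `|b' - b| < e.
Proof.
move=> /ltr_normlP[? ?] /ler_normlP[? ?] /ler_normlP[? ?] ?.
by apply/ltr_normlP; split; lra.
Qed.

Lemma close_of_half (R : realFieldType) (a b c p q e : R) :
  `|a - b| <= p -> `|a - c| < q -> p < e / 2 -> q < e / 2 -> `|c - b| < e.
Proof.
move=> /ler_normlP[? ?] /ltr_normlP[? ?] ? ?.
by apply/ltr_normlP; split; lra.
Qed.

Lemma dist_le_limit (R : realFieldType) (a b a' b' e : R) :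
  `|a' - a| < e -> `|b' - b| < e -> `|b - a| <= `|b' - a'| + 2 * e.
Proof.
move=> /ltr_normlP[? ?] /ltr_normlP[? ?].
have := ler_norm (b' - a'); have := ler_norm (- (b' - a')); rewrite normrN.
by move=> ? ?; apply/ler_normlP; split; lra.
Qed.

(** Tychonoff's theorem for sequences of pointwise bounded curves, phrased with
    finitely many test times so that no subsequence has to be chosen. *)
Lemma pointwise_cluster (R : realType) (zs : nat -> R -> R * R) (K : R -> R) :
  (forall n t, `|(zs n t).1| <= K t /\ `|(zs n t).2| <= K t) ->
  exists z : R -> R * R, forall (ts : seq R) e N, 0 < e ->
    exists2 n, (N <= n)%N & forall t, t \in ts ->
      `|(zs n t).1 - (z t).1| < e /\ `|(zs n t).2 - (z t).2| < e.
Proof.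
move=> zK.
pose A (t : R) : set (R * R) := `[- K t, K t]%classic `*` `[- K t, K t]%classic.
have cA t : compact (A t) by apply: compact_setX; exact: segment_compact.
pose PT := prod_topology (fun _ : R => (R * R)%type).
pose F : set_system PT := (fun n => zs n : PT) @ \oo.
have PF : ProperFilter F by exact: fmap_proper_filter.
have [|z [_ clz]] := @tychonoff R (fun _ : R => (R * R)%type) A cA F PF.
  by exists 0%N => // n _ /= t; rewrite /A/= !in_itv/= -!ler_norml.
exists z => ts e N e0.
pose B : set PT := [set u | forall t, t \in ts ->
  `|(u t).1 - (z t).1| < e /\ `|(u t).2 - (z t).2| < e].
have zF : Filter (nbhs (z : PT)) by exact: nbhs_filter.
have nB : nbhs (z : PT) B.
  rewrite /B; elim: ts {B} => [|t0 ts IH]; first by apply: filterE => u t.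
  have nt0 : nbhs (z : PT) (proj t0 @^-1` ball (z t0) e).
    apply: (@proj_continuous _ (fun _ : R => (R * R)%type) t0 z).
    exact: nbhsx_ballx.
  apply: filterS (filterI nt0 IH) => u [ut0 uts] t.
  rewrite inE => /predU1P[->|]; last exact: uts.
  by move: ut0 => [/= b1 b2]; rewrite distrC (distrC _.2).
have FA : F [set (zs n : PT) | n in [set n | (N <= n)%N]].
  by exists N => // n Nn /=; exists n.
have [_ [[n Nn <-] Bn]] := clz _ _ FA nB.
by exists n.
Qed.

Section limits.
Context {R : realType} (T : R) (m : R -> R) (f g : R -> R * R -> R).
Hypothesis im : (@lebesgue_measure R).-integrable [set: R] (EFin \o m).
Hypotheses (df : dominated_field m f) (dg : dominated_field m g).
Hypothesis m0 : forall t, ~~ (0 < t <= T) -> m t = 0.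

Let M := primitive m.

(** The curves [zs n] share the modulus of continuity [M], hence so does any
    cluster point, and closeness on a fine grid of times is uniform closeness.
    The delayed curves [ws n] then converge as well, and dominated convergence
    carries the integral equation to the limit. *)
Lemma delayed_limit (zs ws : nat -> R -> R * R) (z0 : nat -> R * R) (d : nat -> R)
    (K : R) :
  0 <= T ->
  (forall n, `|(z0 n).1| <= K /\ `|(z0 n).2| <= K) ->
  (forall n, continuous (ws n)) ->
  (forall n t, zs n t = integral_curve f g (z0 n) (ws n) t) ->
  (forall n s, 0 < s -> s <= T -> ws n s = zs n (s - d n)) ->
  (forall n, 0 <= d n) -> d @ \oo --> 0 ->
  exists2 z, integral_solution f g z &
    forall e N, 0 < e -> exists2 n, (N <= n)%N & forall t, 0 <= t <= T ->
      `|(zs n t).1 - (z t).1| < e /\ `|(zs n t).2 - (z t).2| < e.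
Proof.
move=> T0 z0K cws zsE wsE d0 dcvg.
have zsM n u v : u <= v -> `|(zs n v).1 - (zs n u).1| <= M v - M u /\
    `|(zs n v).2 - (zs n u).2| <= M v - M u.
  by move=> uv; rewrite !zsE; exact: integral_curve_modulus.
have zs0 n : zs n 0 = z0 n.
  rewrite zsE /integral_curve /primitive0 !subrr !addr0.
  by rewrite -surjective_pairing.
have zsK n t : `|(zs n t).1| <= K + `|M t - M 0| /\ `|(zs n t).2| <= K + `|M t - M 0|.
  have [K1 K2] := z0K n.
  have [t1 t2] : `|(zs n t).1 - (z0 n).1| <= `|M t - M 0| /\
      `|(zs n t).2 - (z0 n).2| <= `|M t - M 0|.
    rewrite -zs0; have [t0|/ltW t0] := leP 0 t.
      by have [h1 h2] := zsM n _ _ t0; split; [apply: le_trans h1 _|apply: le_trans h2 _];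
        exact: ler_norm.
    have [h1 h2] := zsM n _ _ t0; rewrite distrC (distrC (zs n t).2) (distrC (M t)).
    by split; [apply: le_trans h1 _|apply: le_trans h2 _]; exact: ler_norm.
  split.
    by rewrite -[X in `|X|](subrK (z0 n).1) (le_trans (ler_normD _ _))// addrC lerD.
  by rewrite -[X in `|X|](subrK (z0 n).2) (le_trans (ler_normD _ _))// addrC lerD.
have [z zcl] := pointwise_cluster zsK.
have zM u v : u <= v -> `|(z v).1 - (z u).1| <= M v - M u /\
    `|(z v).2 - (z u).2| <= M v - M u.
  move=> uv.
  by split; apply/ler_addgt0Pl => e e0;
    have e2 : 0 < e / 2 by [rewrite divr_gt0];
    have [n _ H] := zcl [:: u; v] _ 0%N e2;
    have [h1 h2] := zsM n _ _ uv;
    have [|u1 u2] := H u; rewrite ?inE ?eqxx//;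
    have [|v1 v2] := H v; rewrite ?inE ?eqxx ?orbT//;
    [apply: le_trans (dist_le_limit u1 v1) _|apply: le_trans (dist_le_limit u2 v2) _];
    rewrite mulrC divfK// addrC lerD2l.
have cz : continuous z.
  by apply: continuous_of_coordinates; apply: (modulus_continuous im) => u v uv;
    have [] := zM _ _ uv.
(* one grid on which [M] hardly varies between neighbours turns closeness at
   finitely many times into uniform closeness *)
have zunif e N : 0 < e -> exists2 n, (N <= n)%N & forall t, 0 <= t <= T ->
      `|(zs n t).1 - (z t).1| < e /\ `|(zs n t).2 - (z t).2| < e.
  move=> e0; have e3 : 0 < e / 3 by rewrite divr_gt0.
  have [r r0 Mr] := abscont_within (abscont_primitive 0 T im) e3.
  pose k := (Num.truncn (T / r)).+1.
  pose ts := [seq i%:R * r | i <- iota 0 k].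
  have [n Nn H] := zcl ts _ N e3; exists n => // t /andP[t0 tT].
  pose i := Num.truncn (t / r).
  have /andP[it ti] := truncn_itv (divr_ge0 t0 (ltW r0)).
  rewrite -/i ler_pdivlMr// in it; rewrite -/i ltr_pdivrMr// in ti.
  have its : i%:R * r \in ts.
    apply/mapP; exists i => //; rewrite mem_iota/= add0n ltnS le_truncn//.
    by rewrite ler_wpM2r// invr_ge0 ltW.
  have ir0 : 0 <= i%:R * r by rewrite mulr_ge0// ltW.
  have Mi : `|M t - M (i%:R * r)| < e / 3.
    by apply: Mr => //; rewrite ltrBlDr -[X in X + _]mul1r -mulrDl addrC natr1.
  have [zi1 zi2] := H _ its; have [n1 n2] := zsM n _ _ it; have [l1 l2] := zM _ _ it.
  have M' := le_lt_trans (ler_norm _) Mi.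
  by split; [exact: close_of_third zi1 n1 l1 M'|exact: close_of_third zi2 n2 l2 M'].
have /choice[nu nuP] : forall k, exists n, (k <= n)%N /\ forall t, 0 <= t <= T ->
    `|(zs n t).1 - (z t).1| < k.+1%:R^-1 /\ `|(zs n t).2 - (z t).2| < k.+1%:R^-1.
  by move=> k; have [|n kn H] := zunif k.+1%:R^-1 k; [rewrite invr_gt0|exists n].
have zcvg t : 0 <= t <= T -> (zs (nu k) t).1 @[k --> \oo] --> (z t).1 /\
    (zs (nu k) t).2 @[k --> \oo] --> (z t).2.
  move=> t0T; split; apply/cvgrPdist_lt => e e0; near=> k;
    have [_ /(_ _ t0T) [h1 h2]] := nuP k; rewrite distrC;
    [apply: lt_trans h1 _|apply: lt_trans h2 _]; near: k;
    exact: (near_infty_natSinv_lt (PosNum e0)).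
have wcvg s : 0 < s -> s <= T -> ws (nu k) s @[k --> \oo] --> z s.
  move=> s0 sT.
  have cMs : {for s, continuous M}.
    apply: (@abscont_continuous_at _ (s - 1) (s + 1)); last exact: abscont_primitive.
      by rewrite ltrBlDr ltrDl.
    by rewrite ltrDl.
  have close e : 0 < e -> \forall k \near \oo,
      `|(z s).1 - (ws (nu k) s).1| < e /\ `|(z s).2 - (ws (nu k) s).2| < e.
    move=> e0; have e2 : 0 < e / 2 by rewrite divr_gt0.
    have [r /= r0 Mr] := (@cvgrPdist_lt _ _ _ _ _ _ _).1 cMs _ e2.
    have [D _ dD] := (@cvgrPdist_lt _ _ _ _ _ _ _).1 dcvg _ r0.
    near=> k.
    have [kn /(_ s)] := nuP k; rewrite (ltW s0) sT => /(_ isT)[h1 h2].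
    have dr : d (nu k) < r.
      have := dD (nu k); rewrite /= sub0r normrN (ger0_norm (d0 _)); apply.
      by rewrite (leq_trans _ kn)//; near: k; exists D.
    have ss : s - d (nu k) <= s by rewrite gerBl.
    have Ms : M s - M (s - d (nu k)) < e / 2.
      apply: le_lt_trans (ler_norm _) _; apply: Mr => /=.
      by rewrite opprB addrC subrK ger0_norm.
    have [l1 l2] := zsM (nu k) _ _ ss; rewrite -wsE// in l1 l2.
    have ke : k.+1%:R^-1 < e / 2 by near: k; exact: (near_infty_natSinv_lt (PosNum e2)).
    by split; [exact: close_of_half l1 h1 Ms ke|exact: close_of_half l2 h2 Ms ke].
  rewrite (surjective_pairing (z s)).
  rewrite (_ : (fun k => _) = (fun k => ((ws (nu k) s).1, (ws (nu k) s).2))); last first.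
    by apply/funext => k; rewrite -surjective_pairing.
  have c1 : (ws (nu k) s).1 @[k --> \oo] --> (z s).1.
    by apply/cvgrPdist_lt => e /close; apply: filterS => k [].
  have c2 : (ws (nu k) s).2 @[k --> \oo] --> (z s).2.
    by apply/cvgrPdist_lt => e /close; apply: filterS => k [].
  exact: (cvg_pair c1 c2).
have pcvg h u : dominated_field m h ->
    primitive (fun s => h s (ws (nu k) s)) u @[k --> \oo] --> primitive (fun s => h s (z s)) u.
  move=> dh; have [mh ch hm] := dh.
  have ih w : continuous w -> (@lebesgue_measure R).-integrable `]-oo, u]
      (EFin \o (fun s => h s (w s))).
    by move=> cw; apply: integrableS (superposition_integrable dh cw im).
  apply: fine_cvg; rewrite fineK; last by apply: integrable_fin_num => //; exact: ih.
  apply: (@dominated_cvg _ _ _ lebesgue_measure `]-oo, u]%classic _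
    (fun k s => (h s (ws (nu k) s))%:E) _ (EFin \o m)) => //.
  - by move=> k; exact: measurable_int (ih _ (cws (nu k))).
  - move=> s _; apply: cvg_EFin; first by apply: nearW.
    have [/andP[s0 sT]|s0T] := boolP (0 < s <= T).
      by apply: (@continuous_cvg _ _ _ _ _ _ (h s)); [exact: ch|exact: wcvg].
    rewrite (_ : fine \o _ = cst (h s (z s))); first exact: cvg_cst.
    by apply/funext => k /=; rewrite !(dominated_field0 m0 _ dh).
  - exact: integrableS im.
  - by move=> k s _ /=; rewrite lee_fin.
have p0cvg h u : dominated_field m h ->
    primitive0 (fun s => h s (ws (nu k) s)) u @[k --> \oo] --> primitive0 (fun s => h s (z s)) u.
  by move=> dh; apply: cvgB; exact: pcvg.
have zE t : 0 <= t <= T -> z t = integral_curve f g (z 0) z t.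
  move=> t0T; have [c1 c2] := zcvg _ t0T.
  have [|i1 i2] := zcvg 0; first by rewrite lexx.
  rewrite (surjective_pairing (z t)); congr (_, _).
    apply: (cvg_unique (@Rhausdorff R) c1).
    rewrite (_ : (fun k => _) = (fun k => (zs (nu k) 0).1 +
      primitive0 (fun s => f s (ws (nu k) s)) t)).
      by apply: cvgD => //; exact: p0cvg.
    by apply/funext => k; rewrite zs0 zsE.
  apply: (cvg_unique (@Rhausdorff R) c2).
  rewrite (_ : (fun k => _) = (fun k => (zs (nu k) 0).2 +
    primitive0 (fun s => g s (ws (nu k) s)) t)).
    by apply: cvgD => //; exact: p0cvg.
  by apply/funext => k; rewrite zs0 zsE.
(* outside of [0, T] the cluster point need not satisfy the integral equation *)
pose zb := integral_curve f g (z 0) z.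
have zb0 : zb 0 = z 0 by rewrite /zb -zE// lexx.
have fzb h s : dominated_field m h -> h s (z s) = h s (zb s).
  move=> dh; have [/andP[s0 sT]|s0T] := boolP (0 < s <= T).
    by rewrite /zb -zE// (ltW s0).
  by rewrite !(dominated_field0 m0 _ dh).
exists zb; last first.
  move=> e N e0; have [n Nn H] := zunif e N e0; exists n => // t t0T.
  by rewrite /zb -zE//; exact: H.
split=> [|t]; first exact: (integral_curve_continuous im df dg).
rewrite zb0 /zb /integral_curve; congr (_ + _, _ + _).
  by congr primitive0; apply/funext => s; exact: fzb.
by congr primitive0; apply/funext => s; exact: fzb.
Unshelve. all: by end_near. Qed.

End limits.

Section shooting.
Context {R : realType} (T : R) (m : R -> R) (f g : R -> R * R -> R).
Hypothesis T0 : 0 < T.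
Hypothesis im : (@lebesgue_measure R).-integrable [set: R] (EFin \o m).
Hypotheses (df : dominated_field m f) (dg : dominated_field m g).
Hypothesis m0 : forall t, ~~ (0 < t <= T) -> m t = 0.
Variables (v : R * R) (a b : R).

(* after [n + 1] iterations with delay [T / (n + 1)] the curve is settled on all of
   [0, T] *)
Let shot (n : nat) (c : R) := delayed f g (T / n.+1%:R) (c *: v) n.+1.
Let side (z : R * R) : R := a * z.1 + b * z.2.

Lemma shots_limit (nu : nat -> nat) (c : nat -> R) (K : R) :
  (forall j, (j <= nu j)%N) -> (forall j, `|c j| <= K) ->
  exists2 z, integral_solution f g z &
    forall e N, 0 < e -> exists2 j, (N <= j)%N & forall t, 0 <= t <= T ->
      `|(shot (nu j) (c j) t).1 - (z t).1| < e /\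
      `|(shot (nu j) (c j) t).2 - (z t).2| < e.
Proof.
move=> nuj cK.
have d0 j : 0 <= T / (nu j).+1%:R by rewrite divr_ge0// ltW.
apply: (@delayed_limit _ T m f g im df dg m0 (fun j => shot (nu j) (c j))
  (fun j s => delayed f g (T / (nu j).+1%:R) (c j *: v) (nu j) (s - T / (nu j).+1%:R))
  (fun j => c j *: v) (fun j => T / (nu j).+1%:R) (K * (`|v.1| + `|v.2|))) => //.
- exact: ltW.
- move=> j; have K0 : 0 <= K by rewrite (le_trans _ (cK j)).
  rewrite /= !normrM; split; apply: ler_pM => //; first by rewrite lerDl.
  by rewrite lerDr.
- by move=> j; apply: shift_continuous; exact: (delayed_continuous im).
- move=> j s s0 sT; rewrite /shot (delayed_stable df dg m0)//.
  rewrite lerBlDr -{2}[T / _]mul1r -mulrDl natr1 mulrCA divff ?mulr1//.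
- apply/cvgrPdist_lt => e e0; near=> j; rewrite sub0r normrN ger0_norm//.
  apply: (@le_lt_trans _ _ (T / j.+1%:R)).
    by rewrite ler_pM2l// lef_pV2 ?posrE// ler_nat ltnS.
  rewrite mulrC -ltr_pdivlMr//; near: j.
  have eT : 0 < e / T by rewrite divr_gt0.
  exact: (near_infty_natSinv_lt (PosNum eT)).
Unshelve. all: by end_near. Qed.

Lemma side_dist (z w : R * R) (e : R) :
  `|z.1 - w.1| < e -> `|z.2 - w.2| < e -> `|side z - side w| <= (`|a| + `|b|) * e.
Proof.
move=> /ltW h1 /ltW h2; rewrite /side.
rewrite (_ : _ - _ = a * (z.1 - w.1) + b * (z.2 - w.2)); last by ring.
by rewrite (le_trans (ler_normD _ _))// !normrM mulrDl lerD// ler_wpM2l.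
Qed.

(** Approximating curves on the wrong side at arbitrarily fine scales would
    accumulate at a solution on the wrong side. *)
Lemma shots_eventually_positive (s : R) (c : R) :
  (forall z, integral_solution f g z -> z 0 = c *: v ->
     0 < s * side (z T)) ->
  exists N, forall n, (N <= n)%N -> 0 < s * side (shot n c T).
Proof.
move=> H; apply: contrapT => /forallNP C.
have /choice[nu nuP] : forall j, exists n, (j <= n)%N /\ s * side (shot n c T) <= 0.
  move=> j; have /existsNP[n /not_implyP[jn /negP]] := C j.
  by rewrite -leNgt => h; exists n.
have [z zE zl] := @shots_limit nu (fun=> c) `|c| (fun j => (nuP j).1) (fun=> lexx _).
have TT : 0 <= T <= T by rewrite (ltW T0) lexx.
have OT : (0 <= (0 : R)) && (0 <= T) by rewrite lexx ltW.
have shot0 n : shot n c 0 = c *: v.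
  rewrite /shot/= /integral_curve /primitive0 !subrr !addr0.
  by rewrite -surjective_pairing.
have z0 : z 0 = c *: v.
  rewrite (surjective_pairing (z 0)) (surjective_pairing (c *: v)).
  congr (_, _); apply/eqP; rewrite eq_sym -subr_eq0 -normr_le0; apply/ler_addgt0Pl => e e0;
    have [j _ /(_ _ OT)[h1 h2]] := zl e 0%N e0; rewrite shot0 in h1 h2; rewrite addr0;
    [exact: ltW h1|exact: ltW h2].
have := H z zE z0; rewrite ltNge => /negP; apply.
apply/ler_addgt0Pl => e e0; rewrite addr0.
pose C0 := `|s| * (`|a| + `|b|) + 1.
have C00 : 0 < C0 by rewrite ltr_wpDl// mulr_ge0// addr_ge0.
have eC : 0 < e / C0 by rewrite divr_gt0.
have [j _ /(_ _ TT)[h1 h2]] := zl _ 0%N eC.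
have := side_dist h1 h2; rewrite distrC => sd.
have sd2 : s * (side (z T) - side (shot (nu j) c T)) <= e.
  rewrite (le_trans (ler_norm _))// normrM (le_trans (ler_wpM2l _ sd))// mulrA.
  rewrite mulrA ler_pdivrMr// mulrC ler_wpM2l ?(ltW e0)//.
  by rewrite /C0 lerDl.
have [_ sle] := nuP j.
by rewrite mulrBr in sd2; lra.
Qed.

(** The intermediate value theorem provides, for each delay, a starting point on
    the segment from [- c *: v] to [c *: v] whose curve ends on the target line;
    these curves accumulate at a solution. *)
Theorem shooting (c : R) : 0 <= c ->
  (forall z, integral_solution f g z -> z 0 = c *: v ->
     0 < a * (z T).1 + b * (z T).2) ->
  (forall z, integral_solution f g z -> z 0 = - c *: v ->
     a * (z T).1 + b * (z T).2 < 0) ->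
  exists z, [/\ integral_solution f g z, (z 0).1 * v.2 = (z 0).2 * v.1,
    `|(z 0).1| <= c * `|v.1| /\ `|(z 0).2| <= c * `|v.2| &
    a * (z T).1 + b * (z T).2 = 0].
Proof.
move=> c0 Hp Hn.
have [N1 P1] := @shots_eventually_positive 1 c (fun z zE z0 => 
  eq_ind_r (fun x => 0 < x) (Hp z zE z0) (mul1r _)).
have [N2 P2] : exists N, forall n, (N <= n)%N -> 0 < -1 * side (shot n (- c) T).
  by apply: shots_eventually_positive => z zE z0; rewrite mulN1r oppr_gt0; exact: Hn.
pose N := maxn N1 N2.
have cc : - c <= c by rewrite (le_trans _ c0)// oppr_le0.
have /choice[r rP] : forall j, exists r, `|r| <= c /\ side (shot (N + j) r T) = 0.
  move=> j; pose psi r := side (shot (N + j) r T).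
  have cpsi : continuous psi.
    move=> r; have [c1 c2] := delayed_parameter_continuous im df dg (T / (N + j).+1%:R) v (N + j).+1 T.
    apply: (@continuousD _ _ _ (fun r : R => a * (shot (N + j) r T).1)).
      by apply: (@continuousM _ _ (fun=> a)); [exact: cst_continuous|exact: c1].
    by apply: (@continuousM _ _ (fun=> b)); [exact: cst_continuous|exact: c2].
  have p1 : 0 < psi c.
    by have := P1 (N + j)%N; rewrite mul1r; apply; rewrite (leq_trans (leq_maxl _ N2)) ?leq_addr.
  have p2 : psi (- c) < 0.
    have := P2 (N + j)%N; rewrite mulN1r oppr_gt0; apply.
    by rewrite (leq_trans (leq_maxr N1 _)) ?leq_addr.
  have [|r rc r0] := @IVT _ psi _ _ 0 cc (continuous_subspaceT cpsi).
    by rewrite ge_min le_max (ltW p1) (ltW p2)/= orbT.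
  by exists r; rewrite ler_norml; move: rc; rewrite in_itv.
have [|z zE zl] := @shots_limit (fun j => (N + j)%N) r c _ (fun j => (rP j).1).
  by move=> j; rewrite leq_addl.
have TT : 0 <= T <= T by rewrite (ltW T0) lexx.
have OT : (0 <= (0 : R)) && (0 <= T) by rewrite lexx ltW.
have shot0 n r' : shot n r' 0 = r' *: v.
  rewrite /shot/= /integral_curve /primitive0 !subrr !addr0.
  by rewrite -surjective_pairing.
exists z; split => //.
- apply/eqP; rewrite -subr_eq0 -normr_le0; apply/ler_addgt0Pl => e e0; rewrite addr0.
  pose C0 := `|v.1| + `|v.2| + 1.
  have C00 : 0 < C0 by rewrite ltr_wpDl// addr_ge0.
  have eC : 0 < e / C0 by rewrite divr_gt0.
  have [j _ /(_ _ OT)[h1 h2]] := zl _ 0%N eC.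
  rewrite shot0 in h1 h2.
  rewrite (_ : _ - _ = (r j * v.2 - (z 0).2) * v.1 - (r j * v.1 - (z 0).1) * v.2); last by ring.
  rewrite (le_trans (ler_normB _ _))// !normrM.
  apply: (@le_trans _ _ (e / C0 * `|v.1| + e / C0 * `|v.2|)).
    by apply: lerD; rewrite ler_wpM2r// ltW.
  rewrite -mulrDr mulrAC ler_pdivrMr// ler_wpM2l ?(ltW e0)//.
  by rewrite /C0 lerDl.
- have near0 (p q x : R) e : `|x| <= c -> `|x * p - q| < e -> `|q| <= e + c * `|p|.
    move=> xc h; rewrite -[q](subKr (x * p)) (le_trans (ler_normB _ _))//.
    by rewrite addrC lerD ?(ltW h)// normrM ler_wpM2r.
  by split; apply/ler_addgt0Pl => e e0; have [j _ /(_ _ OT)] := zl _ 0%N e0;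
    rewrite shot0 => -[h1 h2]; [exact: near0 (rP j).1 h1|exact: near0 (rP j).1 h2].
- apply/eqP; rewrite -normr_le0; apply/ler_addgt0Pl => e e0; rewrite addr0.
  pose C0 := `|a| + `|b| + 1.
  have C00 : 0 < C0 by rewrite ltr_wpDl// addr_ge0.
  have eC : 0 < e / C0 by rewrite divr_gt0.
  have [j _ /(_ _ TT)[h1 h2]] := zl _ 0%N eC.
  have := side_dist h1 h2; rewrite (rP j).2 sub0r normrN => h; apply: le_trans h _.
  by rewrite mulrA ler_pdivrMr// mulrC ler_wpM2l ?(ltW e0)// /C0 lerDl.
Qed.

End shooting.

(** * Borel versions of Caratheodory functions *)

Lemma negligible_countable (R : realType) (I : countType) (F : I -> set R) :
  (forall i, (@lebesgue_measure R).-negligible (F i)) ->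
  (@lebesgue_measure R).-negligible (\bigcup_i F i).
Proof.
move=> nF; pose G (k : nat) := if unpickle k is Some i then F i else set0.
apply: (@negligibleS _ _ _ (@lebesgue_measure R) (\bigcup_k G k)).
  by move=> x [i _ Fx]; exists (pickle i) => //; rewrite /G pickleK.
apply: negligible_bigcup => k; rewrite /G; case: (unpickle k) => // .
exact: negligible_set0.
Qed.

(** The preimages of the half-lines with rational endpoints are Borel up to
    countably many null sets, whose union is the set to be removed. *)
Lemma lebesgue_measurable_borel (R : realType) (D : set R) (h : R -> R) :
  measurable D -> lebesgue_measurable_fun D h ->
  exists N, [/\ measurable N, (@lebesgue_measure R) N = 0%E &
    measurable_fun (D `\` N) h].
Proof.
move=> mD mh.
have mDc : (completed_algebra_gen (@lebesgue_measure R)).-sigma.-measurable D.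
  apply: sub_sigma_algebra; exists D => //; exists set0; last by rewrite setU0.
  exact: negligible_set0.
have /choice[BN BNP] : forall q : rat, exists BN : set R * set R,
    [/\ measurable BN.1, (@lebesgue_measure R).-negligible BN.2 &
      D `&` h @^-1` `]-oo, ratr q[%classic = BN.1 `|` BN.2].
  move=> q; have := mh mDc `]-oo, ratr q[%classic (measurable_itv _).
  rewrite [X in X _ -> _]g_sigma_completed_algebra_genE => -[B mB [N nN BNE]].
  by exists (B, N).
have [N [mN N0 sN]] : (@lebesgue_measure R).-negligible (\bigcup_q (BN q).2).
  by apply: negligible_countable => q; have [] := BNP q.
exists N; split => //.
apply: (measurability (@RGenInftyO.G R)); first exact: RGenInftyO.measurableE.
move=> _ [_ [r ->] <-].
rewrite (_ : _ `&` _ = \bigcup_(q : rat)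
    (if ratr q < r then (BN q).1 `\` N else set0)); last first.
  apply/seteqP; split=> x /=.
    rewrite in_itv/= => -[[Dx Nx] hr].
    have [q] := rat_in_itvoo hr; rewrite in_itv/= => /andP[hq qr].
    exists q => //; rewrite qr; split => //.
    have [_ _ E] := BNP q; have : (D `&` h @^-1` `]-oo, ratr q[%classic) x.
      by split => //=; rewrite in_itv.
    by rewrite E => -[//|Nq]; exfalso; apply: Nx; apply: sN; exists q.
  move=> [q _]; case: ifPn => // qr [Bx Nx].
  have [_ _ E] := BNP q; have : (D `&` h @^-1` `]-oo, ratr q[%classic) x.
    by rewrite E; left.
  rewrite /= !in_itv/= => -[Dx hq]; split => //.
  exact: lt_trans qr.
apply: countable_bigcupT_measurable; first exact: countableP.
move=> q; case: ifPn => // _; apply: measurableD => //.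
by have [] := BNP q.
Qed.

(** Only the rational positions require null sets to be removed; continuity in
    space passes Borel measurability on to all other positions. *)
Lemma caratheodory_borel (R : realType) (T : R) (f : R -> R * R -> R) :
  caratheodory T f ->
  exists E : set R, [/\ measurable E, E `<=` `]0, T]%classic,
    {ae @lebesgue_measure R, forall t, t \in `[0, T] -> E t},
    (forall t, E t -> continuous (f t)) &
    forall z, measurable_fun E (f ^~ z)].
Proof.
move=> [mf [N1 [mN1 N10 cf]]].
have m0T : measurable (`[0, T]%classic : set R) by [].
pose pt (q : rat * rat) : R * R := (ratr q.1, ratr q.2).
have /choice[N2 N2P] : forall q, exists N, [/\ measurable N,
    (@lebesgue_measure R) N = 0%E & measurable_fun (`[0, T]%classic `\` N) (f ^~ (pt q))].
  by move=> q; exact: lebesgue_measurable_borel (mf (pt q)).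
have nN1 : (@lebesgue_measure R).-negligible N1 by exists N1; split.
have nN2 : (@lebesgue_measure R).-negligible (\bigcup_q N2 q).
  by apply: negligible_countable => q; have [mN N0 _] := N2P q; exists (N2 q); split.
have nO : (@lebesgue_measure R).-negligible [set (0 : R)].
  by exists [set 0]; split => //; exact: lebesgue_measure_set1.
have [N [mN N0 sN]] := negligibleU nO (negligibleU nN1 nN2).
have sN1 t : t \in `[0, T] -> ~ N t -> continuous (f t).
  move=> tT Nt; apply: contrapT => cft; apply: Nt; apply: sN; right; left.
  by apply: cf => /= /(_ tT).
exists (`[0, T]%classic `\` N); split.
- exact: measurableD.
- move=> t /= [+ Nt]; rewrite !in_itv/= => /andP[t0 ->]; rewrite andbT.
  rewrite lt_neqAle t0 andbT; apply/eqP => t00; apply: Nt; apply: sN; left.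
  by rewrite -t00.
- exists N; split => // t /= /not_implyP[tT Et]; apply: contrapT => Nt.
  exact: Et.
- by move=> t [/= tT Nt]; exact: sN1.
- have mq q : measurable_fun (`[0, T]%classic `\` N) (f ^~ (pt q)).
    have [_ _] := N2P q; apply: measurable_funS.
      by apply: measurableD => //; have [] := N2P q.
    move=> t [tT Nt]; split => // Nqt; apply: Nt; apply: sN; right; right.
    by exists q.
  have approx (x : R) : exists2 q : nat -> rat, ratr (q n) @[n --> \oo] --> x & True.
    have /choice[q qP] : forall n : nat, exists q : rat, ratr q \in `]x, x + n.+1%:R^-1[.
      by move=> n; apply: rat_in_itvoo; rewrite ltrDl invr_gt0.
    exists q => //; apply/cvgrPdist_lt => e e0; near=> n.
    have := qP n; rewrite in_itv/= => /andP[q1 q2].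
    rewrite ltr0_norm ?subr_lt0// opprB ltrBlDl (lt_trans q2)// ltrD2l.
    by near: n; exact: (near_infty_natSinv_lt (PosNum e0)).
  move=> z; have [q1 q1z _] := approx z.1; have [q2 q2z _] := approx z.2.
  apply: (@measurable_fun_cvg _ _ _ _ (fun n => f ^~ (pt (q1 n, q2 n)))).
    by move=> n; exact: mq.
  move=> t [tT Nt]; apply: (@continuous_cvg _ _ _ _ _ _ (f t)).
    exact: sN1.
  rewrite (surjective_pairing z); exact: (cvg_pair q1z q2z).
Unshelve. all: by end_near. Qed.

(** * Growth and rotation of solutions *)

(** The derivative [2 u / (1 + u^2)] is at most one in absolute value. *)
Lemma ln_sqr_lipschitz (R : realType) (r s : R) :
  `|ln (1 + r ^+ 2) - ln (1 + s ^+ 2)| <= `|r - s|.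
Proof.
wlog sr : r s / s <= r.
  by move=> H; have [/H//|/ltW/H] := leP s r; rewrite distrC (distrC s).
have p0 (u : R) : 0 < 1 + u ^+ 2 by rewrite ltr_wpDr// sqr_ge0.
have D : forall u : R, is_derive u 1 (fun u => ln (1 + u ^+ 2))
    ((1 + u ^+ 2)^-1 * (u + u)).
  move=> u; apply: is_derive_compf; first exact: is_derive1_ln.
  have := is_derive_addf (is_derive_cstf u 1) (is_derive_mulf (is_derive_idf u) (is_derive_idf u)).
  by move=> H; apply: (is_derive_eq1 H); ring.
have [c _ ->] := mean_value D sr.
rewrite normrM; apply: ler_piMl => //.
rewrite normrM normfV (gtr0_norm (p0 c)) mulrC ler_pdivrMr// mul1r.
apply/ler_normlP; split.
  by rewrite -subr_ge0 (_ : _ - _ = (1 + c) ^+ 2) ?sqr_ge0//; ring.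
by rewrite -subr_ge0 (_ : _ - _ = (1 - c) ^+ 2) ?sqr_ge0//; ring.
Qed.

Section along_solutions.
Context {R : realType} (T : R) (m : R -> R) (f g : R -> R * R -> R).
Hypothesis T0 : 0 < T.
Hypothesis im : (@lebesgue_measure R).-integrable [set: R] (EFin \o m).
Hypotheses (df : dominated_field m f) (dg : dominated_field m g).
Hypothesis m0 : forall t, ~~ (0 < t <= T) -> m t = 0.
Variable z : R -> R * R.
Hypothesis zsol : integral_solution f g z.

Lemma solution_abscont a b :
  abscont a b (fun t => (z t).1) /\ abscont a b (fun t => (z t).2).
Proof.
have [cz zE] := zsol; have aM := abscont_primitive a b im.
have aC := abscont_cst a b (0 : R).
split; apply: (@abscont_dominated _ _ _ 1 _ (primitive m) (cst 0) (cst 0)) => //;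
  move=> u v _ uv _; rewrite subrr normr0 !addr0 mul1r;
  have [h1 h2] := integral_curve_modulus im df dg (z 0) cz uv; rewrite (zE v) (zE u).
  by rewrite (le_trans h1)// ler_norm.
by rewrite (le_trans h2)// ler_norm.
Qed.

Lemma solution_ae_derivable : {ae @lebesgue_measure R, forall t : R,
  is_derive t 1 (fun s => (z s).1) (f t (z t)) /\
  is_derive t 1 (fun s => (z s).2) (g t (z t))}.
Proof.
have [cz zE] := zsol.
have key h (c : R) (w : R -> R) : dominated_field m h ->
    (forall t, w t = c + primitive0 (fun s => h s (z s)) t) ->
    {ae @lebesgue_measure R, forall t : R, is_derive t 1 w (h t (z t))}.
  move=> dh wE.
  have ih := superposition_integrable dh cz im.
  apply: ae_imply (primitive_ae_derivable ih) => t [/derivable_is_derive1 D DE].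
  rewrite DE in D; have -> : w = (fun t => c + (primitive (fun s => h s (z s)) t -
      primitive (fun s => h s (z s)) 0)) by apply/funext => u; rewrite wE.
  apply: (is_derive_eq1 (is_derive_addf (is_derive_cstf t c)
    (is_derive_subf D (is_derive_cstf t _)))).
  by rewrite subr0 add0r.
apply: ae_conj; [apply: (key f (z 0).1)|apply: (key g (z 0).2)] => // t;
  by rewrite {1}zE.
Qed.

(** Gronwall's inequality, in both directions of time: along a solution the
    derivative of [ln (1 + |z|^2)] is at most [8 * k] in absolute value. *)
Lemma solution_growth (k : R -> R) :
  (@lebesgue_measure R).-integrable [set: R] (EFin \o k) ->
  (forall s, `|f s (z s)| <= k s * (1 + enorm (z s)) /\
             `|g s (z s)| <= k s * (1 + enorm (z s))) ->
  forall t, 0 <= t <= T ->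
  `|ln (1 + enorm (z t) ^+ 2) - ln (1 + enorm (z 0) ^+ 2)| <=
    8 * (primitive k T - primitive k 0).
Proof.
move=> ik fgk t /andP[t0 tT].
have k0 s : 0 <= k s.
  have [h _] := fgk s; have r1 : 0 < 1 + enorm (z s) by rewrite ltr_pwDl// enorm_ge0.
  by rewrite -(pmulr_lge0 _ r1) (le_trans _ h).
have kmon u v : u <= v -> primitive k u <= primitive k v.
  move=> uv; rewrite -subr_ge0.
  have kk s : `|k s| <= k s by rewrite ger0_norm.
  exact: le_trans (le_primitive_sub ik ik kk uv).
pose G s := ln (1 + enorm (z s) ^+ 2).
have [ac1 ac2] := solution_abscont 0 t.
have aK := abscont_primitive 0 t ik.
have Gd u v : `|G v - G u| <= `|(z v).1 - (z u).1| + `|(z v).2 - (z u).2|.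
  by rewrite (le_trans (ln_sqr_lipschitz _ _))// enorm_dist.
have aG (s : R) : `|s| <= 1 -> abscont 0 t (fun u => s * G u + 8 * primitive k u).
  move=> s1; apply: (@abscont_dominated _ _ _ 8 _ _ _ _ _ ac1 ac2 aK) => // u v _ _ _.
  rewrite (_ : _ - _ = s * (G v - G u) + 8 * (primitive k v - primitive k u)); last by ring.
  rewrite (le_trans (ler_normD _ _))// !normrM (ger0_norm (_ : 0 <= 8))//.
  rewrite [leRHS]mulrDr lerD2r.
  apply: (@le_trans _ _ `|G v - G u|); first by rewrite ler_piMl.
  by rewrite (le_trans (Gd _ _))// ler_peMl ?addr_ge0// ler1n.
have DG : {ae @lebesgue_measure R, forall s : R, exists2 dG, is_derive s 1 G dG &
    `|dG| <= 8 * k s /\ is_derive s 1 (primitive k) (k s)}.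
  apply: ae_imply (ae_conj solution_ae_derivable (primitive_ae_derivable ik)).
  move=> s [[D1 D2] [dK kE]].
  have DK : is_derive s 1 (primitive k) (k s) by rewrite -kE; exact: derivable_is_derive1.
  set r := enorm (z s); have r0 : 0 <= r by exact: enorm_ge0.
  have rE : r ^+ 2 = (z s).1 ^+ 2 + (z s).2 ^+ 2 by exact: enorm_sqr.
  have p0 : 0 < 1 + r ^+ 2 by rewrite ltr_wpDr// sqr_ge0.
  pose n := f s (z s) * (z s).1 + (z s).1 * f s (z s) +
    (g s (z s) * (z s).2 + (z s).2 * g s (z s)).
  have Dq : is_derive s 1 (fun s => 1 + enorm (z s) ^+ 2) n.
    rewrite (_ : (fun s => _) = (fun s => 1 + ((z s).1 * (z s).1 + (z s).2 * (z s).2))).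
      apply: (is_derive_eq1 (is_derive_addf (is_derive_cstf s 1)
        (is_derive_addf (is_derive_mulf D1 D1) (is_derive_mulf D2 D2)))).
      by rewrite add0r.
    by apply/funext => u; rewrite enorm_sqr !expr2.
  exists ((1 + r ^+ 2)^-1 * n); first
    exact: (@is_derive_compf _ (@ln R) (fun u => 1 + enorm (z u) ^+ 2) s _ _
      (is_derive1_ln p0) Dq).
  split => //; rewrite normrM normfV (gtr0_norm p0) mulrC ler_pdivrMr//.
  have [f1 g1] := fgk s; rewrite -/r in f1 g1.
  have [z1 z2] := normr_le_enorm (z s); rewrite -/r in z1 z2.
  (* the constant 8 comes from [r (1 + r) <= 2 (1 + r^2)] *)
  apply: (@le_trans _ _ (4 * (k s * (1 + r) * r))).
    rewrite /n (_ : _ + _ = 2 * (f s (z s) * (z s).1 + g s (z s) * (z s).2)); last by ring.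
    rewrite normrM ger0_norm// (_ : 4 = 2 * 2 :> R); last by ring.
    rewrite -[leRHS]mulrA ler_pM2l// (le_trans (ler_normD _ _))// mulr2n mulrDl !mul1r.
    by rewrite lerD// normrM ler_pM.
  rewrite -subr_ge0 (_ : _ - _ = 4 * (k s * (1 + (1 - r) ^+ 2 + r))); last by ring.
  by rewrite !mulr_ge0// addr_ge0// addr_ge0// sqr_ge0.
have side (s : R) : `|s| <= 1 -> s * G 0 + 8 * primitive k 0 <= s * G t + 8 * primitive k t.
  move=> s1; apply: (abscont_nondecreasing t0 (aG _ s1)).
  apply: ae_imply DG => u [dG D [dGk DK]] _.
  have Ds := is_derive_addf (is_derive_mulf (is_derive_cstf u s) D)
    (is_derive_mulf (is_derive_cstf u 8) DK).
  have [dd ->] := is_derive_derive1 Ds; split => //.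
  rewrite !mul0r !add0r -lerBlDl sub0r.
  have := ler_norm (- (s * dG)); rewrite normrN normrM => h.
  have : `|s| * `|dG| <= 1 * (8 * k u) by apply: ler_pM.
  by rewrite mul1r; lra.
have := side 1; rewrite normr1 => /(_ (lexx 1)) h1.
have := side (-1); rewrite normrN normr1 => /(_ (lexx 1)) h2.
have Kt := kmon _ _ tT.
by apply/ler_normlP; rewrite -/(G t) -/(G 0); split; lra.
Qed.

(** The angle is obtained by integrating its differential equation along the
    solution. The maximum in the denominator leaves the integrand unchanged on
    [0, T] and makes it integrable on the whole line. *)
Lemma solution_angle (rho th0 : R) : 0 < rho ->
  (forall t, 0 <= t <= T -> rho <= enorm (z t)) ->
  z 0 = (enorm (z 0) * cos th0, enorm (z 0) * sin th0) ->
  exists th : R -> R, [/\ th 0 = th0, abscont 0 T th,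
    {ae @lebesgue_measure R, forall t : R, t \in `[0, T] -> is_derive t 1 th
      (((z t).1 * g t (z t) - (z t).2 * f t (z t)) / enorm (z t) ^+ 2)} &
    forall t, 0 <= t <= T ->
      z t = (enorm (z t) * cos (th t), enorm (z t) * sin (th t))].
Proof.
move=> rho0 rz z0E; have [cz zE] := zsol.
have cz1 : continuous (fun t => (z t).1).
  by move=> t; apply: (@continuous_comp _ _ _ z fst (t : R)); [exact: cz | exact: cvg_fst].
have cz2 : continuous (fun t => (z t).2).
  by move=> t; apply: (@continuous_comp _ _ _ z snd (t : R)); [exact: cz | exact: cvg_snd].
pose N t := Num.max (rho ^+ 2) (enorm (z t) ^+ 2).
have rho2 : 0 < rho ^+ 2 by rewrite exprn_gt0.
have N0 t : 0 < N t by rewrite lt_max rho2.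
have cN : continuous N.
  move=> t; apply: (@continuous_max _ _ (cst (rho ^+ 2)) (fun t => enorm (z t) ^+ 2)).
    exact: cvg_cst.
  rewrite (_ : (fun t => _) = (fun t => (z t).1 * (z t).1 + (z t).2 * (z t).2)).
    by apply: cvgD; apply: cvgM; solve [exact: cz1 | exact: cz2].
  by apply/funext => u; rewrite enorm_sqr !expr2.
have mq (h : R -> R) : continuous h -> measurable_fun [set: R] (fun t => h t / N t).
  move=> ch; apply: continuous_measurable_fun => t.
  by apply: cvgM; [exact: ch | apply: cvgV; [rewrite gt_eqF | exact: cN]].
pose h t := ((z t).1 / N t) * g t (z t) - ((z t).2 / N t) * f t (z t).
have bq (t a : R) : `|a| <= enorm (z t) -> `|a / N t| <= rho^-1.
  move=> ar; rewrite normrM normfV (gtr0_norm (N0 t)) ler_pdivrMr// mulrC ler_pdivlMr//.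
  have [zr|rz'] := leP (enorm (z t)) rho.
    apply: (@le_trans _ _ (rho ^+ 2)); last by rewrite le_max lexx.
    by rewrite expr2 ler_pM2r// (le_trans ar).
  apply: (@le_trans _ _ (enorm (z t) ^+ 2)); last by rewrite le_max lexx orbT.
  by rewrite expr2 ler_pM// ltW.
have mh : measurable_fun [set: R] h.
  apply: measurable_funB; apply: measurable_funM.
  - exact: mq.
  - exact: superposition_measurable dg cz.
  - exact: mq.
  - exact: superposition_measurable df cz.
have ih : (@lebesgue_measure R).-integrable [set: R] (EFin \o h).
  apply: (le_integrable _ _ _ (integrableZl _ (2 / rho) im)) => //.
    exact/measurable_EFinP.
  move=> t _ /=; rewrite lee_fin; apply: le_trans (ler_norm _).
  have [_ _ fm] := df; have [_ _ gm] := dg; have [z1 z2] := normr_le_enorm (z t).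
  have H a b : `|a| <= enorm (z t) -> `|b| <= m t -> `|a / N t * b| <= rho^-1 * m t.
    by move=> ha hb; rewrite normrM ler_pM// bq.
  rewrite (le_trans (ler_normB _ _))// (_ : 2 / rho * m t = rho^-1 * m t + rho^-1 * m t); last by ring.
  by rewrite lerD// H.
pose th t := th0 + primitive0 h t.
have ath : abscont 0 T th.
  have aC := abscont_cst 0 T (0 : R); have aP := abscont_primitive 0 T ih.
  apply: (@abscont_dominated _ _ _ 1 _ _ _ _ _ aP aC aC) => // u v _ _ _.
  rewrite subrr normr0 !addr0 mul1r /th /primitive0.
  by rewrite (_ : _ - _ = primitive h v - primitive h u)//; ring.
have D : {ae @lebesgue_measure R, forall t : R, t \in `[0, T] ->
    [/\ is_derive t 1 (fun s => (z s).1) (f t (z t)),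
        is_derive t 1 (fun s => (z s).2) (g t (z t)) &
        is_derive t 1 th (((z t).1 * g t (z t) - (z t).2 * f t (z t)) / enorm (z t) ^+ 2)]}.
  apply: ae_imply (ae_conj solution_ae_derivable (primitive_ae_derivable ih)).
  move=> t [[D1 D2] [/derivable_is_derive1 D3 hE]] tT; split => //.
  rewrite hE in D3.
  apply: (is_derive_eq1 (is_derive_addf (is_derive_cstf t th0)
    (is_derive_subf D3 (is_derive_cstf t (primitive h 0))))).
  have NE : N t = enorm (z t) ^+ 2.
    apply: max_r; rewrite ler_pXn2r// ?nnegrE ?enorm_ge0// ?(ltW rho0)//.
    by apply: rz; move: tT; rewrite in_itv.
  by rewrite add0r subr0 /h NE; ring.
exists th; split => //.
- by rewrite /th /primitive0 subrr addr0.
- by apply: ae_imply D => t Dt /Dt[].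
have [ac1 ac2] := solution_abscont 0 T.
have zp s : z s = ((z s).1, (z s).2) by exact: surjective_pairing.
have P1 t : 0 <= t <= T -> rho <= enorm ((z t).1, (z t).2) by rewrite -zp; exact: rz.
have P2 : {ae @lebesgue_measure R, forall t : R, t \in `[0, T] -> exists dx dy,
    [/\ is_derive t 1 (fun s => (z s).1) dx, is_derive t 1 (fun s => (z s).2) dy &
        is_derive t 1 th
          (((z t).1 * dy - (z t).2 * dx) / enorm ((z t).1, (z t).2) ^+ 2)]}.
  by apply: ae_imply D => s Ds /Ds[D1 D2 D3]; exists (f s (z s)), (g s (z s)); rewrite -zp.
have P3 : ((z 0).1, (z 0).2) = (enorm ((z 0).1, (z 0).2) * cos (th 0),
    enorm ((z 0).1, (z 0).2) * sin (th 0)).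
  by rewrite -!zp {1}z0E /th /primitive0 subrr addr0.
by move=> t tT; have := polar_lift rho0 ac1 ac2 ath P1 P2 P3 tT; rewrite -!zp.
Qed.

(** The derivative of [s * W (th t) - k * t] is [- s * w / (2 * V (z t)) - k],
    where [w] is the inner product of [z] with its rotated velocity. *)
Lemma clock_bound (V : R * R -> R) (W : R -> R) (th : R -> R) (rho s k : R) :
  C1 V -> pos_homogeneous2 V -> is_clock V W -> 0 < rho -> abscont 0 T th ->
  (forall t, 0 <= t <= T -> rho <= enorm (z t)) ->
  (forall t, 0 <= t <= T ->
    z t = (enorm (z t) * cos (th t), enorm (z t) * sin (th t))) ->
  {ae @lebesgue_measure R, forall t : R, t \in `[0, T] -> is_derive t 1 th
    (((z t).1 * g t (z t) - (z t).2 * f t (z t)) / enorm (z t) ^+ 2)} ->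
  {ae @lebesgue_measure R, forall t : R, t \in `[0, T] ->
    k * (2 * V (z t)) <= - s * ((z t).2 * f t (z t) - (z t).1 * g t (z t))} ->
  k * T <= s * (W (th T) - W (th 0)).
Proof.
move=> C1V hV DW rho0 ath rz zth Dth wk.
have [c c0 [C _ WC]] := clock_increment C1V hV DW.
have W_lip u v : `|W v - W u| <= c * `|v - u|.
  wlog uv : u v / u <= v.
    by move=> H; have [/H//|/ltW/H] := leP u v; rewrite distrC (distrC u).
  have /andP[_ h] := WC _ _ uv.
  by rewrite !ger0_norm ?subr_ge0 ?(clock_le C1V hV DW).
pose G t := s * W (th t) - k * t.
have aG : abscont 0 T G.
  have aC := abscont_cst 0 T (0 : R).
  apply: (@abscont_dominated _ _ _ (`|s| * c + `|k|) _ _ _ _ _ ath (abscont_id 0 T) aC).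
    by rewrite addr_ge0// mulr_ge0// ltW.
  move=> u v _ _ _; rewrite subrr normr0 addr0 /G.
  rewrite (_ : _ - _ = s * (W (th v) - W (th u)) - k * (v - u)); last by ring.
  rewrite (le_trans (ler_normB _ _))// !normrM mulrDl.
  rewrite lerD//.
    by rewrite -mulrA ler_wpM2l// (le_trans (W_lip _ _))// ler_wpM2l ?(ltW c0)// lerDl.
  by rewrite ler_wpM2l// lerDr.
suff : G 0 <= G T by rewrite /G mulr0 subr0 mulrBr; lra.
apply: (abscont_nondecreasing (ltW T0) aG).
apply: ae_imply (ae_conj Dth wk) => t [D w] tT.
have tT' : 0 <= t <= T by move: tT; rewrite in_itv.
have D' := is_derive_subf (is_derive_mulf (is_derive_cstf t s)
  (is_derive_compf (DW (th t)) (D tT)))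
  (is_derive_mulf (is_derive_cstf t k) (is_derive_idf t)).
have [dd ->] := is_derive_derive1 D'; split => //.
have r0 : 0 < enorm (z t) by exact: lt_le_trans (rz _ tT').
have e0 := homogeneous_gt0 hV (circle_neq0 (th t)).
have VE : V (z t) = enorm (z t) ^+ 2 * V (cos (th t), sin (th t)).
  by rewrite {1}(zth _ tT'); exact: homogeneous_polar.
have := w tT; rewrite VE => h.
have p0 : 0 < enorm (z t) ^+ 2 * (2 * V (cos (th t), sin (th t))).
  by rewrite mulr_gt0 ?exprn_gt0// mulr_gt0.
rewrite !mul0r !add0r mulr1 subr_ge0 -(ler_pM2r p0).
rewrite mulrCA (mulrC k) -mulrA (mulrCA (enorm _ ^+ 2)) in h.
rewrite (_ : s * _ * _ = - s * ((z t).2 * f t (z t) - (z t).1 * g t (z t))); last first.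
  field.
  by rewrite !gt_eqF// .
apply: le_trans h; rewrite le_eqVlt; apply/orP; left; apply/eqP; ring.
Qed.

(** Clockwise motion decreases the angle; the clock of [V1] bounds the rotation
    from below and the clock of [V2] bounds it from above. *)
Lemma solution_rotation (V1 V2 : R * R -> R) (W1 W2 : R -> R) (rho eta th0 : R) :
  C1 V1 -> pos_homogeneous2 V1 -> is_clock V1 W1 ->
  C1 V2 -> pos_homogeneous2 V2 -> is_clock V2 W2 -> 0 < rho ->
  (forall t, 0 <= t <= T -> rho <= enorm (z t)) ->
  z 0 = (enorm (z 0) * cos th0, enorm (z 0) * sin th0) ->
  {ae @lebesgue_measure R, forall t : R, t \in `[0, T] ->
    (1 - eta) * (2 * V1 (z t)) <= (z t).2 * f t (z t) - (z t).1 * g t (z t)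
      <= (1 + eta) * (2 * V2 (z t))} ->
  exists th : R,
    [/\ z T = (enorm (z T) * cos th, enorm (z T) * sin th),
        (1 - eta) * T <= W1 th0 - W1 th & W2 th0 - W2 th <= (1 + eta) * T].
Proof.
move=> C1V1 hV1 DW1 C1V2 hV2 DW2 rho0 rz z0E w.
have [th [th0E ath Dth zth]] := solution_angle rho0 rz z0E.
exists (th T); rewrite -th0E; split.
- by apply: zth; rewrite lexx ltW.
- have := @clock_bound V1 W1 th rho (-1) (1 - eta) C1V1 hV1 DW1 rho0 ath rz zth Dth.
  rewrite mulN1r opprB; apply.
  by apply: ae_imply w => t h /h/andP[h1 _]; rewrite opprK mul1r.
have := @clock_bound V2 W2 th rho 1 (- (1 + eta)) C1V2 hV2 DW2 rho0 ath rz zth Dth.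
rewrite mul1r mulNr lerNl opprB; apply.
by apply: ae_imply w => t h /h/andP[_ h2]; rewrite mulNr mulN1r lerN2.
Qed.

End along_solutions.

(** * Truncation *)

Lemma enorm_le (R : realType) (z w : R * R) :
  `|z.1| <= `|w.1| -> `|z.2| <= `|w.2| -> enorm z <= enorm w.
Proof.
move=> h1 h2; rewrite ler_wsqrtr// lerD//.
  by rewrite -(real_normK (num_real z.1)) -(real_normK (num_real w.1)) ler_pXn2r ?nnegrE.
by rewrite -(real_normK (num_real z.2)) -(real_normK (num_real w.2)) ler_pXn2r ?nnegrE.
Qed.

Definition clamp (R : realType) (rho x : R) : R := Num.max (- rho) (Num.min rho x).

Definition clamp2 (R : realType) (rho : R) (z : R * R) : R * R :=
  (clamp rho z.1, clamp rho z.2).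

Section clamp.
Context {R : realType} (rho : R).
Hypothesis rho0 : 0 <= rho.

Lemma clamp_continuous : continuous (clamp rho).
Proof.
move=> x; apply: (@continuous_max _ _ (cst (- rho)) (fun x => Num.min rho x)).
  exact: cvg_cst.
by apply: (@continuous_min _ _ (cst rho) id); [exact: cvg_cst | exact: cvg_id].
Qed.

Lemma clamp2_continuous : continuous (clamp2 rho).
Proof.
move=> z; have cc x := @clamp_continuous x.
have c1 : clamp rho (w.1) @[w --> z] --> clamp rho z.1.
  by apply: (@continuous_comp _ _ _ fst (clamp rho) z); [exact: cvg_fst | exact: cc].
have c2 : clamp rho (w.2) @[w --> z] --> clamp rho z.2.
  by apply: (@continuous_comp _ _ _ snd (clamp rho) z); [exact: cvg_snd | exact: cc].
exact: (cvg_pair c1 c2).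
Qed.

Lemma clampE x : `|x| <= rho -> clamp rho x = x.
Proof.
by move=> /ler_normlP[h1 h2]; rewrite /clamp min_r// max_r// lerNl.
Qed.

Lemma clamp_le x : `|clamp rho x| <= rho /\ `|clamp rho x| <= `|x|.
Proof.
have [h|h] := leP `|x| rho; first by rewrite clampE.
suff -> : `|clamp rho x| = rho by split => //; exact: ltW.
rewrite /clamp; have [x0|/ltW x0] := leP 0 x.
  rewrite min_l ?max_r ?ger0_norm//; last by rewrite -(ger0_norm x0) ltW.
  by rewrite (@le_trans _ _ 0)// oppr_le0.
have h' : rho < - x by rewrite -(ler0_norm x0).
have -> : Num.min rho x = x by rewrite min_r// (le_trans x0).
by rewrite max_l ?normrN ?ger0_norm// lerNr ltW.
Qed.

Lemma clamp2E z : enorm z <= rho -> clamp2 rho z = z.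
Proof.
move=> h; have [h1 h2] := normr_le_enorm z.
by rewrite /clamp2 !clampE ?(le_trans h1)// ?(le_trans h2)// -surjective_pairing.
Qed.

Lemma enorm_clamp2 z : enorm (clamp2 rho z) <= enorm z /\
  enorm (clamp2 rho z) <= 2 * rho.
Proof.
have [a1 a2] := clamp_le z.1; have [b1 b2] := clamp_le z.2.
split; first exact: enorm_le.
by rewrite (le_trans (enorm_le_normrD _))// (_ : 2 * rho = rho + rho) ?lerD//; ring.
Qed.

End clamp.

(** Composing with the projection onto a square bounds a field of linear growth by
    an integrable function of time and leaves it unchanged on the disc of radius
    [rho]. *)
Definition truncated (R : realType) (E : set R) (rho : R) (f : R -> R * R -> R)
    (t : R) (z : R * R) : R := if t \in E then f t (clamp2 rho z) else 0.

Section truncated.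
Context {R : realType} (E : set R) (rho : R) (k : R -> R) (f : R -> R * R -> R).
Hypothesis rho0 : 0 <= rho.
Hypothesis k0 : forall t, 0 <= k t.
Hypothesis fk : forall t z, E t -> `|f t z| <= k t * (1 + enorm z).

Lemma truncatedE t z : E t -> enorm z <= rho -> truncated E rho f t z = f t z.
Proof. by move=> Et zr; rewrite /truncated mem_set// clamp2E. Qed.

Lemma truncated_growth t z : `|truncated E rho f t z| <= k t * (1 + enorm z).
Proof.
rewrite /truncated; case: ifPn => [/set_mem Et|_].
  by rewrite (le_trans (fk _ Et))// ler_wpM2l// lerD2l; have [] := enorm_clamp2 rho0 z.
by rewrite normr0 mulr_ge0// addr_ge0// enorm_ge0.
Qed.

Lemma truncated_dominated : measurable E ->
  (forall t, E t -> continuous (f t)) ->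
  (forall z, measurable_fun E (f ^~ z)) ->
  dominated_field (fun t => (1 + 2 * rho) * k t) (truncated E rho f).
Proof.
move=> mE cf mf; split.
- move=> z.
  have /(measurable_restrictT _ mE) := mf (clamp2 rho z).
  by congr measurable_fun; apply/funext => t; rewrite patchE /truncated.
- move=> t; rewrite /truncated; case: (boolP (t \in E)) => [/set_mem Et|_] z.
    apply: (@continuous_comp _ _ _ (clamp2 rho) (f t)); last exact: cf.
    exact: clamp2_continuous.
  exact: cvg_cst.
move=> t z; rewrite /truncated; case: ifPn => [/set_mem Et|_].
  rewrite (le_trans (fk _ Et))// mulrC ler_wpM2r// lerD2l.
  by have [] := enorm_clamp2 rho0 z.
by rewrite normr0 mulr_ge0// addr_ge0// mulr_ge0.
Qed.

End truncated.

(** * The boundary value problem in angular coordinates *)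

Lemma sin_near_multiple_gt0 (R : realType) (x : R) n :
  - (n%:R * pi) < x < - (n%:R * pi) + pi -> 0 < (-1) ^+ n * sin x.
Proof.
elim: n x => [|n IH] x.
  by rewrite mul0r oppr0 add0r expr0 mul1r => /sin_gt0_pi.
move=> /andP[h1 h2]; rewrite exprS mulN1r mulNr -mulrN -sinDpi.
apply: IH; move: h1 h2; rewrite -natr1; move: (@pi R) => q.
by rewrite mulrDl mul1r; move: (n%:R * q) => r; lra.
Qed.

Section angular_shooting.
Context {R : realType} (T : R) (E : set R) (k : R -> R) (f g : R -> R * R -> R).
Hypothesis T0 : 0 < T.
Hypothesis mE : measurable E.
Hypothesis aeE : {ae @lebesgue_measure R, forall t : R, t \in `[0, T] -> E t}.
Hypothesis ik : (@lebesgue_measure R).-integrable [set: R] (EFin \o k).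
Hypothesis k0 : forall t, 0 <= k t.
Hypothesis kT : forall t, ~~ (0 < t <= T) -> k t = 0.
Hypothesis cf : forall t, E t -> continuous (f t).
Hypothesis cg : forall t, E t -> continuous (g t).
Hypothesis mf : forall z, measurable_fun E (f ^~ z).
Hypothesis mg : forall z, measurable_fun E (g ^~ z).
Hypothesis fk : forall t z, E t -> `|f t z| <= k t * (1 + enorm z).
Hypothesis gk : forall t z, E t -> `|g t z| <= k t * (1 + enorm z).

Variables (V1 V2 : R * R -> R) (W1 W2 : R -> R).
Hypotheses (C1V1 : C1 V1) (hV1 : pos_homogeneous2 V1) (DW1 : is_clock V1 W1).
Hypotheses (C1V2 : C1 V2) (hV2 : pos_homogeneous2 V2) (DW2 : is_clock V2 W2).

Variables (eta M : R).
Hypothesis rotation : forall t z, E t -> M < enorm z ->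
  (1 - eta) * (2 * V1 z) <= z.2 * f t z - z.1 * g t z <= (1 + eta) * (2 * V2 z).

Let K := expR (8 * (primitive k T - primitive k 0)).

Let K0 : 0 < K. Proof. exact: expR_gt0. Qed.

(* so large that solutions starting at this distance stay beyond [`|M| + 1] *)
Let c := K * (1 + (`|M| + 1) ^+ 2).

(* so large that solutions starting within distance [c] stay within this one *)
Let rho := K * (1 + c ^+ 2).

Let c_gt0 : 0 < c.
Proof. by rewrite mulr_gt0// ltr_pwDl// sqr_ge0. Qed.

Let rho_gt0 : 0 < rho.
Proof. by rewrite mulr_gt0// ltr_pwDl// sqr_ge0. Qed.

Let fr := truncated E rho f.
Let gr := truncated E rho g.
Let m := fun t => (1 + 2 * rho) * k t.

Let dfr : dominated_field m fr.
Proof. exact: truncated_dominated (ltW rho_gt0) k0 fk mE cf mf. Qed.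

Let dgr : dominated_field m gr.
Proof. exact: truncated_dominated (ltW rho_gt0) k0 gk mE cg mg. Qed.

Let im : (@lebesgue_measure R).-integrable [set: R] (EFin \o m).
Proof.
have := integrableZl (@measurableT _ _) (1 + 2 * rho) ik.
by apply: eq_integrable => // t _ /=; rewrite EFinM.
Qed.

Let m0 t : ~~ (0 < t <= T) -> m t = 0.
Proof. by move=> /kT; rewrite /m => ->; rewrite mulr0. Qed.

Section solution.
Variable z : R -> R * R.
Hypothesis zsol : integral_solution fr gr z.

Let growth t : 0 <= t <= T ->
  1 + enorm (z t) ^+ 2 <= K * (1 + enorm (z 0) ^+ 2) /\
  1 + enorm (z 0) ^+ 2 <= K * (1 + enorm (z t) ^+ 2).
Proof.
move=> tT.
have p0 (u : R) : 0 < 1 + u ^+ 2 by rewrite ltr_wpDr// sqr_ge0.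
have := solution_growth im dfr dgr zsol ik _ tT => H.
have {H} : `|ln (1 + enorm (z t) ^+ 2) - ln (1 + enorm (z 0) ^+ 2)|
    <= 8 * (primitive k T - primitive k 0).
  apply: H => s; split; first exact: (truncated_growth (ltW rho_gt0) k0 fk).
  exact: (truncated_growth (ltW rho_gt0) k0 gk).
move=> /ler_normlP[h1 h2].
have key a b : 0 < a -> 0 < b ->
    ln a - ln b <= 8 * (primitive k T - primitive k 0) -> a <= K * b.
  move=> a0 b0 h; rewrite -[a]lnK// -[b in leRHS]lnK// /K -expRD ler_expR.
  by rewrite -lerBlDr.
by split; apply: key => //; lra.
Qed.

Lemma truncation_inactive t : enorm (z 0) <= c -> 0 <= t <= T -> enorm (z t) <= rho.
Proof.
move=> z0c tT; have [h _] := growth tT.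
have r0 := enorm_ge0 (z t).
apply: (@le_trans _ _ (1 + enorm (z t) ^+ 2)).
  by rewrite -subr_ge0 (_ : _ - _ = (enorm (z t) - 2^-1) ^+ 2 + 3 / 4) ?addr_ge0 ?sqr_ge0//; field.
apply: (le_trans h); rewrite ler_pM2l// lerD2l ler_pXn2r// nnegrE ?enorm_ge0//.
exact: ltW.
Qed.

Lemma solution_far t : enorm (z 0) = c -> 0 <= t <= T -> `|M| + 1 <= enorm (z t).
Proof.
move=> z0c tT; have [_ h] := growth tT; rewrite z0c in h.
have M0 : 0 <= `|M| + 1 by rewrite addr_ge0.
rewrite -(@ler_pXn2r _ 2)// ?nnegrE ?enorm_ge0// -(lerD2l 1) -(ler_pM2l K0).
apply: le_trans h; rewrite -/c.
by rewrite -subr_ge0 (_ : _ - _ = (c - 2^-1) ^+ 2 + 3 / 4) ?addr_ge0 ?sqr_ge0//; field.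
Qed.

(** The clocks confine the final angle to the open interval from [omA - n pi] to
    [omA - n pi + pi], which is one side of the line of angle [omA]; the parity of
    [n] tells which one. *)
Lemma solution_side (th0 omA : R) n :
  z 0 = (c * cos th0, c * sin th0) ->
  W1 th0 - W1 (omA - n%:R * pi + pi) < (1 - eta) * T ->
  (1 + eta) * T < W2 th0 - W2 (omA - n%:R * pi) ->
  0 < (-1) ^+ n * ((z T).2 * cos omA - (z T).1 * sin omA).
Proof.
move=> z0E lo hi.
have z0c : enorm (z 0) = c by rewrite z0E enorm_polar// ltW.
have M1 : 0 < `|M| + 1 by rewrite ltr_wpDl.
have far t : 0 <= t <= T -> `|M| + 1 <= enorm (z t) := @solution_far t z0c.
have z0p : z 0 = (enorm (z 0) * cos th0, enorm (z 0) * sin th0) by rewrite z0c.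
have rot : {ae @lebesgue_measure R, forall t : R, t \in `[0, T] ->
    (1 - eta) * (2 * V1 (z t)) <= (z t).2 * fr t (z t) - (z t).1 * gr t (z t)
      <= (1 + eta) * (2 * V2 (z t))}.
  apply: ae_imply aeE => t Et tT; have {}Et := Et tT.
  have tT' : 0 <= t <= T by move: tT; rewrite in_itv.
  have zr : enorm (z t) <= rho by apply: truncation_inactive => //; rewrite z0c.
  rewrite /fr /gr !truncatedE//; apply: rotation => //.
  by rewrite (lt_le_trans _ (far _ tT'))// ltr_pwDr// ler_norm.
have [th [zT h1 h2]] := solution_rotation T0 im dfr dgr zsol C1V1 hV1 DW1
  C1V2 hV2 DW2 M1 far z0p rot.
have rT : 0 < enorm (z T) by rewrite (lt_le_trans M1)// far// lexx ltW.
rewrite zT /= (_ : _ - _ = enorm (z T) * (sin th * cos omA - cos th * sin omA)); last by ring.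
rewrite -sinB mulrCA mulr_gt0//; apply: sin_near_multiple_gt0.
have a1 : omA - n%:R * pi < th.
  by rewrite -(clock_lt C1V2 hV2 DW2); lra.
have a2 : th < omA - n%:R * pi + pi.
  by rewrite -(clock_lt C1V1 hV1 DW1); lra.
by rewrite ltrBrDl a1 ltrBlDl addrA.
Qed.

End solution.

(** The side reached from the angle [omS] has index [n], the one reached from
    [omS - pi] has index [n + 1]: they are opposite to each other, so shooting
    applies. *)
Lemma angular_shooting (omS omA : R) n :
  W1 omS - W1 (omA - n%:R * pi + pi) < (1 - eta) * T ->
  (1 + eta) * T < W2 omS - W2 (omA - n%:R * pi) ->
  W1 (omS - pi) - W1 (omA - n%:R * pi) < (1 - eta) * T ->
  (1 + eta) * T < W2 (omS - pi) - W2 (omA - pi - n%:R * pi) ->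
  exists z : R -> R * R,
    [/\ abscont 0 T (fun t => (z t).1) /\ abscont 0 T (fun t => (z t).2),
        {ae @lebesgue_measure R, forall t : R, t \in `[0, T] ->
          is_derive t 1 (fun s => (z s).1) (f t (z t)) /\
          is_derive t 1 (fun s => (z s).2) (g t (z t))},
        (z 0).1 * sin omS = (z 0).2 * cos omS &
        (z T).1 * sin omA = (z T).2 * cos omA].
Proof.
move=> lo hi lo' hi'.
pose s : R := (-1) ^+ n.
have sideE (w : R * R) : - s * sin omA * w.1 + s * cos omA * w.2 =
    s * (w.2 * cos omA - w.1 * sin omA) by ring.
have [|||z [zsol zS zc zA]] := @shooting R T m fr gr T0 im dfr dgr m0
    (cos omS, sin omS) (- s * sin omA) (s * cos omA) c.
- exact: ltW.
- move=> z zsol z0; rewrite sideE; apply: (solution_side zsol z0) => //.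
- move=> z zsol z0; rewrite sideE -oppr_gt0 -mulNr.
  rewrite (_ : - s = (-1) ^+ n.+1); last by rewrite exprS mulN1r.
  have e1 : omA - n.+1%:R * pi = omA - pi - n%:R * pi.
    by rewrite -natr1; move: (@pi R) => q; ring.
  have e2 : omA - pi - n%:R * pi + pi = omA - n%:R * pi.
    by move: (@pi R) => q; ring.
  apply: (@solution_side _ zsol (omS - pi)); rewrite ?e1 ?e2//.
  rewrite z0 -[omS in LHS](subrK pi) cosDpi sinDpi.
  have scE (r x y : R) : r *: ((x, y) : R * R) = (r * x, r * y) by [].
  by rewrite scE !mulrNN.
have z0c : enorm (z 0) <= c.
  rewrite -(@enorm_polar _ c omS (ltW c_gt0)); have [z1 z2] := zc.
  by apply: enorm_le => /=; rewrite normrM (gtr0_norm c_gt0).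
exists z; split.
- exact: (solution_abscont im dfr dgr zsol).
- apply: ae_imply (ae_conj aeE (solution_ae_derivable im dfr dgr zsol)).
  move=> t [Et D] tT; have {}Et := Et tT.
  have tT' : 0 <= t <= T by move: tT; rewrite in_itv.
  by have := D; rewrite /fr /gr !truncatedE//; exact: truncation_inactive.
- exact: zS.
- have s0 : s != 0 by rewrite signr_eq0.
  move: zA; rewrite sideE => /eqP; rewrite mulf_eq0 (negbTE s0)/= subr_eq0.
  by move=> /eqP.
Qed.

End angular_shooting.

(** * Nonresonance and growth of the right-hand side *)

Lemma strict_margin (R : realType) (T a b : R) : 0 < T -> a < T -> T < b ->
  exists2 eta, 0 < eta & a < (1 - eta) * T /\ (1 + eta) * T < b.
Proof.
move=> T0 aT Tb; pose d : R := Num.min (T - a) (b - T).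
have d0 : 0 < d by rewrite lt_min !subr_gt0 aT.
have da : d <= T - a by rewrite ge_min lexx.
have db : d <= b - T by rewrite ge_min lexx orbT.
exists (d / (2 * T)); first by rewrite divr_gt0// mulr_gt0.
have E : d / (2 * T) * T = d / 2 by field; rewrite gt_eqF.
by move: E; set e : R := d / (2 * T) => E; split; lra.
Qed.

Section nonresonance.
Context {R : realType} (V1 V2 : R * R -> R) (W1 W2 : R -> R).
Hypotheses (C1V1 : C1 V1) (hV1 : pos_homogeneous2 V1) (DW1 : is_clock V1 W1).
Hypotheses (C1V2 : C1 V2) (hV2 : pos_homogeneous2 V2) (DW2 : is_clock V2 W2).
Variables (lS lA : set (R * R)) (omS omA T : R).
Hypotheses (T0 : 0 < T) (dS : is_direction lS omS) (dA : is_direction lA omA).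
Hypotheses (omS1 : omS <= pi / 2) (omS2 : pi / 2 < omS + pi).
Hypotheses (omA1 : omS - pi <= omA) (omA2 : omA < omS).
Hypothesis nonresonant : ~ resonance_set lS lA V1 V2 T.

(** The times [alpha V2 n] tend to infinity, so there is a first one beyond [T].
    Since [T] avoids the resonance intervals, it lies beyond all of the preceding
    interval. *)
Lemma nonresonant_window : exists n (a b : R), [/\ a < T, T < b,
  W1 omS - W1 (omA - n%:R * pi + pi) <= a /\
  W1 (omS - pi) - W1 (omA - n%:R * pi) <= a &
  b <= W2 omS - W2 (omA - n%:R * pi) /\
  b <= W2 (omS - pi) - W2 (omA - pi - n%:R * pi)].
Proof.
have t1 := time1E C1V2 hV2 DW2 dS dA omS1 omS2 omA1 omA2.
have t2 := time2E C1V2 hV2 DW2 dS dA omS1 omS2 omA1 omA2.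
have s1 := time1E C1V1 hV1 DW1 dS dA omS1 omS2 omA1 omA2.
have s2 := time2E C1V1 hV1 DW1 dS dA omS1 omS2 omA1 omA2.
have pi0 := @pi_gt0 R.
have ex : exists n, T < alpha lS lA V2 n.
  have [c _ [C C0 WC]] := clock_increment C1V2 hV2 DW2.
  have q0 : 0 <= T / (C * pi) by rewrite divr_ge0 ?mulr_ge0// ltW.
  have := archi_boundP q0; set n := Num.bound _; rewrite ltr_pdivrMr ?mulr_gt0// => nT.
  exists n; rewrite /alpha lt_min t1 t2.
  have np : 0 <= n%:R * pi :> R by rewrite mulr_ge0// ltW.
  have nT' : T < C * (n%:R * pi) by rewrite mulrCA.
  have key x y : n%:R * pi < x - y -> T < W2 x - W2 y.
    move=> xy; have yx : y <= x by rewrite -subr_ge0 (le_trans np)// ltW.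
    have /andP[h _] := WC _ _ yx; apply: lt_le_trans h; apply: (lt_trans nT').
    by rewrite ltr_pM2l.
  by apply/andP; split; apply: key; move: (@pi R) omA2 => r h; lra.
case: (ex_minnP ex) => n; rewrite {1}/alpha lt_min t1 t2 => /andP[b1 b2] nmin.
set B1 := W2 omS - _ in b1 *; set B2 := W2 (omS - pi) - _ in b2 *.
exists n, (Num.max (W1 omS - W1 (omA - n%:R * pi + pi))
                   (W1 (omS - pi) - W1 (omA - n%:R * pi))), (Num.min B1 B2).
split; [|by rewrite lt_min b1|by rewrite !le_max !lexx orbT|
  by rewrite !ge_min !lexx orbT].
case: n nmin {B1 B2 b1 b2} => [|j] nmin.
  rewrite mul0r subr0 gt_max.
  have W0 x y : x <= y -> W1 x - W1 y < T.
    move=> xy; have : W1 x <= W1 y by rewrite (clock_le C1V1 hV1 DW1).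
    by move=> h; rewrite ltrBlDr (le_lt_trans h)// ltrDr.
  by apply/andP; split; apply: W0; rewrite // -lerBlDr.
have e1 : omA - j.+1%:R * pi + pi = omA - j%:R * pi.
  by rewrite -natr1; move: (@pi R) => q; ring.
have e2 : omA - j.+1%:R * pi = omA - pi - j%:R * pi.
  by rewrite -natr1; move: (@pi R) => q; ring.
rewrite e1 e2 -s1 -s2 -/(beta lS lA V1 j) ltNge; apply/negP => Tb.
have [aT|Ta] := leP (alpha lS lA V2 j) T.
  by apply: nonresonant; exists j => //=; rewrite in_itv/= aT.
by have := nmin _ Ta; rewrite ltnn.
Qed.

End nonresonance.

Lemma ae_measurable_set (R : realType) (P : R -> Prop) :
  {ae @lebesgue_measure R, forall t, P t} ->
  exists G : set R, [/\ measurable G, {ae @lebesgue_measure R, forall t, G t} &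
    forall t, G t -> P t].
Proof.
move=> [N [mN N0 PN]]; exists (~` N); split; first exact: measurableC.
  by exists N; split => // t /= /contrapT.
by move=> t Nt; apply: contrapT => Pt; apply: Nt; exact: PN.
Qed.

Lemma grad_affine_bound (R : realType) (V : R * R -> R) :
  C1 V -> pos_homogeneous2 V ->
  exists2 B, 0 <= B & forall z, `|(grad V z).1| <= B * (1 + enorm z) /\
                                `|(grad V z).2| <= B * (1 + enorm z).
Proof.
move=> C1V hV; have [B B0 HB] := grad_linear_bound C1V hV.
exists (B + (`|(grad V 0).1| + `|(grad V 0).2|)); first by rewrite !addr_ge0.
move=> z; have r0 := enorm_ge0 z; set a : R := `|(grad V 0).1|; set b : R := `|(grad V 0).2|.
have a0 : 0 <= a by exact: normr_ge0.
have b0 : 0 <= b by exact: normr_ge0.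
have [->|z0] := eqVneq z 0.
  have p0 : 0 <= (B + (a + b)) * enorm (0 : R * R).
    by rewrite mulr_ge0 ?enorm_ge0// !addr_ge0.
  by rewrite -/a -/b; split; lra.
have [h1 h2] := HB _ z0.
have : B * enorm z <= (B + (a + b)) * (1 + enorm z).
  by apply: ler_pM => //; [rewrite lerDl addr_ge0 | rewrite lerDr].
by split; [apply: (le_trans h1) | apply: (le_trans h2)].
Qed.

(** Far away [p] grows at most linearly; on the remaining disc it is bounded in
    L^2(0,T), hence by the integrable function [1 + ell ^+ 2]. *)
Lemma sublinear_growth (R : realType) (T B : R) (p : R -> R * R -> R * R) :
  L2_dominated_on_compacts T (fun t z => enorm (p t z)) -> sublinear T p ->
  0 <= B ->
  exists k : R -> R,
    [/\ (@lebesgue_measure R).-integrable [set: R] (EFin \o k),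
        forall t, 0 <= k t, forall t, ~~ (0 < t <= T) -> k t = 0 &
        {ae @lebesgue_measure R, forall t : R, t \in `[0, T] -> 0 < t ->
          forall z, B * (1 + enorm z) + enorm (p t z) <= k t * (1 + enorm z)}].
Proof.
move=> pL2 plim B0; have [M pM] := plim 1 ltr01.
have cK : compact (`[- `|M|, `|M|]%classic `*` `[- `|M|, `|M|]%classic : set (R * R)).
  by apply: compact_setX; exact: segment_compact.
have [ell ellL2 pell] := pL2 _ cK.
pose q := ell \_ `[0, T]%classic.
have iq2 := Lfun2_integrable_sqr ellL2; rewrite -/q in iq2.
pose h (t : R) : R := (B + 2) + q t ^+ 2.
pose k := h \_ `]0, T]%classic.
have h0 t : 0 <= h t by rewrite !addr_ge0// sqr_ge0.
have kE t : 0 < t <= T -> k t = h t.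
  by move=> tT; rewrite /k patchE mem_set//= in_itv.
exists k; split.
- suff /integrable_mkcond : (@lebesgue_measure R).-integrable `]0, T] (EFin \o h).
    by rewrite restrict_EFin; apply.
  pose u : R -> R := cst (B + 2); pose v (t : R) : R := q t ^+ 2.
  have -> : EFin \o h = ((EFin \o u) \+ (EFin \o v))%E.
    by apply/funext => t /=; rewrite EFinD.
  apply: integrableD => //; last exact: integrableS iq2.
  have iu : (@lebesgue_measure R).-integrable `[0, T] (EFin \o u).
    apply: continuous_compact_integrable; first exact: segment_compact.
    by apply: continuous_subspaceT => t; exact: cst_continuous.
  by apply: integrableS iu => //; exact: subset_itv_oc_cc.
- by move=> t; rewrite /k patchE; case: ifPn.
- by move=> t tT; rewrite /k patchE memNset//= in_itv/=; apply/negP.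
apply: ae_imply (ae_conj pM pell) => t [pMt pellt] tT t0 z.
have tT' : 0 < t <= T by move: tT; rewrite in_itv/= t0 => /andP[].
have qE : q t = ell t by rewrite /q patchE mem_set.
rewrite kE// /h qE; have r0 := enorm_ge0 z.
suff H : enorm (p t z) <= enorm z + (1 + ell t ^+ 2).
  have : 0 <= (1 + ell t ^+ 2) * enorm z by rewrite mulr_ge0// addr_ge0// sqr_ge0.
  by move: H; nra.
have s0 := sqr_ge0 (ell t).
have [Mz|zM] := ltP `|M| (enorm z).
  have zr : 0 < enorm z by rewrite (le_lt_trans _ Mz).
  have z0 : z != 0.
    apply: contraTneq zr => ->.
    by rewrite /enorm/= expr0n/= addr0 sqrtr0 ltxx.
  have := pMt tT z z0 (le_lt_trans (ler_norm _) Mz).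
  by rewrite ltr_pdivrMr// mul1r => pz; rewrite ltW// ltr_wpDr// addr_ge0.
have [z1 z2] := normr_le_enorm z.
have : enorm (p t z) <= ell t.
  apply: (pellt tT); split; rewrite /= in_itv/= -ler_norml.
    exact: le_trans zM.
  exact: le_trans zM.
have := sqr_ge0 (ell t - 2^-1); rewrite sqrrB; move=> h1 h2.
have : (2^-1 : R) * 2 = 1 by rewrite mulVf.
by nra.
Qed.

(** * Existence for nonresonant times *)

Lemma convex_combination_bound (R : realType) (l a b c : R) :
  0 <= l <= 1 -> `|a| <= c -> `|b| <= c -> `|(1 - l) * a + l * b| <= c.
Proof.
move=> /andP[l0 l1] ac bc; rewrite (le_trans (ler_normD _ _))// !normrM.
rewrite (ger0_norm l0) ger0_norm ?subr_ge0//.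
have h1 : (1 - l) * `|a| <= (1 - l) * c by rewrite ler_wpM2l// subr_ge0.
have h2 : l * `|b| <= l * c by rewrite ler_wpM2l.
by rewrite (le_trans (lerD h1 h2))// -mulrDl subrK mul1r.
Qed.

(** By Euler's identity the unperturbed speed lies between [2 V1 z] and [2 V2 z].
    The perturbation contributes at most [2 |q| |z|], and [c |z|^2 <= V1 z] makes
    this at most a fraction [eta] of [2 V1 z]. *)
Lemma rotation_bound (R : realType) (V1 V2 : R * R -> R) (c eta l : R)
    (z q F : R * R) :
  C1 V1 -> pos_homogeneous2 V1 -> C1 V2 -> pos_homogeneous2 V2 ->
  (forall z, V1 z <= V2 z) -> 0 <= eta -> 0 <= l <= 1 -> z != 0 ->
  (forall th, c <= V1 (cos th, sin th)) ->
  enorm q <= eta * c * enorm z ->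
  F = (1 - l) *: grad V1 z + l *: grad V2 z + q ->
  (1 - eta) * (2 * V1 z) <= F.1 * z.1 + F.2 * z.2 <= (1 + eta) * (2 * V2 z).
Proof.
move=> C1V1 hV1 C1V2 hV2 V12 eta0 /andP[l0 l1] z0 cV qz FE.
have r0 := enorm_gt0 z0; have V12z := V12 z.
have cz : c * enorm z ^+ 2 <= V1 z.
  have [th _ zE] := polar_representation z0.
  by rewrite {2}zE (homogeneous_polar hV1)// mulrC ler_pM2l// exprn_gt0.
have qz2 : `|q.1 * z.1 + q.2 * z.2| <= eta * (2 * V1 z).
  have [q1 q2] := normr_le_enorm q; have [z1 z2] := normr_le_enorm z.
  apply: (@le_trans _ _ (2 * (enorm q * enorm z))).
    rewrite (le_trans (ler_normD _ _))// !normrM mulr2n mulrDl !mul1r.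
    by rewrite lerD// ler_pM.
  rewrite [leRHS]mulrCA ler_pM2l//.
  apply: (@le_trans _ _ (eta * (c * enorm z ^+ 2))).
    by rewrite expr2 !mulrA ler_pM2r// -mulrA.
  by rewrite ler_wpM2l.
have E : F.1 * z.1 + F.2 * z.2 =
    (1 - l) * (2 * V1 z) + l * (2 * V2 z) + (q.1 * z.1 + q.2 * z.2).
  rewrite -(homogeneous_euler C1V1 hV1 z0) -(homogeneous_euler C1V2 hV2 z0).
  have -> : F.1 = (1 - l) * (grad V1 z).1 + l * (grad V2 z).1 + q.1 by rewrite FE.
  have -> : F.2 = (1 - l) * (grad V1 z).2 + l * (grad V2 z).2 + q.2 by rewrite FE.
  by move: (grad V1 z) (grad V2 z) => u v; ring.
rewrite E; move: qz2 => /ler_normlP[h1 h2].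
have a1 : 0 <= l * (V2 z - V1 z) by rewrite mulr_ge0// subr_ge0.
have a2 : 0 <= (1 - l) * (V2 z - V1 z) by rewrite mulr_ge0// subr_ge0.
have a3 : 0 <= eta * (V2 z - V1 z) by rewrite mulr_ge0// subr_ge0.
by apply/andP; split; nra.
Qed.

Theorem theorem3p2 (R : realType) (T : R) (hT : 0 < T)
  (lS lA : set (R * R)) (hS : is_line lS) (hA : is_line lA)
  (V1 V2 : R * R -> R)
  (hV1 : C1 V1) (hV1h : pos_homogeneous2 V1)
  (hV2 : C1 V2) (hV2h : pos_homogeneous2 V2)
  (hV12 : forall z, V1 z <= V2 z)
  (gamma : R -> R * R -> R)
  (hgamma : L2_caratheodory T gamma)
  (hgamma01 : forall t z, t \in `[0, T] -> 0 <= gamma t z <= 1)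
  (g : R -> R * R -> R * R)
  (hg : forall t z, t \in `[0, T] ->
     g t z = (1 - gamma t z) *: grad V1 z + gamma t z *: grad V2 z)
  (p : R -> R * R -> R * R)
  (hp : caratheodory2 T p)
  (hpL2 : L2_dominated_on_compacts T (fun t z => enorm (p t z)))
  (hplim : sublinear T p)
  (hres : ~ resonance_set lS lA V1 V2 T) :
  exists z : R -> R * R,
    [/\ is_solution (fun t x => g t x + p t x) 0 T z, lS (z 0) & lA (z T)].
Proof.
have pi0 := @pi_gt0 R.
have [omS dS /andP[omS1 omS2]] := line_direction (pi / 2) hS.
(* if the lines coincide, the angle of [lA] is taken half a turn before [omS] *)
have [omA dA [omA1 omA2]] : exists2 om, is_direction lA om &
    omS - pi <= om /\ om < omS.
  have [om dom /andP[h1 h2]] := line_direction omS hA.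
  have [eom|neom] := eqVneq om omS.
    exists (om - pi); first exact: is_direction_subpi.
    by rewrite eom; split => //; rewrite ltrBlDr ltrDl.
  by exists om => //; split; [rewrite lerBlDr ltW | rewrite lt_neqAle neom].
have [W1 DW1] := clock_exists hV1 hV1h.
have [W2 DW2] := clock_exists hV2 hV2h.
have [n [a [b [aT Tb [a1 a2] [b1 b2]]]]] := nonresonant_window hV1 hV1h DW1
  hV2 hV2h DW2 hT dS dA omS1 omS2 omA1 omA2 hres.
have [eta eta0 [aeta beta]] := strict_margin hT aT Tb.
have [c c0 [C _ cV']] := homogeneous_circle_bounds hV1 hV1h.
have cV th : c <= V1 (cos th, sin th) by have /andP[] := cV' th.
have [M pM] := hplim (eta * c) (mulr_gt0 eta0 c0).
have [B1 B10 gB1] := grad_affine_bound hV1 hV1h.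
have [B2 B20 gB2] := grad_affine_bound hV2 hV2h.
have B0 : 0 <= B1 + B2 by rewrite addr_ge0.
have [k [ik k0 kT pk]] := sublinear_growth hpL2 hplim B0.
have [hp1 hp2] := hp.
have [E1 [mE1 sE1 aE1 cgam mgam]] := caratheodory_borel hgamma.1.
have [E2 [mE2 _ aE2 cp1 mp1]] := caratheodory_borel hp1.
have [E3 [mE3 _ aE3 cp2 mp2]] := caratheodory_borel hp2.
have [E4 [mE4 aE4 E4P]] := ae_measurable_set (ae_conj pM pk).
(* the times at which everything assumed almost everywhere holds *)
pose E := E1 `&` E2 `&` (E3 `&` E4).
have mE : measurable E by do 2 ?apply: measurableI.
have aE : {ae @lebesgue_measure R, forall t : R, t \in `[0, T] -> E t}.
  apply: ae_imply (ae_conj (ae_conj aE1 aE2) (ae_conj aE3 aE4)).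
  by move=> t [[e1 e2] [e3 e4]] tT; split; split; auto.
have EI t : E t -> t \in `[0, T] /\ 0 < t.
  by move=> [[/sE1 + _] _]; rewrite /= !in_itv/= => /andP[t0 ->]; rewrite (ltW t0).
pose F t z := (1 - gamma t z) *: grad V1 z + gamma t z *: grad V2 z + p t z.
have gE t z : t \in `[0, T] -> g t z + p t z = F t z by move=> tT; rewrite hg.
have cg1 (V : R * R -> R) : C1 V -> continuous (fun z => (grad V z).1).
  by move=> [_ cV1] z; apply: (@continuous_comp _ _ _ (grad V) fst); [exact: cV1 | exact: cvg_fst].
have cg2 (V : R * R -> R) : C1 V -> continuous (fun z => (grad V z).2).
  by move=> [_ cV1] z; apply: (@continuous_comp _ _ _ (grad V) snd); [exact: cV1 | exact: cvg_snd].
have cF1 t : E t -> continuous (fun z => (F t z).1).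
  move=> [[e1 e2] _] z; have G := cgam _ e1 z; have P := cp1 _ e2 z.
  apply: cvgD; last exact: P.
  apply: cvgD; apply: cvgM; [|exact: cg1|exact: G|exact: cg1].
  by apply: cvgB; [exact: cvg_cst | exact: G].
have cF2 t : E t -> continuous (fun z => (F t z).2).
  move=> [[e1 _] [e3 _]] z; have G := cgam _ e1 z; have P := cp2 _ e3 z.
  apply: cvgD; last exact: P.
  apply: cvgD; apply: cvgM; [|exact: cg2|exact: G|exact: cg2].
  by apply: cvgB; [exact: cvg_cst | exact: G].
have mG z : measurable_fun E (gamma ^~ z).
  by apply: measurable_funS (mgam z) => // t [[]].
have mF1 z : measurable_fun E (fun t => (F t z).1).
  apply: measurable_funD; last by apply: measurable_funS (mp1 z) => // t [[]].
  apply: measurable_funD; apply: measurable_funM => //.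
  by apply: measurable_funB.
have mF2 z : measurable_fun E (fun t => (F t z).2).
  apply: measurable_funD; last by apply: measurable_funS (mp2 z) => // t [_ []].
  apply: measurable_funD; apply: measurable_funM => //.
  by apply: measurable_funB.
have Fk t z : E t -> `|(F t z).1| <= k t * (1 + enorm z) /\
    `|(F t z).2| <= k t * (1 + enorm z).
  move=> Et; have [tT t0] := EI _ Et; have [_ [_ e4]] := Et.
  have [_ /(_ tT t0 z) h] := E4P _ e4; have [p1 p2] := normr_le_enorm (p t z).
  have [x1 x2] := gB1 z; have [y1 y2] := gB2 z; have l01 := hgamma01 _ z tT.
  have r1 : 0 <= 1 + enorm z by rewrite addr_ge0// enorm_ge0.
  have le1 x : x <= B1 * (1 + enorm z) -> x <= (B1 + B2) * (1 + enorm z).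
    by move=> hx; rewrite (le_trans hx)// ler_wpM2r// lerDl.
  have le2 x : x <= B2 * (1 + enorm z) -> x <= (B1 + B2) * (1 + enorm z).
    by move=> hx; rewrite (le_trans hx)// ler_wpM2r// lerDr.
  split; apply: (le_trans _ h); rewrite (le_trans (ler_normD _ _))// lerD//.
    exact: convex_combination_bound l01 (le1 _ x1) (le2 _ y1).
  exact: convex_combination_bound l01 (le1 _ x2) (le2 _ y2).
have rot t z : E t -> `|M| < enorm z ->
    (1 - eta) * (2 * V1 z) <= z.2 * (F t z).2 - z.1 * - (F t z).1
      <= (1 + eta) * (2 * V2 z).
  move=> Et Mz; have [tT _] := EI _ Et; have [_ [_ e4]] := Et.
  have zr : 0 < enorm z by rewrite (le_lt_trans _ Mz).
  have z0 : z != 0.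
    by apply: contraTneq zr => ->; rewrite /enorm/= expr0n/= addr0 sqrtr0 ltxx.
  have [/(_ tT z z0 (le_lt_trans (ler_norm _) Mz)) + _] := E4P _ e4.
  rewrite ltr_pdivrMr// => /ltW pz.
  have := rotation_bound hV1 hV1h hV2 hV2h hV12 (ltW eta0) (hgamma01 _ z tT) z0 cV pz erefl.
  by rewrite -/(F t z) mulrN opprK (mulrC z.2) (mulrC z.1) [in X in _ <= X <= _]addrC.
have [z [az Dz zS zA]] := @angular_shooting R T E k (fun t z => (F t z).2)
  (fun t z => - (F t z).1) hT mE aE ik k0 kT cF2
  (fun t Et z => cvgN (cF1 t Et z)) mF2 (fun z => measurableT_comp (@oppr_measurable R setT) (mF1 z))
  (fun t z Et => (Fk t z Et).2)
  (fun t z Et => eq_ind_r (fun x => x <= _) (Fk t z Et).1 (normrN _))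
  V1 V2 W1 W2 hV1 hV1h DW1 hV2 hV2h DW2 eta `|M| rot omS omA n
  (le_lt_trans a1 aeta) (lt_le_trans beta b1)
  (le_lt_trans a2 aeta) (lt_le_trans beta b2).
exists z; split; [|exact/dS|exact/dA].
split; first exact/absolutely_continuous_onP.
apply: ae_imply Dz => t Dt tT; have [D1 D2] := Dt tT.
have [dz ->] := is_derive_pair D1 D2; split => //.
by rewrite gE//; case: (F t (z t)) => x y; rewrite /Jrot/= opprK.
Qed.
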